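(* Let $T$ be an ergodic automorphism of a Lebesgue space $(X,\mu)$, $\mu(X)=1$. Suppose that for some real $a\in(0,1)$ and some sequence of integers $k_i\to\infty$ one has the weak operator convergence on $L_2(\mu)$ $$\widehat{T}^{k_i}\to aI+(1-a)\widehat{T}.$$ Then: (1) the spectral measure $\sigma$ of $\widehat{T}$ and the convolution $\sigma\ast\sigma$ are disjoint (mutually singular); (2) if, in addition, $T$ has a simple spectrum, then $T\times T$ has a homogeneous spectrum of multiplicity $2$.
   Context: A Lebesgue space here is a probability space isomorphic mod 0 to the unit interval with Lebesgue measure; an automorphism $T$ is an invertible (mod 0) bimeasurable measure-preserving map. The induced unitary operator (Koopman operator) on $L_2(\mu)$ (complex-valued) is $\widehat{T}f(x)=f(Tx)$, and $I$ is the identity operator. Let $H=\{f\in L_2(\mu):\int f\,d\mu=0\}$. The spectral measure $\sigma=\sigma_T$ is (a finite Borel measure on the unit circle representing) the maximal spectral type of the restriction of $\widehat{T}$ to $H$; the convolution $\sigma\ast\sigma$ is taken on the circle group. $T$ has a simple spectrum if $\widehat{T}|_H$ has a cyclic vector, i.e. there is $f\in H$ such that the closed linear span of $\{\widehat{T}^n f:n\in\mathbb{Z}\}$ is $H$. $(T\times T)(x,y)=(Tx,Ty)$ acts on $(X\times X,\mu\times\mu)$. It has a homogeneous spectrum of multiplicity $2$ if the spectral multiplicity function of the unitary operator $\widehat{T}\otimes\widehat{T}$, restricted to the orthogonal complement of the constants in $L_2(\mu\times\mu)$, equals $2$ almost everywhere with respect to the maximal spectral type of that restriction. *)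

(* Defs.v *)
From HB Require Import structures.
From mathcomp Require Import all_boot all_order all_algebra.
From mathcomp Require Import all_classical all_reals all_analysis.
From mathcomp Require Import measurable_realfun complex.

Set Implicit Arguments.
Unset Strict Implicit.
Unset Printing Implicit Defensive.

Import Order.TTheory GRing.Theory Num.Theory.
Import numFieldNormedType.Exports.

Local Open Scope classical_set_scope.
Local Open Scope ring_scope.
Local Open Scope complex_scope.

Section lebesgue_space.
Context {d : measure_display} {X : measurableType d} {R : realType}.

(* [phi] and [psi] are the two directions of an isomorphism mod 0 with the unit
   interval; the values of [psi] outside [0, 1] are irrelevant.  The interval
   carries the Lebesgue (completed) sigma-algebra on the source side of [psi],
   so that both standard Borel spaces and their completions are covered. *)
Definition lebesgue_space (mu : probability X R) : Prop :=
  exists (phi : X -> R) (psi : R -> X),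
    [/\ measurable_fun setT phi /\
          (forall B : set R, measurable B ->
            mu (phi @^-1` B) = lebesgue_measure (B `&` `[0, 1])),
        (forall A : set X, measurable A ->
          completed_algebra_gen (@lebesgue_measure R)
            (`[0, 1] `&` psi @^-1` A) /\
          completed_lebesgue_measure (`[0, 1] `&` psi @^-1` A) = mu A),
        (\forall x \ae mu, psi (phi x) = x) &
        (\forall t \ae (@lebesgue_measure R),
          t \in `[0, 1] -> phi (psi t) = t)].

End lebesgue_space.

Record automorphism {d : measure_display} {X : measurableType d}
    {R : realType} (mu : probability X R) := Automorphism {
  aut_fun :> X -> X ;
  aut_inv : X -> X ;
  aut_measurable : measurable_fun setT aut_fun ;
  aut_inv_measurable : measurable_fun setT aut_inv ;
  aut_preserving : forall A : set X, measurable A ->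
    mu (aut_fun @^-1` A) = mu A ;
  aut_funK : \forall x \ae mu, aut_inv (aut_fun x) = x ;
  aut_invK : \forall x \ae mu, aut_fun (aut_inv x) = x
}.

Definition ergodic {d : measure_display} {X : measurableType d}
    {R : realType} {mu : probability X R} (T : automorphism mu) : Prop :=
  forall A : set X, measurable A -> T @^-1` A = A ->
    mu A = 0%E \/ mu A = 1%E.

Section product_automorphism.
Local Open Scope ereal_scope.
Context {d1 d2 : measure_display} {X : measurableType d1}
  {Y : measurableType d2} {R : realType}.
Context {mu : probability X R} {nu : probability Y R}.
Variables (T : automorphism mu) (S : automorphism nu).

Let prod_fun (f : X -> X) (g : Y -> Y) (z : X * Y) := (f z.1, g z.2).

Let prod_fun_measurable f g : measurable_fun setT f -> measurable_fun setT g ->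
  measurable_fun setT (prod_fun f g).
Proof.
move=> mf mg; apply/measurable_fun_pairP; split.
  exact: (measurableT_comp mf measurable_fst).
exact: (measurableT_comp mg measurable_snd).
Qed.

Let mTS : measurable_fun setT (prod_fun T S).
Proof. exact: prod_fun_measurable (aut_measurable T) (aut_measurable S). Qed.

Let prod_preserving (A : set (X * Y)) : measurable A ->
  (mu \x nu) (prod_fun T S @^-1` A) = (mu \x nu) A.
Proof.
move=> mA; apply/esym.
pose F : {mfun (X * Y)%type >-> (X * Y)%type} := mfun_Sub (mem_set mTS).
apply: etrans (_ : distribution (mu \x nu) F A = _); last by [].
apply: product_measure_unique => // B D mB mD.
rewrite /distribution /pushforward /=.
have -> : prod_fun T S @^-1` (B `*` D) = (T @^-1` B) `*` (S @^-1` D) by [].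
have mTB : measurable (T @^-1` B).
  by rewrite -[X in measurable X]setTI; exact: (aut_measurable T).
have mSD : measurable (S @^-1` D).
  by rewrite -[X in measurable X]setTI; exact: (aut_measurable S).
rewrite product_measure1E//.
by congr (_ * _); [exact: (aut_preserving T)|exact: (aut_preserving S)].
Qed.

Let prod_ae (f : X -> X) (g : Y -> Y) :
  (\forall x \ae mu, f x = x) -> (\forall y \ae nu, g y = y) ->
  \forall z \ae (mu \x nu), prod_fun f g z = z.
Proof.
move=> [A [mA A0 fA]] [B [mB B0 gB]].
exists ((A `*` setT) `|` (setT `*` B)); split.
- by apply: measurableU; exact: measurableX.
- apply/eqP; rewrite -measure_le0.
  apply: (le_trans (measureU2 _ _ _)); [exact: measurableX|exact: measurableX|].
  have eA : (mu \x nu) (A `*` setT) = 0.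
    rewrite product_measure1E//.
    by apply: (etrans (congr1 (fun t => t * _) A0)); rewrite mul0e.
  have eB : (mu \x nu) (setT `*` B) = 0.
    rewrite product_measure1E//.
    by apply: (etrans (congr1 (fun t => _ * t) B0)); rewrite mule0.
  rewrite (_ : _ + _ = 0)//.
  by apply: etrans (congr2 (fun s t => s + t) eA eB) (adde0 _).
- move=> [x y] /= nxy.
  have [Ax|nAx] := pselect (A x); first by left.
  right; split => //; apply: gB => /= gy; apply: nAx; apply: fA => /= fx.
  by apply: nxy; rewrite /prod_fun/= fx gy.
Qed.

Definition prod_automorphism : automorphism (mu \x nu) :=
  @Automorphism _ _ _ (mu \x nu) (prod_fun T S)
    (prod_fun (aut_inv T) (aut_inv S)) mTS
    (prod_fun_measurable (aut_inv_measurable T) (aut_inv_measurable S))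
    prod_preserving
    (prod_ae (aut_funK T) (aut_funK S))
    (prod_ae (aut_invK T) (aut_invK S)).

End product_automorphism.

(* Vectors of L2 are represented by functions; no quotient is taken, since every
   notion below only depends on classes of functions modulo a.e. equality. *)

Section complex_L2.
Context {d : measure_display} {X : measurableType d} {R : realType}.
Variable mu : {measure set X -> \bar R}.
Local Notation C := R[i].

Definition cintegral (f : X -> C) : C :=
  (\int[mu]_x complex.Re (f x)) +i* (\int[mu]_x complex.Im (f x)).

Definition L2 (f : X -> C) : Prop :=
  (fun x => complex.Re (f x)) \in Lfun mu 2%:E /\
  (fun x => complex.Im (f x)) \in Lfun mu 2%:E.

Definition inner (f g : X -> C) : C := cintegral (fun x => f x * (g x)^*).

Definition l2norm (f : X -> C) : R := Num.sqrt (complex.Re (inner f f)).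

(* the orthogonal complement of the constants *)
Definition L2_0 (f : X -> C) : Prop := L2 f /\ cintegral f = 0.

Definition closed_span (S : set (X -> C)) : set (X -> C) :=
  [set g | L2 g /\ forall eps : R, 0 < eps ->
    exists (n : nat) (c : 'I_n -> C) (h : 'I_n -> X -> C),
      (forall i, S (h i)) /\
      l2norm (fun x => g x - \sum_(i < n) c i * h i x) < eps].

Definition weak_operator_cvg (U : nat -> (X -> C) -> (X -> C))
    (V : (X -> C) -> (X -> C)) : Prop :=
  forall f g : X -> C, L2 f -> L2 g ->
    (fun i => inner (U i f) g : C^o) @ \oo --> (inner (V f) g : C^o).

End complex_L2.

Section koopman.
Context {d : measure_display} {X : measurableType d} {R : realType}.
Context {mu : probability X R}.
Variable T : automorphism mu.
Local Notation C := R[i].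

Definition koopman (f : X -> C) : X -> C := f \o T.

Definition koopman_inv (f : X -> C) : X -> C := f \o aut_inv T.

Definition koopman_pow (n : int) (f : X -> C) : X -> C :=
  match n with
  | Posz m => iter m koopman f
  | Negz m => iter m.+1 koopman_inv f
  end.

Definition orbit (f : X -> C) : set (X -> C) := range (koopman_pow ^~ f).

Definition simple_spectrum : Prop :=
  exists f : X -> C, L2_0 mu f /\ L2_0 mu `<=` closed_span mu (orbit f).

End koopman.

Record unit_circle (R : realType) : Type := UnitCircle {
  circle_val : R[i] ;
  circle_norm : `|circle_val| == 1
}.

HB.instance Definition _ (R : realType) := [isSub for @circle_val R].
HB.instance Definition _ (R : realType) := [Choice of unit_circle R by <:].
HB.instance Definition _ (R : realType) :=
  isPointed.Build (unit_circle R) (UnitCircle (introT eqP (@normr1 R[i]))).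

(* Borel sigma-algebra: traces of the Borel sets of the plane *)
Definition circle (R : realType) :=
  g_sigma_algebra_preimageType (fun z : unit_circle R =>
    (complex.Re (circle_val z), complex.Im (circle_val z)) : R * R).

Section circle.
Context {R : realType}.

Fact circle_mul_subproof (z w : circle R) :
  `|circle_val z * circle_val w| == 1.
Proof. by rewrite normrM (eqP (circle_norm z)) (eqP (circle_norm w)) mulr1. Qed.

Definition circle_mul (z w : circle R) : circle R :=
  UnitCircle (circle_mul_subproof z w).

Definition convolution (sigma tau : {finite_measure set (circle R) -> \bar R}) :
    set (circle R) -> \bar R :=
  pushforward (sigma \x tau)%E
    (fun p : circle R * circle R => circle_mul p.1 p.2).

End circle.

Section measure_relations.
Context {d : measure_display} {Y : measurableType d} {R : realType}.
Implicit Types mu nu : set Y -> \bar R.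

Definition mutually_singular mu nu : Prop :=
  exists A, [/\ measurable A, mu A = 0%E & nu (~` A) = 0%E].

Definition equivalent_measures mu nu : Prop := mu `<< nu /\ nu `<< mu.

End measure_relations.

Section spectral.
Context {d : measure_display} {X : measurableType d} {R : realType}.
Context {mu : probability X R}.
Variable T : automorphism mu.
Local Notation C := R[i].
Local Notation circle_measure := {finite_measure set (circle R) -> \bar R}.

(* such a [rho] exists by Herglotz' theorem, and is unique since a finite measure
   on the circle is determined by its Fourier coefficients *)
Definition spectral_measure_of (f : X -> C) (rho : circle_measure) : Prop :=
  forall n : int, inner mu (koopman_pow T n f) f =
    cintegral rho (fun z => circle_val z ^ n).

Definition maximal_spectral_type (sigma : circle_measure) : Prop :=
  (forall (f : X -> C) (rho : circle_measure),
    L2_0 mu f -> spectral_measure_of f rho -> rho `<< sigma) /\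
  (exists (f : X -> C) (rho : circle_measure),
    [/\ L2_0 mu f, spectral_measure_of f rho & sigma `<< rho]).

(* Hahn-Hellinger: the zero-mean space is the orthogonal sum of the cyclic
   spaces of [f 0], [f 1], ..., the spectral measure of [f n] has the type of
   the restriction of [sigma] to [A n], the sets [A n] decrease, and the
   multiplicity at [z] is the number of [n] such that [z] is in [A n].  Some
   [f n] may vanish, so finite multiplicity is included. *)
Definition multiplicity_function (sigma : circle_measure)
    (M : circle R -> \bar R) : Prop :=
  maximal_spectral_type sigma /\
  exists (f : nat -> X -> C) (A : nat -> set (circle R))
      (mA : forall n, measurable (A n)),
    [/\ (forall n, L2_0 mu (f n)) /\
          (forall m n, m <> n -> forall g h,
            orbit T (f m) g -> orbit T (f n) h -> inner mu g h = 0),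
        L2_0 mu `<=` closed_span mu (\bigcup_n orbit T (f n)),
        (forall n, A n.+1 `<=` A n),
        (forall n, exists rho : circle_measure,
          spectral_measure_of (f n) rho /\
          equivalent_measures rho (mrestr sigma (mA n))) &
        (forall z, M z = (\sum_(0 <= n <oo) (\1_(A n) z)%:E)%E)].

Definition homogeneous_spectrum (m : nat) : Prop :=
  exists (sigma : circle_measure) (M : circle R -> \bar R),
    multiplicity_function sigma M /\ \forall z \ae sigma, M z = m%:R%:E.

End spectral.

(* Main.v *)
From HB Require Import structures.
From Pilot Require Import Defs.
From mathcomp Require Import all_boot all_order all_algebra.
From mathcomp Require Import all_classical all_reals all_analysis.
From mathcomp Require Import measurable_realfun complex.
From mathcomp Require Import ring lra.
Set Implicit Arguments.
Unset Strict Implicit.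
Unset Printing Implicit Defensive.
Import Order.TTheory GRing.Theory Num.Theory.
Import numFieldNormedType.Exports.
Local Open Scope classical_set_scope.
Local Open Scope complex_scope.
Local Open Scope ring_scope.

(** Let [U] be the Koopman operator of [T], let [f] have mean zero and let [rho] be its
    spectral measure, so that [U] acts on the cyclic space of [f] as multiplication by the
    coordinate [z] on [L2(rho)].  The hypothesis says that [z^(k i)] converges weakly there to
    [v(z) = a + (1 - a) z].  On the torus, for a product measure, the powers [(zw)^(k i)] thus
    converge weakly to
      [v(z) v(w) = a^2 + a (1 - a) (z + w) + (1 - a)^2 zw],
    and as weak limits of bounded sequences of a subspace lie in its closure
    ([closed_span_weak]), a closed subspace that is stable under multiplication by [zw] is also
    stable under multiplication by [z + w] ([diag_stable_sum]), hence by every symmetric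
    polynomial.  Both parts of the theorem come from this fact.

    Part (1).  Take the product of [rho] with [rho] plus a point mass at [1].  The closed span
    of the powers of [zw] contains the products of [1 - ((1 + z)/2)^(2^j)] and
    [1 - ((1 + w)/2)^(2^j)], and therefore their limit, the indicator of [w <> 1], since [rho]
    does not charge [1] by ergodicity ([spectral_measure_no_mass1]).  So there are polynomials
    [p] with [p(zw)] close to [0] for [rho \x rho] while [p(z)] is close to [1] for [rho]
    ([separating_polynomial]).  Along a fast sequence of such polynomials the Borel-Cantelli
    lemma produces a set that carries [rho] and is null for its convolution square
    ([spectral_type_singular]).

    Part (2).  Let [f] be cyclic.  The square is generated by the two vectors
      [f (x) 1 + f (x) f]   and   [1 (x) f + (f (x) U f - U f (x) f)],
    whose cyclic spaces are orthogonal.  The separating polynomials split off the components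
    [f (x) 1] and [1 (x) f].  What remains is the tensor square of [L2(rho)]: there [f (x) f]
    corresponds to [1] and spans all symmetric polynomials under the powers of [zw]
    ([closed_span_symmetric]), and the other component corresponds to [w - z] and spans all
    antisymmetric ones ([closed_span_antisymmetric]).  The two vectors have equivalent spectral
    measures.  One direction follows from the symmetry between the factors; for the other, the
    weak limit of [(z/w)^(k i)] shows that the constant [1] is a limit of multiples of [z - w]
    ([closed_span_diff_cst1]).  Hence the multiplicity is [2] everywhere.

    Three results support the argument.  Every vector has a spectral measure ([herglotz]): the
    squared norms of the discrete Fourier transforms of finite stretches of its orbit are the
    masses of atomic measures, of which a limit is taken by Helly's selection theorem.  The
    vectors whose spectral measure does not charge a given set form a closed invariant subspace
    ([spectral_null_closed_span]), which stands in for a functional calculus.  And an almost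
    invariant Cauchy sequence of mean zero functions tends to zero under an ergodic map
    ([mean_ergodic_null]). *)

(** * Squared moduli and the complex L2 space *)

Section complex_parts.
Context {R : realType}.
Implicit Types x y : R[i].
Local Notation Re := complex.Re.
Local Notation Im := complex.Im.

Lemma ReD x y : Re (x + y) = Re x + Re y.
Proof. by case: x y => ? ? []. Qed.

Lemma ImD x y : Im (x + y) = Im x + Im y.
Proof. by case: x y => ? ? []. Qed.

Lemma ReM x y : Re (x * y) = Re x * Re y - Im x * Im y.
Proof. by case: x y => ? ? []. Qed.

Lemma ImM x y : Im (x * y) = Re x * Im y + Im x * Re y.
Proof. by case: x y => ? ? [] ? ? /=; rewrite addrC. Qed.

Lemma ReN x : Re (- x) = - Re x. Proof. by case: x. Qed.

Lemma ImN x : Im (- x) = - Im x. Proof. by case: x. Qed.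

Lemma ReJ x : Re x^* = Re x. Proof. by case: x. Qed.

Lemma ImJ x : Im x^* = - Im x. Proof. by case: x. Qed.

Lemma ReC (r : R) : Re r%:C = r. Proof. by []. Qed.

Lemma ImC (r : R) : Im r%:C = 0. Proof. by []. Qed.

Lemma complex_ext x y : Re x = Re y -> Im x = Im y -> x = y.
Proof. by case: x y => ? ? [? ?] /= -> ->. Qed.

Lemma conjC_real (r : R) : (r%:C)^* = r%:C.
Proof. by apply: complex_ext; rewrite ?ReJ ?ImJ //= oppr0. Qed.

Definition ReImE := (ReD, ImD, ReN, ImN, ReM, ImM, ReJ, ImJ, ReC, ImC).

Definition sqc x : R := Re x ^+ 2 + Im x ^+ 2.

Lemma sqc_ge0 x : 0 <= sqc x.
Proof. by rewrite addr_ge0// sqr_ge0. Qed.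

Lemma sqcN x : sqc (- x) = sqc x.
Proof. by rewrite /sqc ReN ImN !sqrrN. Qed.

Lemma sqcM x y : sqc (x * y) = sqc x * sqc y.
Proof. by rewrite /sqc !ReImE; ring. Qed.

Lemma sqcE x : x * x^* = (sqc x)%:C.
Proof. by apply: complex_ext; rewrite !ReImE /sqc; ring. Qed.

Lemma sqcD2 x y : sqc (x + y) <= 2 * sqc x + 2 * sqc y.
Proof.
rewrite /sqc !ReImE.
have := sqr_ge0 (Re x - Re y); have := sqr_ge0 (Im x - Im y).
by rewrite !expr2; lra.
Qed.

End complex_parts.

Section L2_toolbox.
Context {d : measure_display} {Y : measurableType d} {R : realType}.
Variable m : {measure set Y -> \bar R}.
Local Notation C := R[i].
Local Notation Re := complex.Re.
Local Notation Im := complex.Im.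
Implicit Types f g h : Y -> C.

Lemma Lfun2P (u : Y -> R) : u \in Lfun m 2%:E <->
  measurable_fun setT u /\ m.-integrable setT (fun x => (u x ^+ 2)%:E).
Proof.
split.
  move=> u2; split; last exact: Lfun2_integrable_sqr.
  by have /sub_Lfun_mfun := u2; rewrite inE.
move=> [mu iu]; rewrite inE; apply/andP; split; first by rewrite inE.
rewrite inE /= /finite_norm unlock /=.
rewrite /=; apply: poweR_lty.
have /integrableP[_] := iu; apply: le_lt_trans.
rewrite le_eqVlt; apply/orP; left; apply/eqP; apply: eq_integral => x _.
by rewrite powR_mulrn// real_normK ?num_real//= ger0_norm// sqr_ge0.
Qed.

Definition cmeasurable f :=
  measurable_fun setT (fun x => Re (f x)) /\ measurable_fun setT (fun x => Im (f x)).

Lemma L2_cmeasurable f : L2 m f -> cmeasurable f.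
Proof. by case=> /Lfun2P[? _] /Lfun2P[? _]. Qed.

Lemma cmeasurableD f g : cmeasurable f -> cmeasurable g ->
  cmeasurable (fun x => f x + g x).
Proof.
move=> [f1 f2] [g1 g2]; split; under eq_fun do rewrite !ReImE.
  exact: measurable_funD.
exact: measurable_funD.
Qed.

Lemma cmeasurableM f g : cmeasurable f -> cmeasurable g ->
  cmeasurable (fun x => f x * g x).
Proof.
move=> [f1 f2] [g1 g2]; split; under eq_fun do rewrite !ReImE.
  by apply: measurable_funB; exact: measurable_funM.
by apply: measurable_funD; exact: measurable_funM.
Qed.

Lemma cmeasurableJ f : cmeasurable f -> cmeasurable (fun x => (f x)^*).
Proof.
move=> [f1 f2]; split; under eq_fun do rewrite !ReImE.
  exact: f1.
exact: (measurableT_comp (@oppr_measurable _ setT) f2).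
Qed.

Lemma cmeasurable_cst (c : C) : cmeasurable (fun=> c).
Proof. by split; exact: measurable_cst. Qed.

Lemma measurable_sqc f : cmeasurable f -> measurable_fun setT (fun x => sqc (f x)).
Proof. by move=> [f1 f2]; apply: measurable_funD; exact: measurable_funX. Qed.

Lemma L2P f : L2 m f <->
  cmeasurable f /\ m.-integrable setT (fun x => (sqc (f x))%:E).
Proof.
split=> [[/Lfun2P[mR iR] /Lfun2P[mI iI]]|[[mR mI] iS]].
  split=> //; have := integrableD measurableT iR iI.
  by apply: eq_integrable => // x _; rewrite /= EFinD.
split; apply/Lfun2P; split=> //.
- apply: le_integrable iS => //.
    by apply/measurable_EFinP; exact: measurable_funX.
  move=> x _; rewrite /= lee_fin !ger0_norm ?sqr_ge0 ?sqc_ge0//.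
  by rewrite lerDl sqr_ge0.
- apply: le_integrable iS => //.
    by apply/measurable_EFinP; exact: measurable_funX.
  move=> x _; rewrite /= lee_fin !ger0_norm ?sqr_ge0 ?sqc_ge0//.
  by rewrite lerDr sqr_ge0.
Qed.

Lemma L2_le f (u : Y -> R) : cmeasurable f -> m.-integrable setT (EFin \o u) ->
  (forall x, sqc (f x) <= u x) -> L2 m f.
Proof.
move=> mf iu fu; apply/L2P; split => //; apply: le_integrable iu => //.
  by apply/measurable_EFinP; exact: measurable_sqc.
move=> x _; rewrite /= lee_fin ger0_norm ?sqc_ge0//.
exact: (le_trans (fu x) (ler_norm _)).
Qed.

Lemma L2D f g : L2 m f -> L2 m g -> L2 m (fun x => f x + g x).
Proof.
move=> /L2P[mf ifi] /L2P[mg ig].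
apply: (@L2_le _ (fun x => 2 * sqc (f x) + 2 * sqc (g x))).
- exact: cmeasurableD.
- have := integrableD measurableT (integrableZl measurableT 2 ifi) (integrableZl measurableT 2 ig).
  by apply: eq_integrable => // x _; rewrite /= EFinD !EFinM.
- by move=> x; exact: sqcD2.
Qed.

Lemma L2Z (c : C) f : L2 m f -> L2 m (fun x => c * f x).
Proof.
move=> /L2P[mf ifi].
apply: (@L2_le _ (fun x => sqc c * sqc (f x))).
- by apply: cmeasurableM => //; exact: cmeasurable_cst.
- have := integrableZl measurableT (sqc c) ifi.
  by apply: eq_integrable => // x _; rewrite /= EFinM.
- by move=> x; rewrite sqcM.
Qed.

Lemma L2N f : L2 m f -> L2 m (fun x => - f x).
Proof.
move=> /(L2Z (-1)); rewrite (_ : (fun _ => _) = (fun x => - f x))//.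
by apply/funext => x; rewrite mulN1r.
Qed.

Lemma L2B f g : L2 m f -> L2 m g -> L2 m (fun x => f x - g x).
Proof. by move=> mf /L2N; exact: L2D. Qed.

Lemma L2_0fun : L2 m (fun=> 0).
Proof.
apply/L2P; split; first exact: cmeasurable_cst.
have := @integrable0 _ _ _ m setT; apply: eq_integrable => // x _.
by rewrite /= /sqc /= expr0n /= addr0.
Qed.

Lemma L2_sum n (c : 'I_n -> C) (h : 'I_n -> Y -> C) :
  (forall i, L2 m (h i)) -> L2 m (fun x => \sum_(i < n) c i * h i x).
Proof.
elim: n c h => [|n IH] c h mh.
  by under eq_fun do rewrite big_ord0; exact: L2_0fun.
under eq_fun do rewrite big_ord_recr.
by apply: L2D; [exact: IH|exact: L2Z].
Qed.

Definition cintegrable f :=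
  m.-integrable setT (fun x => (Re (f x))%:E) /\
  m.-integrable setT (fun x => (Im (f x))%:E).

Lemma cintegrable_mul f g : L2 m f -> L2 m g -> cintegrable (fun x => f x * (g x)^*).
Proof.
move=> [f1 f2] [g1 g2].
have P u v : u \in Lfun m 2%:E -> v \in Lfun m 2%:E ->
    m.-integrable setT (fun x => (u x * v x)%:E).
  by move=> u2 v2; apply/Lfun1_integrable; exact: Lfun2_mul_Lfun1.
split.
  have := integrableD measurableT (P _ _ f1 g1) (P _ _ f2 g2).
  by apply: eq_integrable => // x _; rewrite !ReImE /= -EFinD; congr EFin; ring.
have := integrableB measurableT (P _ _ f2 g1) (P _ _ f1 g2).
by apply: eq_integrable => // x _; rewrite !ReImE /= -EFinB; congr EFin; ring.
Qed.

Lemma cintegralD f g : cintegrable f -> cintegrable g ->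
  cintegral m (fun x => f x + g x) = cintegral m f + cintegral m g.
Proof.
move=> [f1 f2] [g1 g2]; apply: complex_ext; rewrite !ReImE /=.
  by rewrite -RintegralD//; apply: eq_Rintegral => x _; rewrite ReD.
by rewrite -RintegralD//; apply: eq_Rintegral => x _; rewrite ImD.
Qed.

Lemma cintegralZ (c : C) f : cintegrable f ->
  cintegral m (fun x => c * f x) = c * cintegral m f.
Proof.
move=> [f1 f2]; apply: complex_ext; rewrite !ReImE /=.
  rewrite -!RintegralZl// -RintegralB//; last 2 first.
  - by have := integrableZl measurableT (Re c) f1; apply: eq_integrable => // x _; rewrite /= EFinM.
  - by have := integrableZl measurableT (Im c) f2; apply: eq_integrable => // x _; rewrite /= EFinM.
  by apply: eq_Rintegral => x _; rewrite ReM.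
rewrite -!RintegralZl// -RintegralD//; last 2 first.
- by have := integrableZl measurableT (Re c) f2; apply: eq_integrable => // x _; rewrite /= EFinM.
- by have := integrableZl measurableT (Im c) f1; apply: eq_integrable => // x _; rewrite /= EFinM.
by apply: eq_Rintegral => x _; rewrite ImM.
Qed.

Lemma cintegralJ f : cintegrable f ->
  cintegral m (fun x => (f x)^*) = (cintegral m f)^*.
Proof.
move=> [f1 f2]; apply: complex_ext; rewrite !ReImE /=.
  by apply: eq_Rintegral => x _; rewrite ReJ.
rewrite -mulN1r -RintegralZl//; apply: eq_Rintegral => x _.
by rewrite ImJ mulN1r.
Qed.

Lemma innerDl f g h : L2 m f -> L2 m g -> L2 m h ->
  inner m (fun x => f x + g x) h = inner m f h + inner m g h.
Proof.
move=> mf mg mh; rewrite /inner -cintegralD; [|exact: cintegrable_mul..].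
by congr cintegral; apply/funext => x; rewrite mulrDl.
Qed.

Lemma innerZl (c : C) f h : L2 m f -> L2 m h ->
  inner m (fun x => c * f x) h = c * inner m f h.
Proof.
move=> mf mh; rewrite /inner -cintegralZ; last exact: cintegrable_mul.
by congr cintegral; apply/funext => x; rewrite mulrA.
Qed.

Lemma innerC f g : L2 m f -> L2 m g -> inner m g f = (inner m f g)^*.
Proof.
move=> mf mg; rewrite /inner -cintegralJ; last exact: cintegrable_mul.
by congr cintegral; apply/funext => x; rewrite rmorphM/= conjCK mulrC.
Qed.

Lemma innerDr f g h : L2 m f -> L2 m g -> L2 m h ->
  inner m h (fun x => f x + g x) = inner m h f + inner m h g.
Proof.
move=> mf mg mh; rewrite innerC ?innerDl//; last exact: L2D.
by rewrite rmorphD/= -!innerC.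
Qed.

Lemma innerZr (c : C) f h : L2 m f -> L2 m h ->
  inner m h (fun x => c * f x) = c^* * inner m h f.
Proof.
move=> mf mh; rewrite innerC ?innerZl//; last exact: L2Z.
by rewrite rmorphM/= -innerC.
Qed.

Lemma inner_suml n (c : 'I_n -> C) (h : 'I_n -> Y -> C) g :
  (forall i, L2 m (h i)) -> L2 m g ->
  inner m (fun x => \sum_(i < n) c i * h i x) g = \sum_(i < n) c i * inner m (h i) g.
Proof.
move=> + mg; elim: n c h => [|n IH] c h mh.
  rewrite big_ord0; under eq_fun do rewrite big_ord0.
  rewrite /inner -[RHS](mul0r (cintegral m (fun x => g x * (g x)^*))) -cintegralZ.
    by congr cintegral; apply/funext => x; rewrite !mul0r.
  exact: cintegrable_mul.
under eq_fun do rewrite big_ord_recr.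
by rewrite big_ord_recr innerDl ?innerZl ?IH//; [exact: L2_sum|exact: L2Z].
Qed.

Definition nsq f : R := \int[m]_x sqc (f x).

Lemma innerE f : L2 m f -> inner m f f = (nsq f)%:C.
Proof.
move=> mf; apply: complex_ext => /=.
  by apply: eq_Rintegral => x _; rewrite sqcE.
transitivity (\int[m]_x (0 : R)); last by rewrite Rintegral_cst// mul0r.
by apply: eq_Rintegral => x _; rewrite sqcE.
Qed.

Lemma nsq_ge0 f : 0 <= nsq f.
Proof. by apply: Rintegral_ge0 => x _; exact: sqc_ge0. Qed.

Lemma l2normE f : L2 m f -> l2norm m f = Num.sqrt (nsq f).
Proof. by move=> mf; rewrite /l2norm innerE. Qed.

Lemma nsqD f g : L2 m f -> L2 m g ->
  nsq (fun x => f x + g x) = nsq f + nsq g + 2 * Re (inner m f g).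
Proof.
move=> mf mg; have := innerE (L2D mf mg).
rewrite innerDl ?innerDr//; try exact: L2D.
rewrite !innerE// (innerC mf mg) => /(congr1 (@complex.Re R)); rewrite !ReImE => <-; ring.
Qed.

Lemma nsqZ (c : C) f : L2 m f -> nsq (fun x => c * f x) = sqc c * nsq f.
Proof.
move=> mf; have := innerE (L2Z c mf).
rewrite innerZl ?innerZr// ?innerE//; last exact: L2Z.
by rewrite mulrA sqcE => /(congr1 (@complex.Re R)); rewrite !ReImE mulr0 subr0.
Qed.

Lemma nsqN f : nsq (fun x => - f x) = nsq f.
Proof. by apply: eq_Rintegral => x _; rewrite sqcN. Qed.

Lemma nsqBC f g : nsq (fun x => f x - g x) = nsq (fun x => g x - f x).
Proof. by rewrite -nsqN; congr nsq; apply/funext => x; rewrite opprB. Qed.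

Lemma innerNr f g : L2 m f -> L2 m g -> inner m f (fun x => - g x) = - inner m f g.
Proof.
move=> mf mg; rewrite (_ : (fun _ => _) = (fun x => -1 * g x)); last first.
  by apply/funext => x; rewrite mulN1r.
by rewrite innerZr// rmorphN rmorph1 mulN1r.
Qed.

Lemma innerNl f g : L2 m f -> L2 m g -> inner m (fun x => - f x) g = - inner m f g.
Proof.
move=> mf mg; rewrite (_ : (fun _ => _) = (fun x => -1 * f x)); last first.
  by apply/funext => x; rewrite mulN1r.
by rewrite innerZl// mulN1r.
Qed.

Lemma nsqB f g : L2 m f -> L2 m g ->
  nsq (fun x => f x - g x) = nsq f + nsq g - 2 * Re (inner m f g).
Proof.
move=> mf mg; rewrite nsqD//; last exact: L2N.
by rewrite nsqN innerNr// ReN mulrN.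
Qed.

Lemma nsqD2 f g : L2 m f -> L2 m g ->
  nsq (fun x => f x + g x) <= 2 * nsq f + 2 * nsq g.
Proof.
move=> mf mg; rewrite (nsqD mf mg); have := nsqB mf mg.
by have := nsq_ge0 (fun x => f x - g x); lra.
Qed.

Lemma nsq_triangle f g h : L2 m f -> L2 m g -> L2 m h ->
  nsq (fun x => f x - h x) <=
  2 * nsq (fun x => f x - g x) + 2 * nsq (fun x => g x - h x).
Proof.
move=> mf mg mh; apply: le_trans (nsqD2 (L2B mf mg) (L2B mg mh)).
by rewrite (_ : (fun x => f x - h x) = (fun x => f x - g x + (g x - h x)))//;
  apply/funext => x; rewrite addrA subrK.
Qed.

(** A quadratic polynomial that stays above [dlt] bounds its linear coefficient;
    with [dlt = 0] this is the Cauchy-Schwarz inequality. *)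
Lemma Re_inner_sqr_le f g (dlt : R) : L2 m f -> L2 m g ->
  (forall t : R, dlt <= nsq (fun x => f x - t%:C * g x)) ->
  Re (inner m f g) ^+ 2 <= nsq g * (nsq f - dlt).
Proof.
move=> mf mg H.
have E t : nsq (fun x => f x - t%:C * g x) =
    nsq f + t ^+ 2 * nsq g - 2 * t * Re (inner m f g).
  rewrite nsqB ?nsqZ ?innerZr//; last exact: L2Z.
  by rewrite conjC_real /sqc !ReImE; ring.
have [g0|g0] := eqVneq (nsq g) 0.
  rewrite g0 mul0r; have [->|i0] := eqVneq (Re (inner m f g)) 0; first by rewrite expr0n.
  have := H ((nsq f - dlt + 1) / (2 * Re (inner m f g))).
  rewrite E g0 mulr0 addr0 (_ : 2 * _ * _ = nsq f - dlt + 1); last by field.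
  by lra.
have gp : 0 < nsq g by rewrite lt_def g0 nsq_ge0.
have := H (Re (inner m f g) / nsq g); rewrite E => H'.
have : 0 <= nsq g * (nsq f - dlt - Re (inner m f g) ^+ 2 / nsq g).
  rewrite mulr_ge0 ?nsq_ge0//.
  rewrite subr_ge0 lerBrDr -lerBrDl; apply: le_trans H' _.
  by rewrite le_eqVlt; apply/orP; left; apply/eqP; field.
by rewrite mulrBr (_ : nsq g * (_ / _) = Re (inner m f g) ^+ 2); [lra|field].
Qed.

Lemma Re_inner_CS f g : L2 m f -> L2 m g ->
  Re (inner m f g) ^+ 2 <= nsq f * nsq g.
Proof.
move=> mf mg; have := @Re_inner_sqr_le f g 0 mf mg (fun t => nsq_ge0 _).
by rewrite subr0 mulrC.
Qed.

End L2_toolbox.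

Lemma cmeasurable_comp (R : realType) d (Y : measurableType d) d' (Z : measurableType d')
    (T : Z -> Y) (f : Y -> R[i]) :
  measurable_fun setT T -> cmeasurable f -> cmeasurable (fun x => f (T x)).
Proof.
by move=> mT [mR mI]; split; [exact: (measurableT_comp mR)|exact: (measurableT_comp mI)].
Qed.

(** * Spans and their closures *)

Section closed_span_theory.
Context {d : measure_display} {Y : measurableType d} {R : realType}.
Variable m : {measure set Y -> \bar R}.
Local Notation C := R[i].
Implicit Types (f g h s : Y -> C) (S : set (Y -> C)).

(** Combinations are built one term at a time, so that statements about spans are proved by
    induction on a derivation; [lspanP] relates this to sums over ordinals. *)
Inductive lspan S : (Y -> C) -> Prop :=
| lspan0 : lspan S (fun=> 0)
| lspanS c h s : S h -> lspan S s -> lspan S (fun x => c * h x + s x).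

Lemma lspanP S g : lspan S g <-> exists (n : nat) (c : 'I_n -> C) (h : 'I_n -> Y -> C),
  (forall i, S (h i)) /\ g = (fun x => \sum_(i < n) c i * h i x).
Proof.
split=> [|[n [c [h [+ ->]]]]].
  elim=> [|c0 h0 s Sh0 _ [n [c [h [Sh ->]]]]].
    exists 0, (fun=> 0), (fun=> fun=> 0); split; first by case.
    by apply/funext => x; rewrite big_ord0.
  exists n.+1, (fun i => if unlift ord0 i is Some j then c j else c0),
    (fun i => if unlift ord0 i is Some j then h j else h0); split.
    by move=> i; case: unliftP.
  apply/funext => x; rewrite big_ord_recl unlift_none; congr (_ + _).
  by apply: eq_bigr => i _; rewrite liftK.
elim: n c h => [|n IH] c h Sh.
  by under eq_fun do rewrite big_ord0; exact: lspan0.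
under eq_fun do rewrite big_ord_recl.
by apply: lspanS => //; exact: IH.
Qed.

Lemma lspan_eq S f g : lspan S f -> f =1 g -> lspan S g.
Proof. by move=> Sf /funext <-. Qed.

Lemma lspanD S f g : lspan S f -> lspan S g -> lspan S (fun x => f x + g x).
Proof.
move=> + Sg; elim=> [|c h s Sh _ IH]; first by under eq_fun do rewrite add0r.
by under eq_fun do rewrite -addrA; exact: lspanS.
Qed.

Lemma lspanZ S (a : C) f : lspan S f -> lspan S (fun x => a * f x).
Proof.
elim=> [|c h s Sh _ IH]; first by under eq_fun do rewrite mulr0; exact: lspan0.
by under eq_fun do rewrite mulrDr mulrA; exact: lspanS.
Qed.

Lemma lspan_gen S h : S h -> lspan S h.
Proof.
move=> Sh; have := @lspanS S 1 h _ Sh (lspan0 S).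
by under eq_fun do rewrite mul1r addr0.
Qed.

Lemma lspanB S f g : lspan S f -> lspan S g -> lspan S (fun x => f x - g x).
Proof.
move=> Sf Sg; have := lspanD Sf (lspanZ (-1) Sg).
by under eq_fun do rewrite mulN1r.
Qed.

Lemma lspan_trans S S' s : (forall h, S h -> lspan S' h) -> lspan S s -> lspan S' s.
Proof.
move=> SS'; elim=> [|c h t Sh _ IH]; first exact: lspan0.
by apply: lspanD => //; apply: lspanZ; exact: SS'.
Qed.

Lemma lspan_L2 S s : (forall h, S h -> L2 m h) -> lspan S s -> L2 m s.
Proof.
move=> SL; elim=> [|c h t Sh _ IH]; first exact: L2_0fun.
by apply: L2D => //; apply: L2Z; exact: SL.
Qed.

Section products.
Variable S : set (Y -> C).
Hypothesis S1 : S (fun=> 1).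
Hypothesis SM : forall f g, S f -> S g -> S (fun x => f x * g x).

Lemma lspan_mul f g : lspan S f -> lspan S g -> lspan S (fun x => f x * g x).
Proof.
move=> + Sg; elim=> [|c h s Sh _ IH].
  by apply: lspan_eq (lspan0 _) _ => x; rewrite mul0r.
apply: (@lspan_eq _ (fun x => c * (h x * g x) + s x * g x)); last first.
  by move=> x; rewrite mulrDl mulrA.
apply: lspanD => //; apply: lspanZ; elim: Sg {IH} => [|c' h' s' Sh' _ IH].
  by apply: lspan_eq (lspan0 _) _ => x; rewrite mulr0.
apply: (@lspan_eq _ (fun x => c' * (h x * h' x) + h x * s' x)).
  by apply: lspanS => //; exact: SM.
by move=> x; rewrite mulrDr mulrCA.
Qed.

Lemma lspan_cst c : lspan S (fun=> c).
Proof. by apply: lspan_eq (lspanZ c (lspan_gen S1)) _ => x; rewrite mulr1. Qed.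

Lemma lspanX f n : lspan S f -> lspan S (fun x => f x ^+ n).
Proof.
move=> Sf; elim: n => [|n IH]; first exact: lspan_cst.
by apply: lspan_eq (lspan_mul Sf IH) _ => x; rewrite exprS.
Qed.

End products.

Lemma nsq_self f : nsq m (fun x => f x - f x) = 0.
Proof.
rewrite /nsq; under eq_Rintegral do rewrite subrr /sqc /= expr0n /= addr0.
by rewrite Rintegral_cst// mul0r.
Qed.

Section closure.
Variables (S : set (Y -> C)) (SL : forall h, S h -> L2 m h).

Lemma closed_spanP g : closed_span m S g <->
  L2 m g /\ forall e : R, 0 < e -> exists s, lspan S s /\ nsq m (fun x => g x - s x) < e.
Proof.
split=> [[mg H]|[mg H]]; split=> // e e0.
  have se0 : 0 < Num.sqrt e by rewrite sqrtr_gt0.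
  have [n [c [h [Sh]]]] := H _ se0.
  have Ss : lspan S (fun x => \sum_(i < n) c i * h i x) by apply/lspanP; exists n, c, h.
  rewrite l2normE; last by apply: L2B => //; exact: (lspan_L2 SL).
  by rewrite ltr_sqrt// => ?; exists (fun x => \sum_(i < n) c i * h i x).
have [s [Ss]] := H (e ^+ 2) (exprn_gt0 _ e0).
have [n [c [h [Sh E]]]] := (lspanP _ _).1 Ss.
move=> He; exists n, c, h; split=> //.
rewrite E in He Ss.
rewrite l2normE; last by apply: L2B => //; exact: (lspan_L2 SL).
by rewrite -(ltr_pXn2r (n := 2))// ?nnegrE ?sqrtr_ge0// ?ltW// sqr_sqrtr ?nsq_ge0.
Qed.

Lemma closed_span_L2 g : closed_span m S g -> L2 m g.
Proof. by case. Qed.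

Lemma closed_span_eq f g : closed_span m S f -> f =1 g -> closed_span m S g.
Proof. by move=> Sf /funext <-. Qed.

Lemma closed_span_lspan s : lspan S s -> closed_span m S s.
Proof.
move=> Ss; apply/closed_spanP; split; first exact: lspan_L2 Ss.
by move=> e e0; exists s; split=> //; rewrite nsq_self.
Qed.

Lemma closed_span_gen h : S h -> closed_span m S h.
Proof. by move=> /lspan_gen/closed_span_lspan. Qed.

Lemma closed_span_lim g : L2 m g ->
  (forall e : R, 0 < e -> exists2 f, closed_span m S f & nsq m (fun x => g x - f x) < e) ->
  closed_span m S g.
Proof.
move=> mg H; apply/closed_spanP; split=> // e e0.
have e4 : 0 < e / 4 by rewrite divr_gt0.
have [f Sf fe] := H _ e4.
have [mf /(_ _ e4)[s [Ss se]]] := (closed_spanP _).1 Sf.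
exists s; split=> //; apply: le_lt_trans (nsq_triangle mg mf _) _.
  exact: (lspan_L2 SL Ss).
by lra.
Qed.

Lemma closed_spanD f g : closed_span m S f -> closed_span m S g ->
  closed_span m S (fun x => f x + g x).
Proof.
move=> /closed_spanP[mf Sf] /closed_spanP[mg Sg].
apply/closed_spanP; split=> [|e e0]; first exact: L2D.
have e4 : 0 < e / 4 by rewrite divr_gt0.
have [s [Ss se]] := Sf _ e4; have [t [St te]] := Sg _ e4.
exists (fun x => s x + t x); split; first exact: lspanD.
have ms := lspan_L2 SL Ss; have mt := lspan_L2 SL St.
have := nsqD2 (L2B mf ms) (L2B mg mt).
under eq_fun do rewrite addrACA -opprD.
by lra.
Qed.

Lemma closed_spanZ (a : C) f : closed_span m S f -> closed_span m S (fun x => a * f x).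
Proof.
move=> /closed_spanP[mf Sf].
apply/closed_spanP; split=> [|e e0]; first exact: L2Z.
have a1 : 0 < sqc a + 1 by rewrite ltr_wpDl// sqc_ge0.
have [s [Ss se]] := Sf _ (divr_gt0 e0 a1).
exists (fun x => a * s x); split; first exact: lspanZ.
have := nsqZ a (L2B mf (lspan_L2 SL Ss)).
under eq_fun do rewrite mulrBr.
move=> ->; move: se; rewrite ltr_pdivlMr// => se; apply: le_lt_trans se.
by rewrite mulrC ler_wpM2l ?nsq_ge0// lerDl.
Qed.

Lemma closed_span0 : closed_span m S (fun=> 0).
Proof. by apply: closed_span_lspan; exact: lspan0. Qed.

Lemma closed_spanB f g : closed_span m S f -> closed_span m S g ->
  closed_span m S (fun x => f x - g x).
Proof.
move=> Sf Sg; have := closed_spanD Sf (closed_spanZ (-1) Sg).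
by under eq_fun do rewrite mulN1r.
Qed.

Lemma closed_span_null f g : closed_span m S f -> L2 m g ->
  nsq m (fun x => g x - f x) = 0 -> closed_span m S g.
Proof. by move=> Sf mg fg; apply: closed_span_lim => // e e0; exists f; rewrite ?fg. Qed.

(** The distance from [v] to the span is attained in the limit by some [s] for
    which [v - s] is almost orthogonal to the span, uniformly on bounded sets;
    testing against the [w i] in the weak limit shows that [v - s] is almost
    orthogonal to itself. *)
Lemma closed_span_weak v (w : nat -> Y -> C) (B : R) : L2 m v ->
  (forall i, lspan S (w i)) -> (forall i, nsq m (w i) <= B) ->
  (forall u, lspan S u \/ u = v -> forall e : R, 0 < e -> exists i,
     forall j, (i <= j)%N ->
       `|complex.Re (inner m (w j) u) - complex.Re (inner m v u)| < e) ->
  closed_span m S v.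
Proof.
move=> mv Sw wB cvg; apply/closed_spanP; split=> // e e0.
have LS s (Ss : lspan S s) := lspan_L2 SL Ss.
pose D := [set nsq m (fun x => v x - s x) | s in lspan S].
have hD : has_inf D.
  split; first by exists (nsq m (fun x => v x - 0)), (fun=> 0) => //; exact: lspan0.
  by exists 0 => _ [s _ <-]; exact: nsq_ge0.
have dD s : lspan S s -> inf D <= nsq m (fun x => v x - s x).
  by move=> Ss; apply: ge_inf; [case: hD|exists s].
have d0 : 0 <= inf D by apply: lb_le_inf; [case: hD|move=> _ [s _ <-]; exact: nsq_ge0].
have B0 : 0 <= B := le_trans (nsq_ge0 _ _) (wB 0%N).
pose M := 2 * B + 4 * nsq m v + 4 * (inf D + 1) + 1.
have M0 : 0 < M by have := nsq_ge0 m v; rewrite /M; lra.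
pose dl := Num.min 1 (e ^+ 2 / (4 * M)).
have dl0 : 0 < dl by rewrite lt_min ltr01/= divr_gt0 ?exprn_gt0 ?mulr_gt0.
have dlM : M * dl <= (e / 2) ^+ 2.
  have : dl <= e ^+ 2 / (4 * M) by rewrite ge_min lexx orbT.
  rewrite ler_pdivlMr ?mulr_gt0//; rewrite expr_div_n; lra.
have [_ [s Ss <-] sd] := inf_adherent dl0 hD.
exists s; split=> //; have ms := LS _ Ss.
have mu := L2B mv ms; set u := (fun x => v x - s x) in mu sd *.
have e8 : 0 < e / 8 by rewrite divr_gt0.
have [i1 H1] := cvg s (or_introl Ss) _ e8.
have [i2 H2] := cvg v (or_intror erefl) _ e8.
pose j := maxn i1 i2.
have {H1} := H1 j (leq_maxl _ _); have {H2} := H2 j (leq_maxr _ _).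
have mw := LS _ (Sw j).
have mws := L2B mw ms.
have E f : L2 m f -> inner m (fun x => f x - s x) u =
    inner m f v - inner m f s - inner m s u.
  move=> mf; rewrite innerDl ?innerNl//; last exact: L2N.
  by rewrite innerDr ?innerNr//; exact: L2N.
have nu : nsq m u = complex.Re (inner m u u) by rewrite innerE.
have := E _ mv; rewrite -/u => Eu; rewrite Eu !(ReD, ReN) in nu.
have := @Re_inner_sqr_le _ _ _ m u (fun x => w j x - s x) (inf D) mu mws.
rewrite (innerC mws mu) ReJ E// !(ReD, ReN).
have wsM : nsq m (fun x => w j x - s x) <= M.
  have := nsqD2 mw (L2N ms); rewrite nsqN; have := nsqD2 mv (L2N mu); rewrite nsqN.
  under eq_fun do rewrite opprB addrCA subrr addr0.
  have := wB j; have : dl <= 1 by rewrite ge_min lexx.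
  by rewrite /M; lra.
have dt t : inf D <= nsq m (fun x => u x - t%:C * (w j x - s x)).
  have Sst : lspan S (fun x => s x + t%:C * (w j x - s x)).
    by apply: lspanD => //; apply: lspanZ; exact: lspanB.
  by have := dD _ Sst; under eq_fun do rewrite opprD addrA.
move=> /(_ dt) CS.
have {}CS : (complex.Re (inner m (w j) v) - complex.Re (inner m (w j) s)
    - complex.Re (inner m s u)) ^+ 2 <= (e / 2) ^+ 2.
  apply: le_trans CS _; apply: le_trans dlM; apply: ler_pM => //.
  - exact: nsq_ge0.
  - by rewrite subr_ge0; exact: dD.
  - by rewrite lerBlDl ltW.
have {}CS : complex.Re (inner m (w j) v) - complex.Re (inner m (w j) s)
    - complex.Re (inner m s u) <= e / 2.
  apply: le_trans (ler_norm _) _.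
  by rewrite -(ger0_norm (ltW (divr_gt0 e0 (ltr0Sn _ 1)))) -ler_sqr ?nnegrE// !real_normK ?num_real.
by rewrite !ltr_norml => /andP[? ?] /andP[? ?]; lra.
Qed.

End closure.

Lemma closed_span_idem S S' g :
  (forall h, S h -> L2 m h) -> (forall h, S' h -> L2 m h) ->
  (forall h, S h -> closed_span m S' h) -> closed_span m S g -> closed_span m S' g.
Proof.
move=> SL SL' SS' /(closed_spanP SL)[mg Sg].
apply: closed_span_lim => // e /Sg[s [Ss se]]; exists s => //.
elim: Ss {se} => [|c h t Sh _ IH]; first exact: closed_span0.
by apply: closed_spanD => //; apply: closed_spanZ => //; exact: SS'.
Qed.

End closed_span_theory.

Lemma closed_span_map d d' (Y : measurableType d) (Y' : measurableType d') (R : realType)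
    (m : {measure set Y -> \bar R}) (m' : {measure set Y' -> \bar R})
    (F : (Y -> R[i]) -> (Y' -> R[i])) (K : R) S S' g :
  (forall h, S h -> L2 m h) -> (forall h, S' h -> L2 m' h) ->
  (forall f, L2 m f -> L2 m' (F f)) ->
  (forall f g, F (fun x => f x + g x) = (fun x => F f x + F g x)) ->
  (forall c f, F (fun x => c * f x) = (fun x => c * F f x)) ->
  (forall f, L2 m f -> nsq m' (F f) <= K * nsq m f) ->
  (forall h, S h -> closed_span m' S' (F h)) ->
  closed_span m S g -> closed_span m' S' (F g).
Proof.
move=> SL SL' FL FD FZ Fn FS /(closed_spanP SL)[mg Sg].
apply: closed_span_lim => // [|e e0]; first exact: FL.
have K1 : 0 < `|K| + 1 by rewrite ltr_wpDl.
have [s [Ss se]] := Sg _ (divr_gt0 e0 K1).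
have ms := lspan_L2 SL Ss.
exists (F s).
  elim: Ss {se ms} => [|c h t Sh _ IH].
    have := FZ 0 (fun=> 0); under eq_fun do rewrite mulr0.
    by move=> ->; under eq_fun do rewrite mul0r; exact: closed_span0.
  by rewrite FD FZ; apply: closed_spanD => //; apply: closed_spanZ => //; exact: FS.
have -> : (fun x => F g x - F s x) = F (fun x => g x - s x).
  rewrite (_ : (fun x => g x - s x) = (fun x => g x + -1 * s x)); last first.
    by apply/funext => x; rewrite mulN1r.
  by rewrite FD FZ; apply/funext => x; rewrite mulN1r.
apply: le_lt_trans (Fn _ (L2B mg ms)) _.
move: se; rewrite ltr_pdivlMr//; apply: le_lt_trans.
rewrite mulrC ler_wpM2l ?nsq_ge0//.
by rewrite (le_trans (ler_norm _))// lerDl.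
Qed.

(** * Gram matrices, bounded multipliers and tensor products *)

Section gram_transport.
Context {d d' : measure_display} {Y : measurableType d} {Y' : measurableType d'}
  {R : realType} {I : Type}.
Variables (m : {measure set Y -> \bar R}) (m' : {measure set Y' -> \bar R}).
Local Notation C := R[i].
Variables (e : I -> Y -> C) (e' : I -> Y' -> C).

(** Formal combinations, kept apart from the family in which they are evaluated: the same
    coefficients are read in several families, such as characters and orbits of vectors. *)
Definition combo (Z : Type) (b : I -> Z -> C) (l : seq (C * I)) (x : Z) : C :=
  \sum_(p <- l) p.1 * b p.2 x.

Lemma combo_cat (Z : Type) (b : I -> Z -> C) l1 l2 :
  combo b (l1 ++ l2) = fun x => combo b l1 x + combo b l2 x.
Proof. by apply/funext => x; rewrite /combo big_cat. Qed.

Lemma combo_scale (Z : Type) (b : I -> Z -> C) (c : C) l :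
  combo b [seq (c * p.1, p.2) | p <- l] = fun x => c * combo b l x.
Proof.
apply/funext => x; rewrite /combo big_map mulr_sumr.
by apply: eq_bigr => p _; rewrite mulrA.
Qed.

Lemma combo_cons (Z : Type) (b : I -> Z -> C) p l :
  combo b (p :: l) = fun x => p.1 * b p.2 x + combo b l x.
Proof. by apply/funext => x; rewrite /combo big_cons. Qed.

Lemma combo_nil (Z : Type) (b : I -> Z -> C) : combo b [::] = fun=> 0.
Proof. by apply/funext => x; rewrite /combo big_nil. Qed.

Hypothesis eL : forall i, L2 m (e i).
Hypothesis e'L : forall i, L2 m' (e' i).
Hypothesis gram : forall i j, inner m (e i) (e j) = inner m' (e' i) (e' j).

Lemma L2_combo l : L2 m (combo e l).
Proof.
elim: l => [|p l IH]; first by rewrite combo_nil; exact: L2_0fun.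
by rewrite combo_cons; apply: L2D => //; exact: L2Z.
Qed.

Lemma inner_0l f : L2 m f -> inner m (fun=> 0) f = 0.
Proof.
move=> mf; rewrite (_ : (fun=> 0) = (fun x => 0 * f x)); last first.
  by apply/funext => x; rewrite mul0r.
by rewrite innerZl// mul0r.
Qed.

Lemma inner_combo_l l f : L2 m f ->
  inner m (combo e l) f = \sum_(p <- l) p.1 * inner m (e p.2) f.
Proof.
move=> mf; elim: l => [|p l IH]; first by rewrite combo_nil big_nil inner_0l.
rewrite combo_cons big_cons innerDl ?innerZl ?IH//; first exact: L2Z.
exact: L2_combo.
Qed.

Lemma inner_combo l k : inner m (combo e l) (combo e k) =
  \sum_(p <- l) p.1 * \sum_(q <- k) q.1^* * inner m (e p.2) (e q.2).
Proof.
rewrite inner_combo_l; last exact: L2_combo.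
apply: eq_bigr => p _; congr (_ * _).
rewrite innerC ?inner_combo_l ?rmorph_sum//; last exact: L2_combo.
by apply: eq_bigr => q _; rewrite /= rmorphM/= -innerC.
Qed.

End gram_transport.

Section gram_transport2.
Context {d d' : measure_display} {Y : measurableType d} {Y' : measurableType d'}
  {R : realType} {I : Type}.
Variables (m : {measure set Y -> \bar R}) (m' : {measure set Y' -> \bar R}).
Local Notation C := R[i].
Variables (e : I -> Y -> C) (e' : I -> Y' -> C).
Hypothesis eL : forall i, L2 m (e i).
Hypothesis e'L : forall i, L2 m' (e' i).
Hypothesis gram : forall i j, inner m (e i) (e j) = inner m' (e' i) (e' j).

Lemma nsq_combo l : nsq m (combo e l) = nsq m' (combo e' l).
Proof.
apply: (@complexI R).
rewrite -[LHS](innerE (L2_combo eL l)) -[RHS](innerE (L2_combo e'L l)).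
rewrite !inner_combo//; apply: eq_bigr => p _; congr (_ * _).
by apply: eq_bigr => q _; rewrite gram.
Qed.

(** Two families with the same Gram matrix span isometric spaces, so approximation
    statements between their combinations may be carried from one to the other. *)
Lemma closed_span_transport (Q : set (seq (C * I))) l :
  closed_span m (combo e @` Q) (combo e l) ->
  closed_span m' (combo e' @` Q) (combo e' l).
Proof.
have QL : forall h, (combo e @` Q) h -> L2 m h by move=> _ [q _ <-]; exact: L2_combo.
have QL' : forall h, (combo e' @` Q) h -> L2 m' h by move=> _ [q _ <-]; exact: L2_combo.
move=> /(closed_spanP QL)[_ H]; apply/(closed_spanP QL'); split; first exact: L2_combo.
move=> r /H[s [Ss sr]].
have [q [sq Sq]] : exists q, s = combo e q /\ lspan (combo e' @` Q) (combo e' q).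
  elim: Ss {sr} => [|c _ t [p Qp <-] _ [q [-> IH]]].
    by exists [::]; rewrite !combo_nil; split=> //; exact: lspan0.
  exists ([seq (c * x.1, x.2) | x <- p] ++ q).
  rewrite !combo_cat !combo_scale; split=> //.
  by apply: lspanS => //; exists p.
exists (combo e' q); split=> //; move: sr; rewrite sq.
have -> : (fun x => combo e l x - combo e q x) =
    combo e (l ++ [seq (-1 * p.1, p.2) | p <- q]).
  by rewrite combo_cat combo_scale; apply/funext => x; rewrite mulN1r.
have -> : (fun x => combo e' l x - combo e' q x) =
    combo e' (l ++ [seq (-1 * p.1, p.2) | p <- q]).
  by rewrite combo_cat combo_scale; apply/funext => x; rewrite mulN1r.
by rewrite nsq_combo.
Qed.

End gram_transport2.

Lemma lspan_range_combo {R : realType} (I : Type) {d} {Z : measurableType d} (e : I -> Z -> R[i]) (s : Z -> R[i]) :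
  lspan (range e) s -> exists l : seq (R[i] * I), s = combo e l.
Proof.
elim=> [|c h t [n _ <-] _ [l ->]]; first by exists [::]; rewrite combo_nil.
by exists ((c, n) :: l); rewrite combo_cons.
Qed.

Section bounded_L2.
Context {d : measure_display} {Y : measurableType d} {R : realType}.
Variable m : {measure set Y -> \bar R}.
Local Notation C := R[i].
Implicit Types f g h q : Y -> C.

Lemma integrable_cst (M : R) : (m setT < +oo)%E -> m.-integrable setT (EFin \o cst M).
Proof.
move=> mfin; apply: measurable_bounded_integrable => //.
exists `|M|; split; first by rewrite num_real.
by move=> x Mx y _ /=; exact: ltW.
Qed.

Lemma L2_bounded (M : R) f : (m setT < +oo)%E -> cmeasurable f ->
  (forall x, sqc (f x) <= M) -> L2 m f.
Proof. by move=> mfin mf fM; apply: (L2_le mf) fM; exact: integrable_cst. Qed.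

Lemma L2_mul (K : R) q f : cmeasurable q -> (forall x, sqc (q x) <= K) ->
  L2 m f -> L2 m (fun x => q x * f x).
Proof.
move=> mq qK /L2P[mf ifi].
apply: (@L2_le _ _ _ _ _ (fun x => K * sqc (f x))).
- exact: cmeasurableM.
- by have := integrableZl measurableT K ifi; apply: eq_integrable.
- by move=> x; rewrite sqcM ler_wpM2r ?sqc_ge0.
Qed.

Lemma nsq_le f g : L2 m f -> L2 m g -> (forall x, sqc (f x) <= sqc (g x)) ->
  nsq m f <= nsq m g.
Proof. by move=> /L2P[_ mf] /L2P[_ mg] fg; apply: le_Rintegral => // x _; exact: fg. Qed.

Lemma nsq_mul (K : R) q f : cmeasurable q -> (forall x, sqc (q x) <= K) -> L2 m f ->
  nsq m (fun x => q x * f x) <= K * nsq m f.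
Proof.
move=> mq qK mf; have /L2P[_ i1] := L2_mul mq qK mf; have /L2P[_ i2] := mf.
rewrite /nsq -RintegralZl//; apply: le_Rintegral => //.
  by have := integrableZl measurableT K i2; apply: eq_integrable.
by move=> x _; rewrite sqcM ler_wpM2r ?sqc_ge0.
Qed.

Lemma EFin_nsq f : L2 m f -> (\int[m]_x (sqc (f x))%:E)%E = (nsq m f)%:E.
Proof. by move=> /L2P[_ fi]; rewrite fineK//; exact: integrable_fin_num. Qed.

Lemma nsq_ae f g : L2 m f -> L2 m g -> {ae m, forall x, f x = g x} ->
  nsq m (fun x => f x - g x) = 0.
Proof.
move=> mf mg fg; have /L2P[mfg _] := L2B mf mg.
rewrite /nsq /Rintegral (ae_eq_integral (cst 0%E))//.
- by rewrite integral_cst// mul0e.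
- by apply/measurable_EFinP; exact: measurable_sqc.
- by apply: filterS fg => x -> _ /=; rewrite subrr /sqc /= expr0n /= addr0.
Qed.

Lemma inner_ae f f' g g' : L2 m f -> L2 m f' -> L2 m g -> L2 m g' ->
  {ae m, forall x, f x = f' x} -> {ae m, forall x, g x = g' x} ->
  inner m f g = inner m f' g'.
Proof.
move=> mf mf' mg mg' ff gg.
have [i1 i2] := cintegrable_mul mf mg; have [j1 j2] := cintegrable_mul mf' mg'.
have H : {ae m, forall x, f x * (g x)^* = f' x * (g' x)^*}.
  by apply: filterS2 ff gg => x -> ->.
apply: complex_ext; congr fine; apply: ae_eq_integral => //.
- exact: (measurable_int _ i1).
- exact: (measurable_int _ j1).
- by apply: filterS H => x /= -> _.
- exact: (measurable_int _ i2).
- exact: (measurable_int _ j2).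
- by apply: filterS H => x /= -> _.
Qed.

Lemma nsq_dominated_cvg_fun (u : Y -> R) (F : nat -> Y -> C) f :
  m.-integrable setT (EFin \o u) ->
  (forall n, cmeasurable (F n)) -> cmeasurable f ->
  (forall n x, sqc (F n x - f x) <= u x) ->
  {ae m, forall x, (fun n => sqc (F n x - f x)) @ \oo --> 0} ->
  (fun n => nsq m (fun x => F n x - f x)) @ \oo --> 0.
Proof.
move=> iu mF mf bd cv.
have mFf n : cmeasurable (fun x => F n x - f x).
  apply: cmeasurableD => //; split; under eq_fun do rewrite !ReImE.
    by apply: measurableT_comp => //; case: mf.
  by apply: measurableT_comp => //; case: mf.
have := @dominated_convergence _ _ _ m setT measurableT
  (fun n x => (sqc (F n x - f x))%:E) (cst 0%E) (EFin \o u).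
case=> //.
- by move=> n; apply/measurable_EFinP; exact: measurable_sqc.
- by apply: filterS cv => x cx _; apply: cvg_EFin => //; exact: nearW.
- apply: aeW => x n _; rewrite /= lee_fin ger0_norm ?sqc_ge0//; exact: bd.
move=> _ _; rewrite integral0 => H.
by apply: fine_cvg; exact: H.
Qed.

Lemma nsq_dominated_cvg (M : R) (F : nat -> Y -> C) f : (m setT < +oo)%E ->
  (forall n, cmeasurable (F n)) -> cmeasurable f ->
  (forall n x, sqc (F n x - f x) <= M) ->
  {ae m, forall x, (fun n => sqc (F n x - f x)) @ \oo --> 0} ->
  (fun n => nsq m (fun x => F n x - f x)) @ \oo --> 0.
Proof. by move=> mfin; apply: nsq_dominated_cvg_fun; exact: integrable_cst. Qed.

End bounded_L2.

Section product_L2.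
Context {d d' : measure_display} {X : measurableType d} {Y : measurableType d'}
  {R : realType}.
Variables (mu : {finite_measure set X -> \bar R}) (nu : {finite_measure set Y -> \bar R}).
Local Notation C := R[i].

Lemma Rintegral_prod (p : X -> R) (q : Y -> R) :
  mu.-integrable setT (EFin \o p) -> nu.-integrable setT (EFin \o q) ->
  (mu \x nu)%E.-integrable setT (fun z => (p z.1 * q z.2)%:E) /\
  \int[(mu \x nu)%E]_z (p z.1 * q z.2) = (\int[mu]_x p x) * (\int[nu]_y q y).
Proof.
move=> ip iq.
have mp := (measurable_EFinP _ _).1 (measurable_int _ ip).
have mq := (measurable_EFinP _ _).1 (measurable_int _ iq).
have mpq : measurable_fun setT (fun z : X * Y => (p z.1 * q z.2)%:E).
  by apply/measurable_EFinP; apply: measurable_funM;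
    [exact: (measurableT_comp mp measurable_fst)|exact: (measurableT_comp mq measurable_snd)].
have ipq : (mu \x nu)%E.-integrable setT (fun z => (p z.1 * q z.2)%:E).
  apply/(integrable12ltyP _ _ mpq).
  under eq_integral => x _.
    under eq_integral do rewrite /= normrM EFinM.
    rewrite ge0_integralZl//; last by apply/measurable_EFinP; exact: measurableT_comp.
    over.
  have /integrableP[_ qoo] := iq; have /integrableP[_ poo] := ip.
  rewrite ge0_integralZr//; last 2 first.
  - by apply/measurable_EFinP; exact: measurableT_comp.
  - by apply: integral_ge0.
  by apply: lte_mul_pinfty => //; [exact: integral_ge0|rewrite ge0_fin_numE//; exact: integral_ge0].
split=> //; rewrite /Rintegral -integral12_prod_meas1//.
have H x : fubini_F nu (fun z : X * Y => (p z.1 * q z.2)%:E) x =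
    ((p x)%:E * (\int[nu]_y (q y)%:E))%E.
  rewrite /fubini_F -(integralZl measurableT iq).
  by apply: eq_integral => y _; rewrite /= EFinM.
rewrite (eq_integral _ _ (fun x _ => H x)).
have : (\int[nu]_y (q y)%:E)%E \is a fin_num by exact: (integrable_fin_num measurableT iq).
case: (\int[nu]_y (q y)%:E)%E => // r _.
by rewrite integralZr// fineM//; exact: (integrable_fin_num measurableT ip).
Qed.

Definition tensor (f : X -> C) (g : Y -> C) (z : X * Y) : C := f z.1 * g z.2.

Lemma cintegral_tensor (f : X -> C) (g : Y -> C) : cintegrable mu f -> cintegrable nu g ->
  cintegrable (mu \x nu)%E (tensor f g) /\
  cintegral (mu \x nu)%E (tensor f g) = cintegral mu f * cintegral nu g.
Proof.
move=> [f1 f2] [g1 g2].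
have [i11 e11] := Rintegral_prod f1 g1; have [i12 e12] := Rintegral_prod f1 g2.
have [i21 e21] := Rintegral_prod f2 g1; have [i22 e22] := Rintegral_prod f2 g2.
split.
  split.
    have := integrableB measurableT i11 i22.
    by apply: eq_integrable => // z _; rewrite ReM.
  have := integrableD measurableT i12 i21.
  by apply: eq_integrable => // z _; rewrite ImM.
apply: complex_ext; rewrite !(ReM, ImM) /=.
  rewrite -e11 -e22 -RintegralB//.
  by apply: eq_Rintegral => z _; rewrite ReM.
rewrite -e12 -e21 -RintegralD//.
by apply: eq_Rintegral => z _; rewrite ImM.
Qed.

Lemma cmeasurable_tensor (f : X -> C) (g : Y -> C) : cmeasurable f -> cmeasurable g ->
  cmeasurable (tensor f g).
Proof.
move=> mf mg; apply: cmeasurableM.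
  exact: (cmeasurable_comp measurable_fst mf).
exact: (cmeasurable_comp measurable_snd mg).
Qed.

Lemma L2_tensor (f : X -> C) (g : Y -> C) : L2 mu f -> L2 nu g ->
  L2 (mu \x nu)%E (tensor f g).
Proof.
move=> /L2P[mf i1] /L2P[mg i2]; apply/L2P; split; first exact: cmeasurable_tensor.
have [H _] := Rintegral_prod i1 i2.
by apply: eq_integrable H => // z _; rewrite sqcM.
Qed.

Lemma inner_tensor (f f' : X -> C) (g g' : Y -> C) : L2 mu f -> L2 mu f' ->
  L2 nu g -> L2 nu g' ->
  inner (mu \x nu)%E (tensor f g) (tensor f' g') = inner mu f f' * inner nu g g'.
Proof.
move=> mf mf' mg mg'.
have [_ <-] := cintegral_tensor (cintegrable_mul mf mf') (cintegrable_mul mg mg').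
by congr cintegral; apply/funext => z; rewrite /tensor rmorphM/=; ring.
Qed.

End product_L2.

(** * Characters of the circle and of the torus *)

Section complex_powers.
Context {R : realType}.
Local Notation C := R[i].

Lemma sqc0 : sqc (0 : C) = 0.
Proof. by rewrite /sqc /= expr0n /= addr0. Qed.

Lemma sqc1 : sqc (1 : C) = 1.
Proof. by rewrite /sqc /= expr0n /= expr1n addr0. Qed.

Lemma sqcX (x : C) n : sqc (x ^+ n) = sqc x ^+ n.
Proof.
elim: n => [|n IH]; first by rewrite !expr0 sqc1.
by rewrite [in LHS]exprS sqcM IH exprS.
Qed.

Lemma sqcJ (x : C) : sqc x^* = sqc x.
Proof. by rewrite /sqc ReJ ImJ sqrrN. Qed.

Lemma sqc_eq0 (x : C) : sqc x = 0 -> x = 0.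
Proof.
move=> /eqP; rewrite paddr_eq0 ?sqr_ge0// !sqrf_eq0 => /andP[/eqP r /eqP i].
exact: complex_ext.
Qed.

Lemma unit_neq0 (x : C) : sqc x = 1 -> x != 0.
Proof. by move=> x1; apply: contra_eq_neq x1 => ->; rewrite sqc0 eq_sym oner_eq0. Qed.

Lemma unit_conj (x : C) : sqc x = 1 -> x^* = x^-1.
Proof.
move=> x1; apply: (mulfI (unit_neq0 x1)); rewrite mulfV ?unit_neq0//.
by rewrite sqcE x1.
Qed.

Lemma sqc_circle_val (z : circle R) : sqc (circle_val z) = 1.
Proof.
have := add_Re2_Im2 (circle_val z); rewrite (eqP (circle_norm z)) expr1n.
by move=> [].
Qed.

Lemma cmeasurable_circle_val : cmeasurable (fun z : circle R => circle_val z).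
Proof.
split=> _ B mB.
  exists (B `*` setT); first exact: measurableX.
  by apply/seteqP; split=> z /=; [move=> [_ []]|move=> [_ ?]; split].
exists (setT `*` B); first exact: measurableX.
by apply/seteqP; split=> z /=; [move=> [_ []]|move=> [_ ?]; split].
Qed.

(** Coordinatewise, so that only limits of real sequences are ever taken. *)
Definition ccvg (u : nat -> C) (l : C) :=
  (fun i => complex.Re (u i)) @ \oo --> complex.Re l /\
  (fun i => complex.Im (u i)) @ \oo --> complex.Im l.

Lemma ccvg_cst l : ccvg (fun=> l) l.
Proof. by split; exact: cvg_cst. Qed.

Lemma ccvgD u v a b : ccvg u a -> ccvg v b -> ccvg (fun i => u i + v i) (a + b).
Proof.
move=> [u1 u2] [v1 v2]; split; rewrite ?(ReD, ImD).
  by under eq_fun do rewrite ReD; exact: cvgD.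
by under eq_fun do rewrite ImD; exact: cvgD.
Qed.

Lemma ccvgM u v a b : ccvg u a -> ccvg v b -> ccvg (fun i => u i * v i) (a * b).
Proof.
move=> [u1 u2] [v1 v2]; split; rewrite ?(ReM, ImM).
  by under eq_fun do rewrite ReM; apply: cvgB; exact: cvgM.
by under eq_fun do rewrite ImM; apply: cvgD; exact: cvgM.
Qed.

Lemma ccvgJ u a : ccvg u a -> ccvg (fun i => (u i)^*) a^*.
Proof.
move=> [u1 u2]; split; rewrite ?(ReJ, ImJ).
  by under eq_fun do rewrite ReJ.
by under eq_fun do rewrite ImJ; exact: cvgN.
Qed.

Lemma ccvgE (u : nat -> C) (l : C) : (fun i => u i : C^o) @ \oo --> (l : C^o) -> ccvg u l.
Proof.
move=> /cvgrPdist_lt ul.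
have E (e : R) : 0 < e -> \forall i \near \oo, `|l - u i| < e%:C.
  by move=> e0; apply: ul; rewrite ltcR.
split; apply/cvgrPdist_lt => e /E; apply: filterS => i H.
  rewrite -ReN -ReD -ltcR; apply: le_lt_trans H; exact: normc_ge_Re.
rewrite -ImN -ImD -ltcR; apply: le_lt_trans H.
have := normc_ge_Re ((l - u i) * 'i%C); rewrite ReiNIm normrN normrM.
by rewrite (_ : `|'i%C| = 1) ?mulr1// normc_def /= expr0n /= expr1n add0r sqrtr1.
Qed.

Definition half_sum (x : C) : C := (1 + x) / 2.

End complex_powers.

(** The circle enters only through its coordinate: a measurable function [zeta]
    of modulus one on some measurable space. *)
Section characters.
Context {R : realType} {d : measure_display} {Z : measurableType d}.
Local Notation C := R[i].
Variable zeta : Z -> C.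
Hypothesis mzeta : cmeasurable zeta.
Hypothesis zeta1 : forall z, sqc (zeta z) = 1.

Definition chi (n : int) (z : Z) : C := zeta z ^ n.

Lemma chi0 z : chi 0 z = 1. Proof. by []. Qed.

Lemma chi1 z : chi 1 z = zeta z. Proof. by []. Qed.

Lemma chiD m n z : chi (m + n) z = chi m z * chi n z.
Proof. by rewrite /chi expfzDr// unit_neq0. Qed.

Lemma sqc_chi n z : sqc (chi n z) = 1.
Proof.
have H m : sqc (chi (Posz m) z) = 1 by rewrite /chi sqcX zeta1 expr1n.
case: n => n; first exact: H.
have := H n.+1; rewrite NegzE /chi => Hn.
by rewrite -invr_expz -unit_conj// sqcJ.
Qed.

Lemma chiN n z : chi (- n) z = (chi n z)^*.
Proof. by rewrite unit_conj ?sqc_chi// /chi invr_expz. Qed.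

Lemma cmeasurable_chi n : cmeasurable (chi n).
Proof.
have H m : cmeasurable (chi (Posz m)).
  elim: m => [|m IH]; first exact: cmeasurable_cst.
  have -> : chi (Posz m.+1) = fun z => zeta z * chi (Posz m) z.
    by apply/funext => z; rewrite /chi exprSz.
  exact: cmeasurableM.
case: n => n; first exact: H.
rewrite (_ : chi _ = fun z => (chi (Posz n.+1) z)^*); first exact: cmeasurableJ.
by apply/funext => z; rewrite NegzE chiN.
Qed.

Section coefficients.
Variable rho : {finite_measure set Z -> \bar R}.

Lemma fin_measure : (rho setT < +oo)%E.
Proof. by rewrite -ge0_fin_numE//; exact: fin_num_measure. Qed.

Lemma L2_cst (c : C) : L2 rho (fun=> c).
Proof. exact: (L2_bounded (M := sqc c) fin_measure (cmeasurable_cst c)). Qed.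

Lemma L2_chi n : L2 rho (chi n).
Proof.
apply: (@L2_bounded _ _ _ _ 1); [exact: fin_measure|exact: cmeasurable_chi|].
by move=> z; rewrite sqc_chi.
Qed.

Definition coef n : C := cintegral rho (chi n).

Lemma cintegrable_chi n : cintegrable rho (chi n).
Proof.
have := cintegrable_mul (L2_chi n) (L2_chi 0).
by congr cintegrable; apply/funext => z; rewrite chi0 conjC1 mulr1.
Qed.

Lemma inner_chi m n : inner rho (chi m) (chi n) = coef (m - n).
Proof.
by rewrite /inner /coef; congr cintegral; apply/funext => z; rewrite chiD chiN.
Qed.

Lemma coefN n : coef (- n) = (coef n)^*.
Proof.
by rewrite -[n]subr0 opprB -!inner_chi innerC//; exact: L2_chi.
Qed.

End coefficients.

Definition echi (p : int * int) : Z * Z -> C := tensor (chi p.1) (chi p.2).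

Lemma echiD p q z : echi (p.1 + q.1, p.2 + q.2) z = echi p z * echi q z.
Proof. by rewrite /echi /tensor /= !chiD mulrACA. Qed.

Lemma echi0 z : echi (0, 0) z = 1.
Proof. by rewrite /echi /tensor /= !chi0 mulr1. Qed.

Lemma sqc_echi p z : sqc (echi p z) = 1.
Proof. by rewrite /echi /tensor sqcM !sqc_chi mulr1. Qed.

Lemma cmeasurable_echi p : cmeasurable (echi p).
Proof. by apply: cmeasurable_tensor; exact: cmeasurable_chi. Qed.

Definition trig : (Z * Z -> C) -> Prop := lspan (range echi).

Lemma trig_echi p : trig (echi p).
Proof. by apply: lspan_gen; exists p. Qed.

Let range_echi1 : range echi (fun=> 1).
Proof. by exists (0, 0) => //; apply/funext => z; rewrite echi0. Qed.

Let range_echiM f g : range echi f -> range echi g -> range echi (fun z => f z * g z).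
Proof.
move=> [p _ <-] [q _ <-]; exists (p.1 + q.1, p.2 + q.2) => //.
by apply/funext => z; rewrite echiD.
Qed.

Lemma trig_mul f g : trig f -> trig g -> trig (fun z => f z * g z).
Proof. exact: (lspan_mul range_echiM). Qed.

Lemma trig_cst (c : C) : trig (fun=> c).
Proof. exact: (lspan_cst range_echi1). Qed.

Lemma trigX q n : trig q -> trig (fun z => q z ^+ n).
Proof. exact: (lspanX range_echi1 range_echiM). Qed.

Lemma trig_fst : trig (fun z => zeta z.1).
Proof.
by apply: lspan_eq (trig_echi (1, 0)) _ => z; rewrite /echi /tensor /= chi0 mulr1.
Qed.

Lemma trig_snd : trig (fun z => zeta z.2).
Proof.
by apply: lspan_eq (trig_echi (0, 1)) _ => z; rewrite /echi /tensor /= chi0 mul1r.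
Qed.

Lemma trig_half_sum q : trig q -> trig (fun z => half_sum (q z)).
Proof.
move=> tq; apply: lspan_eq (lspanZ 2^-1 (lspanD (trig_cst 1) tq)) _ => z.
by rewrite /half_sum mulrC.
Qed.

Lemma trig_bounded f : trig f -> cmeasurable f /\ exists K : R, forall z, sqc (f z) <= K.
Proof.
elim=> [|c _ s [p _ <-] _ [ms [K sK]]].
  split; first exact: cmeasurable_cst.
  by exists 0 => z; rewrite /sqc /= expr0n /= addr0.
split.
  by apply: cmeasurableD => //; apply: cmeasurableM; [exact: cmeasurable_cst|exact: cmeasurable_echi].
exists (2 * sqc c + 2 * K) => z; apply: le_trans (sqcD2 _ _) _.
by rewrite lerD// ?ler_pM2l// sqcM sqc_echi mulr1.
Qed.

End characters.

Section torus.
Context {R : realType} {d : measure_display} {Z : measurableType d}.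
Local Notation C := R[i].
Variable zeta : Z -> C.
Hypothesis mzeta : cmeasurable zeta.
Hypothesis zeta1 : forall z, sqc (zeta z) = 1.
Variables (rho kap : {finite_measure set Z -> \bar R}).
Local Notation m := (rho \x kap)%E.
Local Notation chi := (chi zeta).
Local Notation echi := (echi zeta).
Local Notation trig := (trig zeta).

Lemma fin_prod : (m setT < +oo)%E.
Proof.
rewrite -setXTT product_measure1E// lte_mul_pinfty//; last exact: fin_measure.
exact: fin_num_measure.
Qed.

Lemma trig_L2 f : trig f -> L2 m f.
Proof.
by move=> /(trig_bounded mzeta zeta1)[mf [K fK]]; exact: (L2_bounded fin_prod mf fK).
Qed.

Lemma L2_echi p : L2 m (echi p).
Proof. exact: trig_L2 (trig_echi zeta p). Qed.

Lemma inner_echi p q :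
  inner m (echi p) (echi q) = coef zeta rho (p.1 - q.1) * coef zeta kap (p.2 - q.2).
Proof. by rewrite inner_tensor ?inner_chi//; exact: L2_chi. Qed.

End torus.

Lemma ccvg_inner_lspan (R : realType) d (Y : measurableType d) (nu : {measure set Y -> \bar R})
    (S : set (Y -> R[i])) (w : nat -> Y -> R[i]) v u :
  (forall h, S h -> L2 nu h) -> (forall i, L2 nu (w i)) -> L2 nu v ->
  (forall h, S h -> ccvg (fun i => inner nu (w i) h) (inner nu v h)) ->
  lspan S u -> ccvg (fun i => inner nu (w i) u) (inner nu v u).
Proof.
move=> SL mw mv H.
have Z f : L2 nu f -> inner nu f (fun=> 0) = 0.
  by move=> mf; rewrite innerC ?inner_0l ?rmorph0//; exact: L2_0fun.
elim=> [|c h s Sh Ss IH].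
  by rewrite Z//; under eq_fun do rewrite Z//; exact: ccvg_cst.
have ms := lspan_L2 SL Ss; have mh := SL _ Sh.
have E f : L2 nu f -> inner nu f (fun x => c * h x + s x) = c^* * inner nu f h + inner nu f s.
  by move=> mf; rewrite innerDr ?innerZr//; exact: L2Z.
rewrite E//; under eq_fun do rewrite E//.
by apply: ccvgD => //; apply: ccvgM; [exact: ccvg_cst|exact: H].
Qed.

Lemma ccvg_eps (R : realType) (u : nat -> R[i]) (l : R[i]) : ccvg u l ->
  forall e : R, 0 < e -> exists i, forall j, (i <= j)%N ->
    `|complex.Re (u j) - complex.Re l| < e.
Proof.
move=> [/cvgrPdist_lt ul _] e e0; have [i _ H] := ul _ e0.
by exists i => j ij; rewrite distrC; exact: H.
Qed.

Lemma ccvg_sqc (R : realType) (u : nat -> R[i]) (l : R[i]) : ccvg u l ->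
  (fun n => sqc (u n - l)) @ \oo --> 0.
Proof.
move=> [u1 u2]; rewrite (_ : 0 = (complex.Re l - complex.Re l) ^+ 2 + (complex.Im l - complex.Im l) ^+ 2); last first.
  by rewrite !subrr expr0n /= addr0.
under eq_fun do rewrite /sqc !(ReD, ImD, ReN, ImN) !expr2.
rewrite !expr2; apply: cvgD; apply: cvgM; apply: cvgB => //; exact: cvg_cst.
Qed.

Section half_powers.
Context {R : realType}.
Local Notation C := R[i].

Lemma sqc_half_sum (x : C) : sqc x = 1 -> sqc (half_sum x) = (1 + complex.Re x) / 2.
Proof.
rewrite /half_sum (_ : 2^-1 = (2^-1)%:C); last by rewrite fmorphV rmorphMn rmorph1.
rewrite /sqc !ReImE /= => x1.
transitivity ((complex.Re x ^+ 2 + complex.Im x ^+ 2 + 1 + 2 * complex.Re x) / 4).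
  by field.
by rewrite x1; field.
Qed.

Lemma sqc_half_sum_le1 (x : C) : sqc x = 1 -> sqc (half_sum x) <= 1.
Proof.
move=> x1; rewrite sqc_half_sum// ler_pdivrMr// mul1r.
have : complex.Re x ^+ 2 <= 1 by rewrite -x1 lerDl sqr_ge0.
by rewrite -[X in _ <= X](expr1n _ 2) => H; have := ler_norm (complex.Re x);
  rewrite -sqrtr_sqr => H1; have := ler_wsqrtr H; rewrite expr1n sqrtr1; lra.
Qed.

Lemma sqc_half_sum_lt1 (x : C) : sqc x = 1 -> x != 1 -> sqc (half_sum x) < 1.
Proof.
move=> x1 xn1; rewrite lt_neqAle sqc_half_sum_le1// andbT.
apply: contra_neq xn1; rewrite sqc_half_sum// => H.
have r1 : complex.Re x = 1 by move: H => /(congr1 (fun t => t * 2)); rewrite divfK//; lra.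
apply: complex_ext => //; apply/eqP; rewrite -sqrf_eq0; apply/eqP => /=.
by move: x1; rewrite /sqc r1; lra.
Qed.

(** Zero at [x = 1]; at the other points of the circle [half_sum x] has modulus less than [1],
    so these functions converge to the indicator of [x <> 1]. *)
Definition half_pow j (x : C) : C := 1 - half_sum x ^+ (2 ^ j).

Lemma sqc_half_pow j (x : C) : sqc x = 1 -> sqc (half_pow j x) <= 4.
Proof.
move=> x1; apply: le_trans (sqcD2 _ _) _.
have -> : sqc (- half_sum x ^+ (2 ^ j)) = sqc (half_sum x) ^+ (2 ^ j).
  by rewrite sqcN sqcX.
rewrite sqc1; have : sqc (half_sum x) ^+ (2 ^ j) <= 1.
  by rewrite exprn_ile1 ?sqc_ge0 ?sqc_half_sum_le1.
by lra.
Qed.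

Lemma half_pow_cvg (x : C) : sqc x = 1 ->
  ccvg (fun j => half_pow j x) (if x == 1 then 0 else 1).
Proof.
move=> x1; case: eqP => [->|/eqP xn1].
  rewrite (_ : (fun _ => _) = fun=> 0); first exact: ccvg_cst.
  apply/funext => j; rewrite /half_pow /half_sum (_ : 1 + 1 = 2)// divff ?expr1n ?subrr//.
have lt1 := sqc_half_sum_lt1 x1 xn1; set t := sqc _ in lt1.
have t0 : 0 <= t := sqc_ge0 _.
have tj : (fun j => t ^+ (2 ^ j)) @ \oo --> 0.
  apply: (@squeeze_cvgr _ _ _ _ (fun=> 0) (fun j => t ^+ j)).
  - apply: nearW => j; rewrite exprn_ge0//=.
    by apply: ler_wiXn2l; rewrite ?t0 ?(ltW lt1)//; exact/ltnW/ltn_expl.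
  - exact: cvg_cst.
  - by apply: cvg_expr; rewrite ger0_norm.
have st : (fun j => Num.sqrt (t ^+ (2 ^ j))) @ \oo --> 0.
  rewrite -[X in _ --> X](sqrtr0 R); apply: continuous_cvg => //; exact: sqrt_continuous.
have sq (y : C) : `|complex.Re y| <= Num.sqrt (sqc y) /\ `|complex.Im y| <= Num.sqrt (sqc y).
  by split; rewrite -sqrtr_sqr ler_wsqrtr// /sqc ?lerDl ?lerDr sqr_ge0.
have H : ccvg (fun j => half_sum x ^+ (2 ^ j)) 0.
  split; apply/cvgrPdist_le => e e0; move/cvgrPdist_le: st => /(_ _ e0);
    apply: filterS => j; rewrite !sub0r !normrN ger0_norm ?sqrtr_ge0//; apply: le_trans;
    rewrite /t -sqcX; by case: (sq (half_sum x ^+ (2 ^ j))).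
have := ccvgD (ccvg_cst 1) (ccvgM (ccvg_cst (-1)) H).
by rewrite mulr0 addr0; under eq_fun do rewrite mulN1r.
Qed.

End half_powers.

(** * Weak limits on the torus *)

Section torus_weak_limits.
Context {R : realType} {d : measure_display} {Z : measurableType d}.
Local Notation C := R[i].
Variable zeta : Z -> C.
Hypothesis mzeta : cmeasurable zeta.
Hypothesis zeta1 : forall z, sqc (zeta z) = 1.
Variables (a : C) (k : nat -> int).
Hypothesis aJ : a^* = a.
Hypothesis a_neq0 : a != 0.
Hypothesis a_neq1 : 1 - a != 0.
Local Notation chi := (chi zeta).
Local Notation echi := (echi zeta).
Local Notation trig := (trig zeta).

(** The weak convergence of [z^(k i)] to [a + (1 - a) z], read on Fourier coefficients. *)
Definition limit_coef (rho : {finite_measure set Z -> \bar R}) := forall j : int,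
  ccvg (fun i => coef zeta rho (k i + j))
    (a * coef zeta rho j + (1 - a) * coef zeta rho (j + 1)).

Section one_measure.
Variable rho : {finite_measure set Z -> \bar R}.
Hypothesis rho_lim : limit_coef rho.
Let Lchi := L2_chi mzeta zeta1 rho.

Lemma ccvg_chi (p q : int) : ccvg (fun i => inner rho (chi (k i + p)) (chi q))
  (inner rho (fun z => a * chi p z + (1 - a) * chi (p + 1) z) (chi q)).
Proof.
rewrite innerDl ?innerZl//; try exact: L2Z.
rewrite !(inner_chi zeta1); under eq_fun do rewrite (inner_chi zeta1).
have := rho_lim (p - q); rewrite (addrAC p (- q)).
by under eq_fun do rewrite addrA.
Qed.

Lemma ccvg_chiN (p q : int) : ccvg (fun i => inner rho (chi (p - k i)) (chi q))
  (inner rho (fun z => a * chi p z + (1 - a) * chi (p - 1) z) (chi q)).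
Proof.
rewrite innerDl ?innerZl//; try exact: L2Z.
rewrite !(inner_chi zeta1); under eq_fun do rewrite (inner_chi zeta1).
have := ccvgJ (rho_lim (q - p)).
have aJ' : (1 - a)^* = 1 - a by rewrite rmorphB/= rmorph1 aJ.
rewrite rmorphD !rmorphM/= aJ aJ' -!(coefN mzeta zeta1).
have -> : - (q - p) = p - q by rewrite opprB.
have -> : - (q - p + 1) = p - 1 - q by rewrite opprD opprB addrAC.
under eq_fun do rewrite -(coefN mzeta zeta1).
by congr ccvg; apply/funext => i; congr coef; rewrite opprD opprB addrCA addrA.
Qed.

End one_measure.

Variables rho kap : {finite_measure set Z -> \bar R}.
Hypothesis rho_lim : limit_coef rho.
Hypothesis kap_lim : limit_coef kap.
Local Notation m := (rho \x kap)%E.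
Let tL2 := trig_L2 mzeta zeta1 rho kap.

Lemma ccvg_tensor (F G : nat -> Z -> C) f g u :
  (forall i, L2 rho (F i)) -> (forall i, L2 kap (G i)) -> L2 rho f -> L2 kap g ->
  (forall q, ccvg (fun i => inner rho (F i) (chi q)) (inner rho f (chi q))) ->
  (forall q, ccvg (fun i => inner kap (G i) (chi q)) (inner kap g (chi q))) ->
  trig u -> ccvg (fun i => inner m (tensor (F i) (G i)) u) (inner m (tensor f g) u).
Proof.
move=> mF mG mf mg cF cG; apply: ccvg_inner_lspan.
- by move=> _ [q _ <-]; exact: L2_echi.
- by move=> i; exact: L2_tensor.
- exact: L2_tensor.
- move=> _ [q _ <-]; have Lc := L2_chi mzeta zeta1.
  rewrite inner_tensor//; under eq_fun do rewrite inner_tensor//.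
  exact: ccvgM.
Qed.

Lemma ccvg_mul_trig (W : nat -> Z * Z -> C) (V : Z * Z -> C) :
  (forall i, trig (W i)) -> trig V ->
  (forall p u, trig u -> ccvg (fun i => inner m (fun z => W i z * echi p z) u)
     (inner m (fun z => V z * echi p z) u)) ->
  forall b u, trig b -> trig u ->
    ccvg (fun i => inner m (fun z => W i z * b z) u) (inner m (fun z => V z * b z) u).
Proof.
move=> tW tV H b u + tu.
have Z0 f : L2 m (fun z => f z * 0) -> inner m (fun z : Z * Z => f z * 0) u = 0.
  move=> _; rewrite (_ : (fun z => f z * 0) = fun=> 0) ?inner_0l//; first exact: tL2.
  by apply/funext => z; rewrite mulr0.
elim=> [|c _ s [p _ <-] ts IH].
  rewrite Z0; last by apply: tL2; apply: trig_mul => //; exact: lspan0.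
  under eq_fun do (rewrite Z0; last by apply: tL2; apply: trig_mul => //; exact: lspan0).
  exact: ccvg_cst.
have E X : trig X -> inner m (fun z => X z * (c * echi p z + s z)) u =
    c * inner m (fun z => X z * echi p z) u + inner m (fun z => X z * s z) u.
  move=> tX; have t1 : trig (fun z => X z * echi p z) by apply: trig_mul => //; exact: trig_echi.
  have t2 : trig (fun z => X z * s z) by exact: trig_mul.
  rewrite -(innerZl c (tL2 t1) (tL2 tu)) -(innerDl (L2Z c (tL2 t1)) (tL2 t2) (tL2 tu)).
  by congr inner; apply/funext => z; rewrite mulrDr mulrCA.
rewrite E//; under eq_fun do rewrite E//.
by apply: ccvgD => //; apply: ccvgM; [exact: ccvg_cst|exact: H].
Qed.

(** Weak limits of bounded vectors of a span lie in its closure, so multipliers act in the weak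
    limit.  The term [t] serves to compare the limit with a fixed multiplier. *)
Lemma closed_span_mul_limit (S : set (Z * Z -> C)) (W : nat -> Z * Z -> C) (V b t : Z * Z -> C) :
  (forall h, S h -> trig h) -> (forall i, trig (W i)) -> (forall i z, sqc (W i z) = 1) ->
  trig V -> trig b -> trig t ->
  (forall p u, trig u -> ccvg (fun i => inner m (fun z => W i z * echi p z) u)
     (inner m (fun z => V z * echi p z) u)) ->
  (forall i, lspan S (fun z => W i z * b z + t z)) ->
  closed_span m S (fun z => V z * b z + t z).
Proof.
move=> St tW W1 tV tb tt H SW.
have SL h : S h -> L2 m h by move=> /St/tL2.
have Lb := tL2 tb; have Lt := tL2 tt.
have LW i : L2 m (fun z => W i z * b z) by apply: tL2; exact: trig_mul.
have LV : L2 m (fun z => V z * b z) by apply: tL2; exact: trig_mul.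
apply: (@closed_span_weak _ _ _ _ _ SL _ (fun i z => W i z * b z + t z)
  (2 * nsq m b + 2 * nsq m t)) => //.
- exact: L2D.
- move=> i; apply: le_trans (nsqD2 (LW i) Lt) _; rewrite lerD2r ler_pM2l//.
  by apply: nsq_le => // z; rewrite sqcM W1 mul1r.
- move=> u uS; have tu : trig u.
    case: uS => [|->]; first by apply: lspan_trans => h /St.
    by apply: lspanD => //; exact: trig_mul.
  have Lu := tL2 tu.
  have := ccvgD (ccvg_mul_trig tW tV H tb tu) (ccvg_cst (inner m t u)).
  rewrite -innerDl//; under eq_fun do rewrite -innerDl//.
  exact: ccvg_eps.
Qed.

Lemma closed_span_mul (S : set (Z * Z -> C)) (q : Z * Z -> C) g :
  (forall h, S h -> trig h) -> trig q ->
  (forall h, S h -> closed_span m S (fun z => q z * h z)) ->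
  closed_span m S g -> closed_span m S (fun z => q z * g z).
Proof.
move=> St /(trig_bounded mzeta zeta1)[mq [K qK]] H.
have SL h : S h -> L2 m h by move=> /St/tL2.
apply: (@closed_span_map _ _ _ _ _ _ _ (fun f z => q z * f z) K S S) => //.
- by move=> f; exact: L2_mul qK.
- by move=> f h; apply/funext => z; rewrite mulrDr.
- by move=> c f; apply/funext => z; rewrite mulrCA.
- by move=> f; exact: nsq_mul.
Qed.

(** The weak limit of the multipliers [x ^ k i]. *)
Definition vlim (x : C) : C := a + (1 - a) * x.

Lemma trig_vlim q : trig q -> trig (fun z => vlim (q z)).
Proof. by move=> tq; apply: lspanD; [exact: trig_cst|exact: lspanZ]. Qed.

Section diagonal_orbit.
Variable b : Z * Z -> C.
Hypothesis tb : trig b.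

Definition diag_orbit : set (Z * Z -> C) :=
  [set (fun z => echi (n, n) z * b z) | n in setT].
Local Notation A := (closed_span m diag_orbit).

Lemma diag_orbit_trig h : diag_orbit h -> trig h.
Proof. by move=> [n _ <-]; apply: trig_mul => //; exact: trig_echi. Qed.

Lemma diag_orbit_L2 h : diag_orbit h -> L2 m h.
Proof. by move=> /diag_orbit_trig; exact: tL2. Qed.

Lemma diag_stable_shift n f : A f -> A (fun z => echi (n, n) z * f z).
Proof.
apply: (closed_span_mul diag_orbit_trig (trig_echi _ _)).
move=> _ [p _ <-]; apply: (closed_span_gen diag_orbit_L2); exists (n + p) => //.
by apply/funext => z; rewrite mulrA -(echiD zeta1 (n, n) (p, p)).
Qed.

Lemma diag_stable_limit f : A f -> A (fun z => vlim (zeta z.1) * vlim (zeta z.2) * f z).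
Proof.
have tV : trig (fun z => vlim (zeta z.1) * vlim (zeta z.2)).
  by apply: trig_mul => //; apply: trig_vlim; [exact: trig_fst|exact: trig_snd].
apply: (closed_span_mul diag_orbit_trig tV) => _ [n _ <-].
suff H : A (fun z => vlim (zeta z.1) * vlim (zeta z.2) * (echi (n, n) z * b z) + 0).
  by apply: closed_span_eq H _ => z; rewrite addr0.
apply: (@closed_span_mul_limit diag_orbit (fun i => echi (k i, k i)) _ _ (fun=> 0)).
- exact: diag_orbit_trig.
- by move=> i; exact: trig_echi.
- by move=> i z; rewrite sqc_echi.
- exact: tV.
- by apply: trig_mul => //; exact: trig_echi.
- exact: lspan0.
- move=> p u tu; have := @ccvg_tensor (fun i => chi (k i + p.1)) (fun i => chi (k i + p.2))
    (fun z => a * chi p.1 z + (1 - a) * chi (p.1 + 1) z)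
    (fun z => a * chi p.2 z + (1 - a) * chi (p.2 + 1) z) u.
  have Lc := L2_chi mzeta zeta1.
  have Ll (nu : {finite_measure set Z -> \bar R}) q : L2 nu (fun z => a * chi q z + (1 - a) * chi (q + 1) z).
    by apply: L2D; exact: L2Z.
  move=> /(_ (fun=> Lc _ _) (fun=> Lc _ _) (Ll _ _) (Ll _ _)).
  move=> /(_ (ccvg_chi rho_lim _) (ccvg_chi kap_lim _) tu).
  congr ccvg.
    by apply/funext => i; congr inner; apply/funext => z; rewrite -echiD.
  congr inner; apply/funext => z; rewrite /tensor /vlim /= /echi /tensor !chiD// !chi1; ring.
- move=> i; apply: (@lspan_eq _ _ _ _ (fun z => echi (k i + n, k i + n) z * b z)).
    by apply: lspan_gen; exists (k i + n).
  by move=> z; rewrite addr0 mulrA -(echiD zeta1 (k i, k i) (n, n)).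
Qed.

(** The weak limit of [(zw)^(k i)] is
    [a^2 + a (1 - a) (z + w) + (1 - a)^2 zw]; as [1] and [zw] are already
    available, [z + w] is gained. *)
Lemma diag_stable_sum f : A f -> A (fun z => (zeta z.1 + zeta z.2) * f z).
Proof.
move=> Af; have V := diag_stable_limit Af; have S := diag_stable_shift 1 Af.
have aa : a * (1 - a) != 0 by rewrite mulf_neq0.
have := closed_spanZ diag_orbit_L2 (a * (1 - a))^-1
  (closed_spanB diag_orbit_L2 (closed_spanB diag_orbit_L2 V
     (closed_spanZ diag_orbit_L2 (a ^+ 2) Af))
     (closed_spanZ diag_orbit_L2 ((1 - a) ^+ 2) S)).
move=> H; apply: (closed_span_eq H) => z; rewrite /echi /tensor /= !chi1 /vlim.
by field; apply/andP.
Qed.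

Lemma diag_stable_prod f : A f -> A (fun z => zeta z.1 * zeta z.2 * f z).
Proof. by move=> /(diag_stable_shift 1). Qed.

(** Power sums and differences of powers satisfy this recurrence; its coefficients are the
    elementary symmetric functions of [z] and [w], which act on the closed span. *)
Lemma diag_recurrence (h : nat -> Z * Z -> C) : A (h 0%N) -> A (h 1%N) ->
  (forall n z, h n.+2 z = (zeta z.1 + zeta z.2) * h n.+1 z - zeta z.1 * zeta z.2 * h n z) ->
  forall n, A (h n).
Proof.
move=> h0 h1 hS n; suff [H _] : A (h n) /\ A (h n.+1) by exact: H.
elim: n => [|n [IH1 IH2]]; first by split; [exact: h0|exact: h1].
split; first exact: IH2.
apply: closed_span_eq (closed_spanB diag_orbit_L2 (diag_stable_sum IH2) (diag_stable_prod IH1)) _.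
by move=> z; rewrite hS.
Qed.

(** Repeated squaring keeps the sum and product of the [2^j]-th powers of
    [(1 + z)/2] and [(1 + w)/2] within the symmetric functions that act. *)
Lemma diag_stable_half_powers j f : A f ->
  A (fun z => (half_sum (zeta z.1) ^+ (2 ^ j) + half_sum (zeta z.2) ^+ (2 ^ j)) * f z) /\
  A (fun z => (half_sum (zeta z.1) * half_sum (zeta z.2)) ^+ (2 ^ j) * f z).
Proof.
have SL := diag_orbit_L2.
elim: j f => [|j IH] f Af.
  have S := diag_stable_sum Af; have P := diag_stable_prod Af; split.
    apply: closed_span_eq (closed_spanD SL Af (closed_spanZ SL 2^-1 S)) _.
    by move=> z; rewrite !expr1 /half_sum; field.
  apply: closed_span_eq (closed_spanZ SL 4^-1 (closed_spanD SL (closed_spanD SL Af S) P)) _.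
  by move=> z; rewrite !expr1 /half_sum; field.
have [S P] := IH _ Af; have [SS _] := IH _ S; have [_ PP] := IH _ P; split.
  apply: closed_span_eq (closed_spanB SL SS (closed_spanZ SL 2 P)) _.
  by move=> z; rewrite /= expnSr !exprM !exprMn; ring.
apply: closed_span_eq PP _.
by move=> z; rewrite /= expnSr !exprM !exprMn; ring.
Qed.

(** The half powers satisfy [h_(j+1) = h_j (1 + s_j)] with [s_j] the [2^j]-th power of the half sum,
    and [(1 + s)(1 + t) = 1 + (s + t) + st] is symmetric. *)
Lemma diag_half_pow f j : A (fun z => half_pow 0 (zeta z.1) * half_pow 0 (zeta z.2) * f z) ->
  A (fun z => half_pow j (zeta z.1) * half_pow j (zeta z.2) * f z).
Proof.
move=> A0; have SL := diag_orbit_L2.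
have E i (x : C) : half_pow i.+1 x = half_pow i x * (1 + half_sum x ^+ (2 ^ i)).
  by rewrite /half_pow expnSr exprM; ring.
elim: j => [|j IH]; first exact: A0.
have [S P] := diag_stable_half_powers j IH.
apply: closed_span_eq (closed_spanD SL IH (closed_spanD SL S P)) _.
move=> z; rewrite /= !E (exprMn (2 ^ j) (half_sum (zeta z.1)) (half_sum (zeta z.2))).
by move: (half_sum (zeta z.1) ^+ _) (half_sum (zeta z.2) ^+ _) => al be; ring.
Qed.

End diagonal_orbit.
End torus_weak_limits.

(** * Symmetric, antisymmetric and off-diagonal functions *)

Section unit_point_set.
Context {R : realType} {d : measure_display} {Z : measurableType d}.
Local Notation C := R[i].
Variable zeta : Z -> C.
Hypothesis mzeta : cmeasurable zeta.

Lemma measurable_zeta_eq1 : measurable [set z | zeta z = 1].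
Proof.
have [m1 m2] := mzeta.
have -> : [set z | zeta z = 1] =
    (fun z => complex.Re (zeta z)) @^-1` [set 1] `&` (fun z => complex.Im (zeta z)) @^-1` [set 0].
  apply/seteqP; split=> z /=; first by move=> ->.
  by move=> [? ?]; exact: complex_ext.
apply: measurableI.
  by rewrite -[X in measurable X]setTI; exact: m1.
by rewrite -[X in measurable X]setTI; exact: m2.
Qed.

Definition off_one (z : Z) : C := if zeta z == 1 then 0 else 1.

Lemma cmeasurable_off_one : cmeasurable off_one.
Proof.
have H : (fun z => complex.Re (off_one z)) = \1_(~` [set z | zeta z = 1]).
  apply/funext => z; rewrite indicE /off_one; case: eqP => h.
    by rewrite memNset// => /(_ h).
  by rewrite mem_set.
split; first by rewrite H; apply: measurable_indic; apply: measurableC; exact: measurable_zeta_eq1.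
rewrite (_ : (fun z => _) = fun=> 0); first exact: measurable_cst.
by apply/funext => z; rewrite /off_one; case: ifP.
Qed.

Lemma sqc_off_one z : sqc (off_one z) <= 1.
Proof. by rewrite /off_one; case: ifP => _; rewrite ?sqc0 ?sqc1. Qed.

End unit_point_set.

Section torus_density.
Context {R : realType} {d : measure_display} {Z : measurableType d}.
Local Notation C := R[i].
Variable zeta : Z -> C.
Hypothesis mzeta : cmeasurable zeta.
Hypothesis zeta1 : forall z, sqc (zeta z) = 1.
Variables (a : C) (k : nat -> int).
Hypothesis aJ : a^* = a.
Hypothesis a_neq0 : a != 0.
Hypothesis a_neq1 : 1 - a != 0.
Local Notation chi := (chi zeta).
Local Notation echi := (echi zeta).
Local Notation trig := (trig zeta).
Variables rho kap : {finite_measure set Z -> \bar R}.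
Hypothesis rho_lim : limit_coef zeta a k rho.
Hypothesis kap_lim : limit_coef zeta a k kap.
Hypothesis rho_one : rho [set z | zeta z = 1] = 0%E.
Local Notation m := (rho \x kap)%E.
Let tL2 := trig_L2 mzeta zeta1 rho kap.

Lemma diag_orbit_cst1 : closed_span m (diag_orbit zeta (fun=> 1)) (fun=> 1).
Proof.
apply: closed_span_gen; first by apply: (diag_orbit_L2 mzeta zeta1); exact: trig_cst.
by exists 0 => //; apply/funext => z; rewrite echi0 mulr1.
Qed.

Lemma diag_orbit_gen b : trig b -> closed_span m (diag_orbit zeta b) b.
Proof.
move=> tb; apply: closed_span_gen; first exact: (diag_orbit_L2 mzeta zeta1).
by exists 0 => //; apply/funext => z; rewrite echi0 mul1r.
Qed.

Let stable_shift n b (tb : trig b) f : closed_span m (diag_orbit zeta b) f ->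
  closed_span m (diag_orbit zeta b) (fun z => echi (n, n) z * f z).
Proof. exact: diag_stable_shift. Qed.

Let stable_sum := diag_stable_sum mzeta zeta1 a_neq0 a_neq1 rho_lim kap_lim.
Let recurrence := diag_recurrence mzeta zeta1 a_neq0 a_neq1 rho_lim kap_lim.

(** Up to the factor [(zw)^i] this is a power sum [z^n + w^n]. *)
Lemma closed_span_symmetric (i j : int) :
  closed_span m (diag_orbit zeta (fun=> 1)) (fun z => echi (i, j) z + echi (j, i) z).
Proof.
have t1 : trig (fun=> 1) by exact: trig_cst.
have SL := diag_orbit_L2 mzeta zeta1 rho kap t1.
have H n : closed_span m (diag_orbit zeta (fun=> 1)) (fun z => zeta z.1 ^+ n + zeta z.2 ^+ n).
  move: n; apply: (recurrence t1).
  - apply: closed_span_eq (closed_spanD SL diag_orbit_cst1 diag_orbit_cst1) _ => z.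
    by rewrite !expr0.
  - apply: closed_span_eq (stable_sum t1 diag_orbit_cst1) _ => z.
    by rewrite !expr1 mulr1.
  - by move=> n z; rewrite !exprS; ring.
wlog ij : i j / (i <= j)%R.
  move=> W; have [/W//|/ltW/W] := leP i j.
  by move=> X; apply: closed_span_eq X _ => z; rewrite addrC.
have [n ->] : exists n : nat, j = i + n%:Z.
  by exists `|j - i|%N; rewrite gez0_abs ?subr_ge0// addrCA subrr addr0.
apply: closed_span_eq (stable_shift i t1 (H n)) _ => z.
by rewrite /echi /tensor /= !chiD// /chi -!exprnP; ring.
Qed.

Definition antisym_gen (z : Z * Z) : C := zeta z.2 - zeta z.1.

Lemma trig_antisym_gen : trig antisym_gen.
Proof. by apply: lspanB; [exact: trig_snd|exact: trig_fst]. Qed.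

(** Up to the factor [(zw)^i] this is [w^n - z^n]. *)
Lemma closed_span_antisymmetric (i j : int) :
  closed_span m (diag_orbit zeta antisym_gen) (fun z => echi (i, j) z - echi (j, i) z).
Proof.
have t1 := trig_antisym_gen.
have SL := diag_orbit_L2 mzeta zeta1 rho kap t1.
have H n : closed_span m (diag_orbit zeta antisym_gen) (fun z => zeta z.2 ^+ n - zeta z.1 ^+ n).
  move: n; apply: (recurrence t1).
  - apply: closed_span_eq (closed_span0 SL) _ => z.
    by rewrite !expr0 subrr.
  - by apply: closed_span_eq (diag_orbit_gen t1) _ => z; rewrite !expr1.
  - by move=> n z; rewrite !exprS; ring.
wlog ij : i j / (i <= j)%R.
  move=> W; have [/W//|/ltW/W] := leP i j.
  by move=> X; apply: closed_span_eq (closed_spanZ SL (-1) X) _ => z; rewrite mulN1r opprB.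
have [n ->] : exists n : nat, j = i + n%:Z.
  by exists `|j - i|%N; rewrite gez0_abs ?subr_ge0// addrCA subrr addr0.
apply: closed_span_eq (stable_shift i t1 (H n)) _ => z.
by rewrite /echi /tensor /= !chiD// /chi -!exprnP; ring.
Qed.

Lemma ae_neq1 : {ae m, forall z, zeta z.1 != 1}.
Proof.
exists ([set z | zeta z = 1] `*` setT); split.
- by apply: measurableX => //; exact: measurable_zeta_eq1.
- rewrite product_measure1E//; last exact: measurable_zeta_eq1.
  by apply: (etrans (congr1 (fun t => (t * _)%E) rho_one)); rewrite mul0e.
- by move=> z /= /negP; rewrite negbK => /eqP.
Qed.

Lemma cmeasurable_half_pow j : cmeasurable (fun z : Z => half_pow j (zeta z)).
Proof.
rewrite (_ : (fun _ => _) = fun z => 1 + -1 * half_sum (zeta z) ^+ (2 ^ j)); last first.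
  by apply/funext => z; rewrite mulN1r.
apply: cmeasurableD; first exact: cmeasurable_cst.
have H n : cmeasurable (fun z => half_sum (zeta z) ^+ n).
  elim: n => [|n IH]; first exact: cmeasurable_cst.
  rewrite (_ : (fun _ => _) = fun z => half_sum (zeta z) * half_sum (zeta z) ^+ n); last first.
    by apply/funext => z; rewrite exprS.
  apply: cmeasurableM => //; apply: cmeasurableM; last exact: cmeasurable_cst.
  by apply: cmeasurableD => //; exact: cmeasurable_cst.
by apply: cmeasurableM; [exact: cmeasurable_cst|exact: H].
Qed.

(** Products of half powers in [z] and in [w] converge boundedly to the indicator of [z <> 1]
    and [w <> 1], and the first condition holds almost everywhere because [rho] does not
    charge [1]. *)
Lemma closed_span_off_one :
  closed_span m (diag_orbit zeta (fun=> 1)) (fun z => off_one zeta z.2).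
Proof.
have t1 : trig (fun=> 1) by exact: trig_cst.
have SL := diag_orbit_L2 mzeta zeta1 rho kap t1.
pose F j z := half_pow j (zeta z.1) * half_pow j (zeta z.2) : C.
have mo : cmeasurable (fun z : Z * Z => off_one zeta z.2).
  exact: (cmeasurable_comp measurable_snd (cmeasurable_off_one mzeta)).
have mF j : cmeasurable (F j).
  rewrite /F; apply: cmeasurableM.
    exact: (cmeasurable_comp measurable_fst (cmeasurable_half_pow j)).
  exact: (cmeasurable_comp measurable_snd (cmeasurable_half_pow j)).
have FA j : closed_span m (diag_orbit zeta (fun=> 1)) (F j).
  have := @diag_half_pow _ _ _ _ mzeta zeta1 _ _ a_neq0 a_neq1 _ _ rho_lim kap_lim _ t1 (fun=> 1) j.
  move=> H; apply: closed_span_eq (H _) _ => [|z]; last by rewrite mulr1.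
  have V := diag_stable_limit mzeta zeta1 rho_lim kap_lim t1 diag_orbit_cst1.
  have S := stable_shift 1 t1 diag_orbit_cst1.
  (* a + (1 - a) zw - v(z) v(w) = a (1 - a) (1 - z) (1 - w) *)
  apply: closed_span_eq (closed_spanZ SL (4 * a * (1 - a))^-1 (closed_spanB SL
    (closed_spanD SL (closed_spanZ SL a diag_orbit_cst1) (closed_spanZ SL (1 - a) S)) V)) _ => z.
  rewrite /half_pow /half_sum /vlim /echi /tensor /= !chi1 expn0 !expr1.
  by field; rewrite a_neq0 a_neq1.
have cv : (fun n => nsq m (fun x => F n x - off_one zeta x.2)) @ \oo --> 0.
  (* 34 = 2 (4 * 4) + 2, as the squared modulus of a half power is at most 4 *)
  apply: (@nsq_dominated_cvg _ _ _ _ 34) => //.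
  - exact: fin_prod.
  - move=> n z; apply: le_trans (sqcD2 _ _) _.
    rewrite sqcN; have := sqc_off_one zeta z.2.
    have := sqc_half_pow n (zeta1 z.1); have := sqc_half_pow n (zeta1 z.2).
    rewrite /F sqcM => h1 h2; have : sqc (half_pow n (zeta z.1)) * sqc (half_pow n (zeta z.2)) <= 4 * 4.
      by apply: ler_pM => //; exact: sqc_ge0.
    by lra.
  - apply: filterS ae_neq1 => z z1; apply: ccvg_sqc.
    have := ccvgM (half_pow_cvg (zeta1 z.1)) (half_pow_cvg (zeta1 z.2)).
    by rewrite (negbTE z1) mul1r.
apply: closed_span_lim => //.
  by apply: (L2_bounded (M := 1)) => //; [exact: fin_prod|move=> z; exact: sqc_off_one].
move=> e e0; move/cvgrPdist_lt: cv => /(_ _ e0)[N _ /(_ N (leqnn N))].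
rewrite sub0r normrN => H; exists (F N) => //; rewrite nsqBC.
exact: le_lt_trans (ler_norm _) H.
Qed.

Section off_diagonal.

Definition diff_gen : set (Z * Z -> C) :=
  [set (fun z => (zeta z.1 - zeta z.2) * echi p z) | p in setT].

Lemma diff_gen_trig h : diff_gen h -> trig h.
Proof.
move=> [p _ <-]; apply: trig_mul => //; last exact: trig_echi.
by apply: lspanB; [exact: trig_fst|exact: trig_snd].
Qed.

Let SL h : diff_gen h -> L2 m h := fun H => tL2 (diff_gen_trig H).
Local Notation K := (closed_span m diff_gen).

Lemma lspan_diff_gen q : trig q -> lspan diff_gen (fun z => (zeta z.1 - zeta z.2) * q z).
Proof.
elim=> [|c _ s [p _ <-] _ IH].
  by apply: lspan_eq (lspan0 _) _ => z; rewrite mulr0.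
apply: (@lspan_eq _ _ _ _ (fun z => c * ((zeta z.1 - zeta z.2) * echi p z) + (zeta z.1 - zeta z.2) * s z)).
  by apply: lspanS => //; exists p.
by move=> z; rewrite mulrDr mulrCA.
Qed.

(** A geometric sum times [z/w - 1]. *)
Lemma quotient_power_diff (n : int) : exists2 q, trig q &
  forall z, echi (n, - n) z - 1 = (zeta z.1 - zeta z.2) * q z.
Proof.
have E1 z : echi (1, - 1) z - 1 = (zeta z.1 - zeta z.2) * echi (0, - 1) z.
  have w0 := unit_neq0 (zeta1 z.2).
  by rewrite /echi /tensor /= chi1 chi0 /chi exprN1 mul1r mulrBl mulfV.
have H (i : nat) : exists2 q, trig q &
    forall z, echi (i%:Z, - i%:Z) z - 1 = (zeta z.1 - zeta z.2) * q z.
  elim: i => [|i [q tq IH]].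
    exists (fun=> 0); first exact: lspan0.
    by move=> z; rewrite oppr0 echi0 subrr mulr0.
  exists (fun z => echi (1, - 1) z * q z + echi (0, - 1) z).
    by apply: lspanD; [apply: trig_mul => //; exact: trig_echi|exact: trig_echi].
  move=> z; rewrite mulrDr mulrCA -IH -E1 intS opprD (echiD zeta1 (1, -1) (i%:Z, - i%:Z)).
  by rewrite mulrBr mulr1 addrA subrK.
case: n => n; first exact: H.
have [q tq Hq] := H n.+1.
exists (fun z => - echi (Negz n, - Negz n) z * q z).
  apply: trig_mul => //; apply: lspan_eq (lspanZ (-1) (trig_echi zeta (Negz n, - Negz n))) _.
  by move=> z; rewrite mulN1r.
move=> z; rewrite mulrCA -Hq mulNr mulrBr mulr1 -(echiD zeta1 (Negz n, - Negz n) (n.+1%:Z, - n.+1%:Z)).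
by rewrite NegzE opprK addNr subrr echi0 opprB.
Qed.

(** The multipliers [(z/w)^(k i) - 1] are multiples of [z - w]; pass to the weak limit. *)
Lemma diff_limit q : trig q ->
  K (fun z => vlim a (zeta z.1) * (a + (1 - a) * chi (- 1) z.2) * q z - q z).
Proof.
move=> tq.
have tV : trig (fun z => vlim a (zeta z.1) * (a + (1 - a) * chi (- 1) z.2)).
  apply: trig_mul => //; first by apply: trig_vlim => //; exact: trig_fst.
  apply: lspanD; first exact: trig_cst.
  apply: lspanZ; apply: lspan_eq (trig_echi zeta (0, - 1)) _ => z.
  by rewrite /echi /tensor /= chi0 mul1r.
have tN : trig (fun z => - q z).
  by apply: lspan_eq (lspanZ (-1) tq) _ => z; rewrite mulN1r.
apply: (closed_span_mul_limit mzeta zeta1 (W := fun i => echi (k i, - k i)) diff_gen_trig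
  _ _ tV tq tN).
- by move=> i; exact: trig_echi.
- by move=> i z; rewrite sqc_echi.
- move=> p u tu; have := @ccvg_tensor _ _ _ _ mzeta zeta1 rho kap
    (fun i => chi (k i + p.1)) (fun i => chi (p.2 - k i))
    (fun z => a * chi p.1 z + (1 - a) * chi (p.1 + 1) z)
    (fun z => a * chi p.2 z + (1 - a) * chi (p.2 - 1) z) u.
  have Lc := L2_chi mzeta zeta1.
  have Ll (nu : {finite_measure set Z -> \bar R}) q1 q2 : L2 nu (fun z => a * chi q1 z + (1 - a) * chi q2 z).
    by apply: L2D; exact: L2Z.
  move=> /(_ (fun=> Lc _ _) (fun=> Lc _ _) (Ll _ _ _) (Ll _ _ _)).
  move=> /(_ (ccvg_chi mzeta zeta1 rho_lim _) (ccvg_chiN mzeta zeta1 aJ kap_lim _) tu).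
  congr ccvg.
    apply/funext => i; congr inner; apply/funext => z.
    by rewrite -echiD// (addrC (- k i)).
  congr inner; apply/funext => z; rewrite /tensor /vlim /= /echi /tensor !chiD// !chi1; ring.
- move=> i; have [r tr Hr] := quotient_power_diff (k i).
  apply: (lspan_eq (lspan_diff_gen (trig_mul zeta1 tr tq))) => z.
  by rewrite mulrA -Hr mulrBl mul1r.
Qed.

(** Modulo multiples of [z - w] the variable [w] may be replaced by [z], and on the circle
    [z (v(z) v(1/z) - 1) = a (1 - a) (1 - z)^2]. *)
Lemma diff_square q : trig q -> K (fun z => (1 - zeta z.1) ^+ 2 * q z).
Proof.
move=> tq.
have tz : trig (fun z => zeta z.1 * q z) by apply: trig_mul => //; exact: trig_fst.
have tr : trig (fun z => vlim a (zeta z.1) * ((1 - a) * (chi (- 1) z.2 * q z))).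
  apply: trig_mul => //; first by apply: trig_vlim => //; exact: trig_fst.
  apply: lspanZ; apply: trig_mul => //; apply: lspan_eq (trig_echi zeta (0, - 1)) _ => z.
  by rewrite /echi /tensor /= chi0 mul1r.
have H1 := diff_limit tz; have H2 := closed_span_lspan SL (lspan_diff_gen tr).
apply: closed_span_eq (closed_spanZ SL (a * (1 - a))^-1 (closed_spanB SL H1 H2)) _ => z.
rewrite /vlim /chi exprN1; have w0 := unit_neq0 (zeta1 z.2).
by field; rewrite a_neq0 a_neq1 w0.
Qed.

(** Squares of half powers are multiples of [(1 - z)^2] and converge to [1] almost everywhere.
    In other words the diagonal of the torus is not charged. *)
Lemma closed_span_diff_cst1 : K (fun=> 1).
Proof.
have HP j : exists2 q, trig q & forall z, half_pow j (zeta z.1) = (1 - zeta z.1) * q z.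
  elim: j => [|j [q tq Hq]].
    exists (fun=> 2^-1); first exact: trig_cst.
    by move=> z; rewrite /half_pow /half_sum expn0 expr1; field.
  exists (fun z => q z * (1 + half_sum (zeta z.1) ^+ (2 ^ j))).
    apply: trig_mul => //; apply: lspanD; first exact: trig_cst.
    by apply: trigX => //; apply: trig_half_sum; exact: trig_fst.
  move=> z; rewrite mulrA -Hq /half_pow expnSr exprM.
  by move: (half_sum (zeta z.1) ^+ (2 ^ j)) => al; ring.
pose F j (z : Z * Z) := half_pow j (zeta z.1) ^+ 2 : C.
have FK j : K (F j).
  have [q tq Hq] := HP j.
  apply: closed_span_eq (diff_square (trig_mul zeta1 tq tq)) _ => z.
  by rewrite /F Hq; ring.
have mF j : cmeasurable (F j).
  have mh := cmeasurable_comp measurable_fst (cmeasurable_half_pow j) : cmeasurable (fun z : Z * Z => half_pow j (zeta z.1)).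
  have := cmeasurableM mh mh.
  by congr cmeasurable; apply/funext => z; rewrite /F expr2.
have cv : (fun n => nsq m (fun x => F n x - 1)) @ \oo --> 0.
  apply: (@nsq_dominated_cvg _ _ _ _ 34) => //.
  - exact: fin_prod.
  - move=> n z; apply: le_trans (sqcD2 _ _) _.
    rewrite sqcN sqc1.
    have := sqc_half_pow n (zeta1 z.1) => h1.
    have : sqc (half_pow n (zeta z.1)) ^+ 2 <= 4 ^+ 2 by rewrite ler_sqr ?nnegrE ?sqc_ge0.
    by rewrite /F sqcX; lra.
  - apply: filterS ae_neq1 => z z1; apply: ccvg_sqc.
    have := ccvgM (half_pow_cvg (zeta1 z.1)) (half_pow_cvg (zeta1 z.1)).
    by rewrite (negbTE z1) mul1r; under eq_fun do rewrite -expr2.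
apply: closed_span_lim => //.
  by apply: tL2; exact: trig_cst.
move=> e e0; move/cvgrPdist_lt: cv => /(_ _ e0)[N _ /(_ N (leqnn N))].
rewrite sub0r normrN => H; exists (F N) => //; rewrite nsqBC.
exact: le_lt_trans (ler_norm _) H.
Qed.

End off_diagonal.
End torus_density.

(** * A polynomial separating the spectral types *)

Section add_finite_measure.
Context {R : realType} {d : measure_display} {Z : measurableType d}.
Variables m1 m2 : {finite_measure set Z -> \bar R}.

Definition add_finite := measure_add m1 m2.

HB.instance Definition _ := Measure.on add_finite.

Lemma add_finite_fin : fin_num_fun add_finite.
Proof.
move=> A mA; rewrite /add_finite measure_addE fin_numD; apply/andP; split.
  exact: fin_num_measure.
exact: fin_num_measure.
Qed.

HB.instance Definition _ := Measure_isFinite.Build _ _ _ add_finite add_finite_fin.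

Lemma nsq_add_finite (f : Z -> R[i]) : L2 add_finite f -> L2 m1 f -> L2 m2 f ->
  nsq add_finite f = nsq m1 f + nsq m2 f.
Proof.
move=> L L1 L2'; apply: EFin_inj; rewrite EFinD -!EFin_nsq//.
apply: ge0_integral_measure_add => //.
  by move=> z _; rewrite lee_fin sqc_ge0.
by apply/measurable_EFinP; apply: measurable_sqc; exact: L2_cmeasurable L.
Qed.

End add_finite_measure.

Section separation.
Context {R : realType} {d : measure_display} {Z : measurableType d}.
Local Notation C := R[i].
Variable zeta : Z -> C.
Hypothesis mzeta : cmeasurable zeta.
Hypothesis zeta1 : forall z, sqc (zeta z) = 1.
Variables (a : C) (k : nat -> int).
Hypothesis aJ : a^* = a.
Hypothesis a_neq0 : a != 0.
Hypothesis a_neq1 : 1 - a != 0.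
Variables (o : Z) (rho : {finite_measure set Z -> \bar R}).
Hypothesis zeta_o : zeta o = 1.
Hypothesis rho_lim : limit_coef zeta a k rho.
Hypothesis rho_one : rho [set z | zeta z = 1] = 0%E.
Local Notation chi := (chi zeta).
Local Notation echi := (echi zeta).
Let kap : {finite_measure set Z -> \bar R} := add_finite (dirac o) rho.

Lemma ge0_integral_add_point_mass (f : Z -> R) : measurable_fun setT f ->
  (forall z, 0 <= f z) ->
  (\int[kap]_z (f z)%:E = (f o)%:E + \int[rho]_z (f z)%:E)%E.
Proof.
move=> mf f0; have mE := (measurable_EFinP _ _).2 mf.
rewrite (ge0_integral_measure_add _ _ measurableT)//; last by move=> z _; rewrite lee_fin.
by rewrite integral_dirac// diracT mul1e.
Qed.

Lemma Rintegral_add_point_mass (f : Z -> R) (M : R) : measurable_fun setT f ->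
  (forall z, `|f z| <= M) ->
  \int[kap]_z (f z) = f o + \int[rho]_z (f z).
Proof.
move=> mf fM; have mE := (measurable_EFinP _ _).2 mf.
have bd (nu : {finite_measure set Z -> \bar R}) : nu.-integrable setT (EFin \o f).
  apply: measurable_bounded_integrable => //; first exact: fin_measure.
  by exists M; split; [exact: num_real|move=> x Mx z _; exact: le_trans (fM z) (ltW Mx)].
rewrite /Rintegral (integral_measure_add _ (bd _) (bd rho))//=.
rewrite integral_dirac// diracT mul1e fineD//.
exact: (integrable_fin_num measurableT (bd rho)).
Qed.

Lemma coef_add_point_mass n : coef zeta kap n = 1 + coef zeta rho n.
Proof.
have [m1 m2] := cmeasurable_chi mzeta zeta1 n.
have H z : `|complex.Re (chi n z)| <= 1 /\ `|complex.Im (chi n z)| <= 1.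
  have := sqc_chi zeta1 n z; rewrite /sqc => H.
  by split; rewrite -(@ler_sqr _ `|_| 1) ?nnegrE// real_normK ?num_real// expr1n -H ?lerDl ?lerDr sqr_ge0.
have chio : chi n o = 1 by rewrite /chi zeta_o exp1rz.
apply: complex_ext; rewrite !(ReD, ImD) /=.
  rewrite (@Rintegral_add_point_mass _ 1)//; first by rewrite chio.
  by move=> z; case: (H z).
rewrite (@Rintegral_add_point_mass _ 1)//; first by rewrite chio.
by move=> z; case: (H z).
Qed.

(** The coefficients of the point mass are all [1], and [a + (1 - a) = 1]. *)
Lemma limit_coef_add_point_mass : limit_coef zeta a k kap.
Proof.
move=> j; rewrite !coef_add_point_mass.
rewrite (_ : _ + _ = 1 + (a * coef zeta rho j + (1 - a) * coef zeta rho (j + 1))); last by ring.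
under eq_fun do rewrite coef_add_point_mass.
by apply: ccvgD; [exact: ccvg_cst|exact: rho_lim].
Qed.

(** The point mass freezes the second variable at [1], where a function of [zw] becomes a
    function of [z]; one approximation on the larger product controls both. *)
Lemma nsq_prod_add_point_mass G : trig zeta G ->
  forall g : Z * Z -> C, cmeasurable g -> (forall z, sqc (g z) <= 1) ->
  let F z := G z - g z in
  nsq (rho \x kap)%E F = nsq rho (fun z => F (z, o)) + nsq (rho \x rho)%E F.
Proof.
move=> tG g mg g1 F.
have [mG [K GK]] := trig_bounded mzeta zeta1 tG.
have mF : cmeasurable F.
  apply: cmeasurableD => //.
  have := cmeasurableM (cmeasurable_cst (-1)) mg.
  by congr cmeasurable; apply/funext => z; rewrite mulN1r.
have FM z : sqc (F z) <= 2 * K + 2.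
  apply: le_trans (sqcD2 _ _) _; rewrite sqcN.
  by have := GK z; have := g1 z; lra.
have mS := measurable_sqc mF.
have LF (nu : {finite_measure set Z -> \bar R}) : L2 (rho \x nu)%E F.
  exact: (L2_bounded (fin_prod rho nu) mF FM).
have mFo : cmeasurable (fun z => F (z, o)).
  exact: (cmeasurable_comp (pair2_measurable o) mF).
have LFo : L2 rho (fun z => F (z, o)) by exact: (L2_bounded (fin_measure rho) mFo).
apply: EFin_inj; rewrite EFinD -!EFin_nsq//.
have mE := (measurable_EFinP _ _).2 mS.
rewrite !fubini_tonelli1//; try by move=> z; rewrite lee_fin sqc_ge0.
rewrite /fubini_F.
have H x : (\int[kap]_y (sqc (F (x, y)))%:E =
    (sqc (F (x, o)))%:E + \int[rho]_y (sqc (F (x, y)))%:E)%E.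
  rewrite (@ge0_integral_add_point_mass (fun y => sqc (F (x, y))))//.
    exact: (measurable_fun_pair2 x mS).
  by move=> z; exact: sqc_ge0.
rewrite (eq_integral _ _ (fun x _ => H x)).
rewrite ge0_integralD//.
- by move=> z _; rewrite lee_fin sqc_ge0.
- by apply/measurable_EFinP; exact: measurable_sqc.
- by move=> z _; apply: integral_ge0 => w _; rewrite lee_fin sqc_ge0.
- by apply: (measurable_fun_fubini_tonelli_F (fun z => (sqc (F z))%:E)) => // z; rewrite lee_fin sqc_ge0.
Qed.

Lemma ae_neq1_snd : {ae (rho \x rho)%E, forall z, zeta z.2 != 1}.
Proof.
exists (setT `*` [set z | zeta z = 1]); split.
- by apply: measurableX => //; exact: measurable_zeta_eq1.
- rewrite product_measure1E//; last exact: measurable_zeta_eq1.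
  by apply: (etrans (congr1 (fun t => (_ * t)%E) rho_one)); rewrite mule0.
- by move=> z /= /negP; rewrite negbK => /eqP.
Qed.

(** Polynomials in one variable may be close to [1] for [rho] and, at [zw], close to
    [0] for [rho \x rho]: this is what keeps the two spectral types apart. *)
Lemma separating_polynomial (e : R) : 0 < e -> exists l : seq (C * int),
  nsq rho (fun z => combo chi l z - 1) < e /\
  nsq (rho \x rho)%E (combo (fun n => echi (n, n)) l) < e.
Proof.
move=> e0.
have t1 : trig zeta (fun=> 1) by exact: trig_cst.
have SL := diag_orbit_L2 mzeta zeta1 rho kap t1.
have A1 := diag_orbit_cst1 mzeta zeta1 rho kap.
have C1 := closed_spanB SL A1 (closed_span_off_one mzeta zeta1 a_neq0 a_neq1 rho_lim limit_coef_add_point_mass rho_one).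
have [_ /(_ (e / 2))] := (closed_spanP SL _).1 C1.
case=> [|s [Ss se]]; first by rewrite divr_gt0.
have [l sl] : exists l, s = combo (fun n => echi (n, n)) l.
  apply: lspan_range_combo; apply: lspan_trans Ss => h [n _ <-].
  by apply: lspan_eq (lspan_gen (imageP _ (I : setT n))) _ => z; rewrite mulr1.
exists l; rewrite sl in Ss se.
set P := combo _ l in Ss se *.
have tP : trig zeta P by apply: lspan_trans Ss => h /(diag_orbit_trig zeta1 t1); exact.
pose g (z : Z * Z) := 1 - off_one zeta z.2 : C.
have gE z : g z = if zeta z.2 == 1 then 1 else 0.
  by rewrite /g /off_one; case: ifP; rewrite ?subr0 ?subrr.
have mg : cmeasurable g.
  have := cmeasurableD (cmeasurable_cst 1) (cmeasurableM (cmeasurable_cst (-1))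
    (cmeasurable_comp measurable_snd (cmeasurable_off_one mzeta) : cmeasurable (fun z : Z * Z => _))).
  by congr cmeasurable; apply/funext => z; rewrite mulN1r.
have g1 z : sqc (g z) <= 1 by rewrite gE; case: ifP; rewrite ?sqc1 ?sqc0.
move: se; rewrite nsqBC.
rewrite (nsq_prod_add_point_mass tP mg g1) => se.
have n1 := nsq_ge0 rho (fun z => P (z, o) - g (z, o)).
have n2 := nsq_ge0 (rho \x rho)%E (fun z => P z - g z).
have e2 : e / 2 < e by rewrite ltr_pdivrMr// ltr_pMr// ltr1n.
split.
  rewrite (_ : (fun z => _) = fun z => P (z, o) - g (z, o)).
    by apply: lt_trans e2; apply: le_lt_trans se; rewrite lerDl.
  apply/funext => z; rewrite gE /= zeta_o eqxx; congr (_ - _).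
  apply: eq_bigr => p _; congr (_ * _).
  by rewrite /echi /tensor /= /chi zeta_o exp1rz mulr1.
have LP := trig_L2 mzeta zeta1 rho rho tP.
have Lg : L2 (rho \x rho)%E g := L2_bounded (fin_prod rho rho) mg g1.
have g0 : nsq (rho \x rho)%E g = 0.
  rewrite -[RHS](nsq_ae Lg (L2_0fun (rho \x rho)%E)).
    by congr nsq; apply/funext => z; rewrite subr0.
  by apply: filterS ae_neq1_snd => z; rewrite gE => /negbTE ->.
have := nsqD2 (L2B LP Lg) Lg; rewrite g0 mulr0 addr0.
under eq_fun do rewrite subrK.
move=> H; apply: le_lt_trans H _; rewrite mulrC -ltr_pdivlMr//.
by apply: le_lt_trans se; rewrite lerDr.
Qed.

End separation.

(** * Approximation by the span of an algebra of functions *)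

Section power_cutoff.
Context {R : realType}.

(** [(1 - t^n)^(n 2^n)] tends to [1] below [1/2] and to [0] from [1/2] on; the
    factor [n] in the exponent is what settles the case [t = 1/2]. *)
Definition cutoff n (t : R) : R := (1 - t ^+ n) ^+ (n * 2 ^ n).

Lemma cutoff_itv n (t : R) : 0 <= t -> t <= 1 -> 0 <= cutoff n t <= 1.
Proof.
move=> t0 t1; have h0 : 0 <= 1 - t ^+ n by rewrite subr_ge0 exprn_ile1.
have h1 : 1 - t ^+ n <= 1 by rewrite gerBl exprn_ge0.
by rewrite exprn_ge0//= exprn_ile1.
Qed.

Lemma cvg_natmul_expr (r : R) : 0 <= r -> r < 1 -> (fun n => n%:R * r ^+ n) @ \oo --> 0.
Proof.
move=> r0 r1; have [->|rn0] := eqVneq r 0.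
  apply: cvg_near_cst; exists 1%N => // n /= n0.
  by rewrite expr0n; case: n n0 => // n _; rewrite mulr0.
have rp : 0 < r by rewrite lt_def rn0.
set s := Num.sqrt r; have sp : 0 < s by rewrite sqrtr_gt0.
have s1 : s < 1 by rewrite -sqrtr1 ltr_sqrt.
have ss : r = s ^+ 2 by rewrite sqr_sqrtr.
pose h := s^-1 - 1; have hp : 0 < h by rewrite subr_gt0 invf_gt1.
have B n : n%:R * r ^+ n <= h^-1 * s ^+ n.
  have sn : 0 < s ^+ n by rewrite exprn_gt0.
  have Bn : 1 + h *+ n <= (s^-1) ^+ n.
    elim: n {sn} => [|n IH]; first by rewrite mulr0n addr0 expr0.
    have si : 0 <= s^-1 by rewrite invr_ge0 ltW.
    have := ler_wpM2l si IH; rewrite -exprS; apply: le_trans.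
    rewrite (_ : s^-1 = 1 + h); last by rewrite /h addrCA subrr addr0.
    rewrite mulrDl mul1r mulrSr addrA mulrDr mulr1.
    have : 0 <= h * (h *+ n) by rewrite mulr_ge0 ?mulrn_wge0 ?ltW.
    by lra.
  rewrite ss -exprM mulnC exprM expr2 mulrA ler_pM2r//.
  rewrite -ler_pdivlMr// -exprVn ler_pdivlMl//.
  by apply: le_trans Bn; rewrite mulr_natr; lra.
apply: (@squeeze_cvgr _ _ _ _ (fun=> 0) (fun n => h^-1 * s ^+ n)).
- by apply: nearW => n; rewrite B andbT mulr_ge0// exprn_ge0.
- exact: cvg_cst.
- rewrite -[X in _ --> X](mulr0 h^-1); apply: cvgMr.
  by apply: cvg_expr; rewrite ger0_norm// ltW.
Qed.

Lemma cutoff_cvg (t : R) : 0 <= t -> t <= 1 ->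
  (fun n => cutoff n t) @ \oo --> (if t < 2^-1 then 1 else 0 : R).
Proof.
move=> t0 t1; case: ltP => t2.
  have r1 : 2 * t < 1 by rewrite -ltr_pdivlMl ?mulr1// -[ltRHS]mul1r mulrC mulr1.
  have r0 : 0 <= 2 * t by rewrite mulr_ge0.
  apply: (@squeeze_cvgr _ _ _ _ (fun n => 1 - n%:R * (2 * t) ^+ n) (fun=> 1)).
  - apply: nearW => n; have /andP[_ ->] := cutoff_itv n t0 t1; rewrite andbT.
    have u1 : t ^+ n <= 1 by rewrite exprn_ile1.
    have u0 : 0 <= t ^+ n by rewrite exprn_ge0.
    have Bern N : 1 - N%:R * t ^+ n <= (1 - t ^+ n) ^+ N.
      elim: N => [|N IH]; first by rewrite mul0r subr0 expr0.
      have h0 : 0 <= 1 - t ^+ n by rewrite subr_ge0.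
      have := ler_wpM2l h0 IH; rewrite -exprS; apply: le_trans.
      rewrite -natr1; have : 0 <= N%:R * (t ^+ n) ^+ 2 by rewrite mulr_ge0// exprn_ge0.
      by rewrite expr2; lra.
    by apply: le_trans (Bern _); rewrite natrM natrX exprMn mulrA.
  - rewrite -[X in _ --> X](subr0 1); apply: cvgB; [exact: cvg_cst|exact: cvg_natmul_expr].
  - exact: cvg_cst.
apply: (@squeeze_cvgr _ _ _ _ (fun=> 0) (fun n => n.+1%:R^-1)).
- apply: nearW => n; have /andP[-> _] /= := cutoff_itv n t0 t1.
  have u1 : t ^+ n <= 1 by rewrite exprn_ile1.
  have u0 : 0 <= t ^+ n by rewrite exprn_ge0.
  have Bern N : 1 + N%:R * t ^+ n <= (1 + t ^+ n) ^+ N.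
    elim: N => [|N IH]; first by rewrite mul0r addr0 expr0.
    have h0 : 0 <= 1 + t ^+ n by rewrite addr_ge0.
    have := ler_wpM2l h0 IH; rewrite -exprS; apply: le_trans.
    rewrite -natr1; have : 0 <= N%:R * (t ^+ n) ^+ 2 by rewrite mulr_ge0// exprn_ge0.
    by rewrite expr2; lra.
  rewrite -[X in _ <= X]mul1r ler_pdivlMr ?ltr0n//.
  apply: (@le_trans _ _ (cutoff n t * (1 + t ^+ n) ^+ (n * 2 ^ n))).
    apply: ler_wpM2l; first by have /andP[] := cutoff_itv n t0 t1.
    apply: le_trans (Bern _); rewrite -natr1 addrC lerD2l natrM natrX -mulrA -exprMn.
    rewrite -[X in X <= _]mulr1 ler_wpM2l// exprn_ege1//.
    by rewrite mulrC -ler_pdivrMr// mul1r.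
  rewrite /cutoff -exprMn exprn_ile1//.
    by apply: mulr_ge0; [rewrite subr_ge0|rewrite addr_ge0].
  by rewrite -subr_sqr expr1n gerBl sqr_ge0.
- exact: cvg_cst.
- exact: cvg_harmonic.
Qed.

End power_cutoff.

Section approximable_sets.
Context {d : measure_display} {Y : measurableType d} {R : realType}.
Variable m : {measure set Y -> \bar R}.
Hypothesis mfin : (m setT < +oo)%E.
Local Notation C := R[i].
Variable S : set (Y -> C).
Hypothesis Sbd : forall h, S h -> cmeasurable h /\ exists K : R, forall x, sqc (h x) <= K.
Hypothesis S1 : S (fun=> 1).
Hypothesis SM : forall f g, S f -> S g -> S (fun x => f x * g x).
Local Notation V := (closed_span m S).

Definition cindic (A : set Y) (x : Y) : C := (\1_A x)%:C.

Let SL h : S h -> L2 m h.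
Proof. by move=> /Sbd[mh [K hK]]; exact: (L2_bounded mfin mh hK). Qed.

Lemma closed_span_mul_lspan s g : lspan S s -> V g -> V (fun x => s x * g x).
Proof.
move=> + Vg; elim=> [|c h t Sh _ IH].
  by apply: closed_span_eq (closed_span0 SL) _ => x; rewrite mul0r.
apply: (@closed_span_eq _ _ _ _ _ (fun x => c * (h x * g x) + t x * g x)); last first.
  by move=> x; rewrite mulrDl mulrA.
apply: closed_spanD => //; apply: closed_spanZ => //.
have [mh [K hK]] := Sbd Sh.
apply: (closed_span_map (F := fun f x => h x * f x) (K := K) SL SL _ _ _ _ _ Vg).
- by move=> f; exact: L2_mul hK.
- by move=> f f'; apply/funext => x; rewrite mulrDr.
- by move=> c' f; apply/funext => x; rewrite mulrCA.
- by move=> f; exact: nsq_mul.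
- by move=> h' Sh'; apply: closed_span_gen => //; exact: SM.
Qed.

Lemma cindicE A x : cindic A x = (x \in A)%:R.
Proof. by rewrite /cindic indicE; case: (x \in A); rewrite ?rmorph1 ?rmorph0. Qed.

Lemma cmeasurable_cindic A : measurable A -> cmeasurable (cindic A).
Proof. by move=> mA; split; [exact: measurable_indic|exact: measurable_cst]. Qed.

Lemma sqc_cindic A x : sqc (cindic A x) <= 1.
Proof. by rewrite cindicE; case: (x \in A); rewrite ?sqc0 ?sqc1. Qed.

Lemma L2_cindic A : measurable A -> L2 m (cindic A).
Proof.
by move=> mA; apply: (L2_bounded (M := 1)) => //; [exact: cmeasurable_cindic|exact: sqc_cindic].
Qed.

Definition approximable (A : set Y) := measurable A /\ V (cindic A).

(** Multiplication by an indicator does not increase the norm, and multiplication by an element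
    of the span preserves the closed span. *)
Lemma approximableI A B : approximable A -> approximable B -> approximable (A `&` B).
Proof.
move=> [mA VA] [mB VB]; split; first exact: measurableI.
apply: closed_span_lim => //; first by apply: L2_cindic; exact: measurableI.
move=> e e0; have [_ /(_ _ e0)[s [Ss se]]] := (closed_spanP SL _).1 VA.
exists (fun x => s x * cindic B x); first exact: closed_span_mul_lspan.
have Ls := lspan_L2 SL Ss; have LA := L2_cindic mA.
apply: le_lt_trans se.
have := nsq_mul (cmeasurable_cindic mB) (@sqc_cindic B) (L2B LA Ls).
rewrite mul1r; congr (nsq _ _ <= _); apply/funext => x.
by rewrite !cindicE in_setI; case: (x \in A); case: (x \in B); rewrite /=; ring.
Qed.

Lemma approximableC A : approximable A -> approximable (~` A).
Proof.
move=> [mA VA]; split; first exact: measurableC.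
apply: closed_span_eq (closed_spanB SL (closed_span_gen SL S1) VA) _ => x.
by rewrite !cindicE in_setC; case: (x \in A); rewrite ?subrr ?subr0.
Qed.

Lemma approximableT : approximable setT.
Proof.
split=> //; apply: closed_span_eq (closed_span_gen SL S1) _ => x.
by rewrite cindicE in_setT.
Qed.

Lemma approximableU A B : approximable A -> approximable B -> approximable (A `|` B).
Proof.
move=> AA AB; rewrite -(setCK (A `|` B)) setCU.
by apply/approximableC/approximableI; exact: approximableC.
Qed.

Lemma approximable_limit (F : nat -> Y -> R) A : measurable A ->
  (forall n, V (fun x => (F n x)%:C)) -> (forall n x, 0 <= F n x <= 1) ->
  (forall x, (fun n => F n x) @ \oo --> (\1_A x : R)) -> approximable A.
Proof.
move=> mA VF F01 cF; split=> //.
have cv : (fun n => nsq m (fun x => (F n x)%:C - cindic A x)) @ \oo --> 0.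
  apply: (@nsq_dominated_cvg _ _ _ _ 4) => //.
  - by move=> n; exact: L2_cmeasurable (closed_span_L2 (VF n)).
  - exact: cmeasurable_cindic.
  - move=> n x; apply: le_trans (sqcD2 _ _) _.
    rewrite sqcN; have := sqc_cindic A x; have /andP[f0 f1] := F01 n x.
    have : sqc (F n x)%:C <= 1.
      by rewrite /sqc /= expr0n /= addr0 expr_le1.
    by lra.
  - apply: aeW => x; apply: ccvg_sqc; split=> /=; [exact: cF|exact: cvg_cst].
apply: closed_span_lim => //; first exact: L2_cindic.
move=> e e0; move/cvgrPdist_lt: cv => /(_ _ e0)[N _ /(_ N (leqnn N))].
rewrite sub0r normrN => H; exists (fun x => (F N x)%:C) => //; rewrite nsqBC.
exact: le_lt_trans (ler_norm _) H.
Qed.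

Lemma approximable_bigcup (F : nat -> set Y) : (forall n, approximable (F n)) ->
  approximable (\bigcup_n F n).
Proof.
move=> AF.
have AU n : approximable (\big[setU/set0]_(i < n) F i).
  elim: n => [|n IH]; last by rewrite big_ord_recr; exact: approximableU.
  by rewrite big_ord0 -setCT; apply: approximableC; exact: approximableT.
apply: (@approximable_limit (fun n => (\1_(\big[setU/set0]_(i < n) F i) : Y -> R))).
- by apply: bigcup_measurable => n _; case: (AF n).
- by move=> n; case: (AU n).
- by move=> n x; rewrite indicE; case: (x \in _); rewrite ?lexx ler01.
move=> x; apply: cvg_near_cst; have [[n _ Fx]|nF] := pselect ((\bigcup_n F n) x).
  exists n.+1 => // k /= nk; rewrite !indicE !mem_set//; first by exists n.
  by rewrite -bigcup_mkord; exists n.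
exists 0%N => // k _; rewrite !indicE !memNset// => H; apply: nF.
by move: H; rewrite -bigcup_mkord => -[i _ Fx]; exists i.
Qed.

Lemma approximable_sigma_algebra : sigma_algebra setT approximable.
Proof.
split.
- by rewrite -setCT; apply: approximableC; exact: approximableT.
- by move=> A AA; rewrite setTD; exact: approximableC.
- exact: approximable_bigcup.
Qed.

Lemma lspan_realX (f : Y -> R) n : lspan S (fun x => (f x)%:C) ->
  lspan S (fun x => (f x ^+ n)%:C).
Proof. by move=> Sf; apply: lspan_eq (lspanX S1 SM n Sf) _ => x; rewrite rmorphXn. Qed.

Lemma lspan_real_affine (f : Y -> R) (p q : R) : lspan S (fun x => (f x)%:C) ->
  lspan S (fun x => (p + q * f x)%:C).
Proof.
move=> Sf; apply: lspan_eq (lspanD (lspan_cst S1 p%:C) (lspanZ q%:C Sf)) _ => x.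
by rewrite rmorphD rmorphM.
Qed.

Lemma approximable_halfline (X : Y -> R) : measurable_fun setT X ->
  (forall y, `|X y| <= 1) -> lspan S (fun y => (X y)%:C) ->
  forall c, approximable (X @^-1` `]-oo, c[).
Proof.
move=> mX X1 SX c.
(* An affine change of variable brings the threshold c to 1/2 and the values of X into [0, 1]. *)
have w0 : 0 < 4 + 2 * `|c| by rewrite ltr_wpDr// mulr_ge0.
pose t y := (2^-1 - c / (4 + 2 * `|c|)) + (4 + 2 * `|c|)^-1 * X y.
have tE y : t y = 2^-1 + (X y - c) / (4 + 2 * `|c|) by rewrite /t; field; rewrite gt_eqF.
have tb y : `|(X y - c) / (4 + 2 * `|c|)| <= 2^-1.
  rewrite normrM normfV (gtr0_norm w0) ler_pdivrMr//.
  have := ler_normB (X y) c; have := X1 y; have := normr_ge0 c; lra.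
have t01 y : 0 <= t y /\ t y <= 1.
  by have := tb y; rewrite ler_norml tE => /andP[? ?]; split; lra.
apply: (@approximable_limit (fun n y => cutoff n (t y))).
- by rewrite -[X in measurable X]setTI; apply: mX.
- move=> n; apply: closed_span_lspan => //; apply: lspan_realX.
  apply: (@lspan_eq _ _ _ _ (fun y => (1 + -1 * (t y) ^+ n)%:C)); last first.
    by move=> y; rewrite mulN1r.
  by apply/lspan_real_affine/lspan_realX/lspan_real_affine.
- by move=> n y; have [t0 t1] := t01 y; exact: cutoff_itv.
- move=> y; have [t0 t1] := t01 y; have := cutoff_cvg t0 t1.
  rewrite indicE (_ : (t y < 2^-1) = (y \in X @^-1` `]-oo, c[)).
    by case: (y \in _).
  rewrite tE gtrDl pmulr_llt0 ?invr_gt0// subr_lt0.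
  by apply/idP/idP; rewrite inE/= in_itv.
Qed.

Lemma approximable_preimage (X : Y -> R) : measurable_fun setT X ->
  (forall y, `|X y| <= 1) -> lspan S (fun y => (X y)%:C) ->
  forall B, measurable B -> approximable (X @^-1` B).
Proof.
move=> mX X1 SX B mB.
have {mB} : (@RGenInftyO.G R).-sigma.-measurable B by rewrite -RGenInftyO.measurableE; exact: mB.
apply: (@smallest_sub _ _ _ [set B | approximable (X @^-1` B)]).
  have [H0 HC HU] := approximable_sigma_algebra; split=> /=.
  - by rewrite preimage_set0.
  - by move=> A AA; rewrite setTD preimage_setC -setTD; exact: HC.
  - by move=> F AF; rewrite preimage_bigcup; exact: HU.
by move=> _ [c ->]; exact: approximable_halfline.
Qed.

Section all_approximable.
Hypothesis approx_all : forall A, measurable A -> approximable A.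

Import HBNNSimple.

Lemma closed_span_nonneg (g : Y -> R) : (forall x, 0 <= g x) ->
  L2 m (fun x => (g x)%:C) -> V (fun x => (g x)%:C).
Proof.
move=> g0 Lg; have [mg _] := L2_cmeasurable Lg.
have mE : measurable_fun setT (EFin \o g) by apply/measurable_EFinP.
pose F := nnsfun_approx measurableT mE.
have cF x : (fun n => F n x) @ \oo --> g x.
  have := cvg_nnsfun_approx measurableT mE (fun x _ => g0 x : (0 <= (g x)%:E)%E) (I : setT x).
  by move/fine_cvgP => [_].
have Fg n x : F n x <= g x.
  have nd : nondecreasing_seq (fun n => F n x).
    by move=> i j ij; exact: (lefP _ _ (nd_nnsfun_approx measurableT mE ij)).
  have := nondecreasing_cvgn_le nd (cvgP _ (cF x)) n.
  by rewrite (cvg_lim _ (cF x)).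
have F0 n x : 0 <= F n x by [].
have mF n : measurable_fun setT (F n) by [].
have VF n : V (fun x => (F n x)%:C).
  have H (r : seq R) : V (fun x => (\sum_(y <- r) y * \1_(F n @^-1` [set y]) x)%:C).
    elim: r => [|y r IH].
      by apply: closed_span_eq (closed_span0 SL) _ => x; rewrite big_nil.
    have my : measurable (F n @^-1` [set y]).
      by rewrite -[X in measurable X]setTI; exact: mF.
    have [_ Vy] := approx_all my.
    apply: closed_span_eq (closed_spanD SL (closed_spanZ SL y%:C Vy) IH) _ => x.
    by rewrite big_cons /cindic rmorphD rmorphM.
  apply: (closed_span_eq (H (finmap.enum_fset (fset_set (range (F n)))))) => x.
  by rewrite [in RHS]fimfunE fsbig_finite//; exact: fimfunP.
have cv : (fun n => nsq m (fun x => (F n x)%:C - (g x)%:C)) @ \oo --> 0.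
  apply: (@nsq_dominated_cvg_fun _ _ _ _ (fun x => sqc (g x)%:C)).
  - by have /L2P[] := Lg.
  - by move=> n; split; [exact: mF|exact: measurable_cst].
  - by split; [exact: mg|exact: measurable_cst].
  - move=> n x; rewrite /sqc !ReImE /= oppr0 addr0 !expr0n /= !addr0.
    rewrite -[X in X <= _]sqrrN opprB ler_sqr ?nnegrE ?subr_ge0//.
    by rewrite gerBl.
  - by apply: aeW => x; apply: ccvg_sqc; split=> /=; [exact: cF|exact: cvg_cst].
apply: closed_span_lim => // e e0; move/cvgrPdist_lt: cv => /(_ _ e0)[N _ /(_ N (leqnn N))].
rewrite sub0r normrN => H; exists (fun x => (F N x)%:C) => //; rewrite nsqBC.
exact: le_lt_trans (ler_norm _) H.
Qed.

Lemma closed_span_real (g : Y -> R) : L2 m (fun x => (g x)%:C) -> V (fun x => (g x)%:C).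
Proof.
move=> Lg; have [mg _] := L2_cmeasurable Lg; have /L2P[_ ig] := Lg.
have H (h : Y -> R) : measurable_fun setT h -> (forall x, 0 <= h x) ->
    (forall x, h x <= `|g x|) -> V (fun x => (h x)%:C).
  move=> mh h0 hg; apply: closed_span_nonneg => //.
  apply: (L2_le _ ig); first by split; [exact: mh|exact: measurable_cst].
  move=> x; rewrite /sqc /= expr0n /= !addr0 -(real_normK (num_real (g x))).
  by rewrite ler_sqr ?nnegrE.
have Vp : V (fun x => (Num.max (g x) 0)%:C).
  apply: H => [|x|x]; first exact: measurable_maxr.
    by rewrite le_max lexx orbT.
  by rewrite ge_max ler_norm normr_ge0.
have Vn : V (fun x => (Num.max (- g x) 0)%:C).
  apply: H => [|x|x]; first by apply: measurable_maxr => //; exact: measurableT_comp.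
    by rewrite le_max lexx orbT.
  by rewrite ge_max -normrN ler_norm normr_ge0.
apply: closed_span_eq (closed_spanB SL Vp Vn) _ => x.
rewrite -rmorphB /=; congr (_%:C); rewrite /Num.max; case: (ltrP (g x) 0) => gx.
  by rewrite oppr_lt0 ltNge (ltW gx)/=; lra.
by rewrite oppr_lt0; case: ltrP => gx'; lra.
Qed.

Lemma closed_span_all f : L2 m f -> V f.
Proof.
move=> /L2P[[mR mI] ifi].
have VR : V (fun x => (complex.Re (f x))%:C).
  apply: closed_span_real; apply: (L2_le _ ifi); first by split; [exact: mR|exact: measurable_cst].
  by move=> x; rewrite /sqc /= expr0n /= addr0 lerDl sqr_ge0.
have VI : V (fun x => (complex.Im (f x))%:C).
  apply: closed_span_real; apply: (L2_le _ ifi); first by split; [exact: mI|exact: measurable_cst].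
  by move=> x; rewrite /sqc /= expr0n /= addr0 lerDr sqr_ge0.
apply: closed_span_eq (closed_spanD SL VR (closed_spanZ SL 'i%C VI)) _ => x.
by rewrite -complexE.
Qed.

End all_approximable.

End approximable_sets.

(** * Density of products and uniqueness of Fourier coefficients *)

Section product_density.
Context {R : realType} {d1 d2 : measure_display}
  {X : measurableType d1} {Y : measurableType d2}.
Local Notation C := R[i].
Variable m : {measure set (X * Y) -> \bar R}.
Hypothesis mfin : (m setT < +oo)%E.

Definition rectangle_indicators : set (X * Y -> C) :=
  [set f | exists A B, [/\ measurable A, measurable B & f = tensor (cindic A) (cindic B)]].

(** Indicators of rectangles are stable under products, and rectangles generate the product
    sigma-algebra. *)
Lemma closed_span_rectangles f : L2 m f -> closed_span m rectangle_indicators f.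
Proof.
have Sbd h : rectangle_indicators h -> cmeasurable h /\ exists K : R, forall x, sqc (h x) <= K.
  move=> [A [B [mA mB ->]]]; split.
    by apply: cmeasurable_tensor; exact: cmeasurable_cindic.
  exists 1 => z; rewrite /tensor sqcM -[leRHS]mulr1.
  by apply: ler_pM; rewrite ?sqc_ge0 ?sqc_cindic.
have rT : rectangle_indicators (fun=> 1).
  exists setT, setT; split => //; apply/funext => z.
  by rewrite /tensor !cindicE !in_setT mulr1.
have rM g h : rectangle_indicators g -> rectangle_indicators h ->
    rectangle_indicators (fun x => g x * h x).
  move=> [A [B [mA mB ->]]] [A' [B' [mA' mB' ->]]].
  exists (A `&` A'), (B `&` B'); split; [exact: measurableI..|].
  apply/funext => z; rewrite /tensor !cindicE !in_setI.
  by case: (z.1 \in A); case: (z.1 \in A'); case: (z.2 \in B); case: (z.2 \in B') => /=; ring.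
apply: (closed_span_all mfin Sbd) => A.
rewrite measurable_prod_measurableType.
apply: (@smallest_sub _ _ _ (approximable m rectangle_indicators)).
  exact: approximable_sigma_algebra.
move=> _ [A1 mA1 [B1 mB1 <-]]; split; first exact: measurableX.
apply: closed_span_gen; first by move=> h /Sbd[mh [K hK]]; exact: (L2_bounded mfin mh hK).
exists A1, B1; split => //; apply/funext => z.
rewrite /tensor !cindicE.
have -> : (z \in A1 `*` B1) = (z.1 \in A1) && (z.2 \in B1).
  by apply/idP/andP; rewrite !inE.
by case: (z.1 \in A1); case: (z.2 \in B1) => /=; rewrite ?mulr1 ?mulr0.
Qed.

End product_density.

Section fourier_uniqueness.
Context {R : realType}.
Local Notation C := R[i].
Local Notation T1 := (circle R).
Local Notation chi := (chi (fun z : T1 => circle_val z)).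

Let mz := @cmeasurable_circle_val R.
Let z1 := @sqc_circle_val R.

Lemma approximable_circle (m : {finite_measure set T1 -> \bar R}) (A : set T1) :
  measurable A -> approximable m (range chi) A.
Proof.
have Sbd h : range chi h -> cmeasurable h /\ exists K : R, forall x, sqc (h x) <= K.
  move=> [n _ <-]; split; first exact: cmeasurable_chi.
  by exists 1 => z; rewrite sqc_chi.
have rT : range chi (fun=> 1) by exists 0.
have rM g h : range chi g -> range chi h -> range chi (fun x => g x * h x).
  by move=> [i _ <-] [j _ <-]; exists (i + j) => //; apply/funext => z; rewrite chiD.
have mfin := fin_measure m.
have AI := approximableI mfin Sbd rM.
have AS := approximable_sigma_algebra mfin Sbd rT rM.
have sR : lspan (range chi) (fun z : T1 => (complex.Re (circle_val z))%:C).
  have := lspanZ 2^-1 (lspanD (lspan_gen (imageP chi (I : setT 1))) (lspan_gen (imageP chi (I : setT (-1))))).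
  move=> H; apply: (lspan_eq H) => z; rewrite chiN// chi1.
  by rewrite addcJ mulKf.
have sI : lspan (range chi) (fun z : T1 => (complex.Im (circle_val z))%:C).
  have := lspanZ (2 * 'i%C)^-1 (lspanB (lspan_gen (imageP chi (I : setT 1))) (lspan_gen (imageP chi (I : setT (-1))))).
  move=> H; apply: (lspan_eq H) => z; rewrite chiN// chi1.
  by rewrite subcJ; field; rewrite eq_complex /= oner_eq0 andbF.
have bR (z : T1) : `|complex.Re (circle_val z)| <= 1.
  by rewrite -(@ler_sqr _ `|_| 1) ?nnegrE// real_normK ?num_real// expr1n -(z1 z) lerDl sqr_ge0.
have bI (z : T1) : `|complex.Im (circle_val z)| <= 1.
  by rewrite -(@ler_sqr _ `|_| 1) ?nnegrE// real_normK ?num_real// expr1n -(z1 z) lerDr sqr_ge0.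
have pR := approximable_preimage mfin Sbd rT rM mz.1 bR sR.
have pI := approximable_preimage mfin Sbd rT rM mz.2 bI sI.
move=> [B mB <-]; rewrite setTI; move: B mB.
have : (fun B : set (R * R) => measurable B) `<=`
    [set B | approximable m (range chi)
      ((fun z : T1 => (complex.Re (circle_val z), complex.Im (circle_val z))) @^-1` B)].
  move=> B /=; rewrite measurable_prod_measurableType.
  apply: (@smallest_sub _ _ _ [set B | approximable m (range chi)
      ((fun z : T1 => (complex.Re (circle_val z), complex.Im (circle_val z))) @^-1` B)]).
    have [H0 HC HU] := AS; split=> /=.
    - by rewrite preimage_set0.
    - by move=> D AD; rewrite setTD preimage_setC -setTD; exact: HC.
    - by move=> F AF; rewrite preimage_bigcup; exact: HU.
  by move=> _ [A1 mA1 [B1 mB1 <-]] /=; apply: AI; [exact: pR|exact: pI].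
by move=> H B /H.
Qed.

(** A finite measure on the circle is determined by its Fourier coefficients: an
    indicator is close, in the mean square of both measures at once, to one
    trigonometric polynomial. *)
Lemma fourier_unique (r1 r2 : {finite_measure set T1 -> \bar R}) :
  (forall n, coef (fun z : T1 => circle_val z) r1 n = coef (fun z : T1 => circle_val z) r2 n) ->
  forall A, measurable A -> r1 A = r2 A.
Proof.
move=> E A mA; have [_ VA] := approximable_circle (add_finite r1 r2) mA.
have Lc (r : {finite_measure set T1 -> \bar R}) h : range chi h -> L2 r h.
  by move=> [n _ <-]; exact: L2_chi.
have LA (r : {finite_measure set T1 -> \bar R}) : L2 r (cindic A) by exact: (L2_cindic (fin_measure r) mA).
have L1 (r : {finite_measure set T1 -> \bar R}) : L2 r (chi 0) by exact: L2_chi.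
have rA (r : {finite_measure set T1 -> \bar R}) : complex.Re (inner r (cindic A) (chi 0)) = fine (r A).
  rewrite /inner /= /Rintegral; congr fine.
  transitivity (\int[r]_x (\1_A x)%:E)%E; last by rewrite integral_indic// setIT.
  by apply: eq_integral => z _; rewrite mulr1 mul0r subr0.
suff : fine (r1 A) = fine (r2 A).
  by move=> H; rewrite -(fineK (fin_num_measure r1 A mA)) H fineK// fin_num_measure.
pose M := fine (r1 setT) + fine (r2 setT).
have nr (r : {finite_measure set T1 -> \bar R}) : nsq r (chi 0) = fine (r setT).
  rewrite /nsq /Rintegral; under eq_integral do rewrite chi0 sqc1.
  by rewrite integral_cst// mul1e.
have nadd s : lspan (range chi) s ->
   nsq (add_finite r1 r2) (fun z => cindic A z - s z) =
   nsq r1 (fun z => cindic A z - s z) + nsq r2 (fun z => cindic A z - s z).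
  move=> Ss; have L (r : {finite_measure set T1 -> \bar R}) : L2 r (fun z => cindic A z - s z) by apply: L2B => //; exact: (lspan_L2 (Lc r) Ss).
  exact: (nsq_add_finite (L _) (L _) (L _)).
apply/eqP; rewrite -subr_eq0 -normr_le0; apply/ler_addgt0Pr => e e0; rewrite add0r.
have [_ /(_ ((e / 2) ^+ 2 / (M + 1)))] := (closed_spanP (Lc _) _).1 VA.
have M0 : 0 <= M by rewrite addr_ge0// fine_ge0.
have M1 : 0 < M + 1 by rewrite ltr_wpDl.
case=> [|s [Ss se]]; first by rewrite divr_gt0// exprn_gt0// divr_gt0.
have Es : inner r1 s (chi 0) = inner r2 s (chi 0).
  elim: (Ss) => [|c h t [n _ <-] St IH]; first by rewrite !inner_0l.
  have Lt (r : {finite_measure set T1 -> \bar R}) : L2 r t := lspan_L2 (Lc r) St.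
  have Ln (r : {finite_measure set T1 -> \bar R}) : L2 r (chi n) by exact: L2_chi.
  rewrite (innerDl (L2Z c (Ln r1)) (Lt r1) (L1 r1)) (innerDl (L2Z c (Ln r2)) (Lt r2) (L1 r2)).
  rewrite (innerZl c (Ln r1) (L1 r1)) (innerZl c (Ln r2) (L1 r2)) IH.
  by rewrite !inner_chi// E.
have B (r : {finite_measure set T1 -> \bar R}) : fine (r setT) <= M ->
   nsq r (fun z => cindic A z - s z) < (e / 2) ^+ 2 / (M + 1) ->
   `|fine (r A) - complex.Re (inner r s (chi 0))| <= e / 2.
  move=> rM rs; have Ls := lspan_L2 (Lc r) Ss.
  have := Re_inner_CS (L2B (LA r) Ls) (L1 r).
  rewrite innerDl ?innerNl ?ReD ?ReN ?rA ?nr//; last exact: L2N.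
  move=> H; rewrite -ler_sqr ?nnegrE ?divr_ge0 ?(ltW e0)// real_normK ?num_real//.
  apply: le_trans H _; apply: (@le_trans _ _ ((e / 2) ^+ 2 / (M + 1) * M)).
    by apply: ler_pM => //; [exact: nsq_ge0|rewrite fine_ge0|exact: ltW].
  by rewrite mulrAC ler_pdivrMr// ler_wpM2l ?sqr_ge0// lerDl.
rewrite nadd// in se.
have n1 := nsq_ge0 r1 (fun z => cindic A z - s z).
have n2 := nsq_ge0 r2 (fun z => cindic A z - s z).
have f1 : 0 <= fine (r1 setT) by rewrite fine_ge0.
have f2 : 0 <= fine (r2 setT) by rewrite fine_ge0.
have B1 := B r1; have B2 := B r2; rewrite -Es in B2.
have := ler_distD (complex.Re (inner r1 s (chi 0))) (fine (r1 A)) (fine (r2 A)).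
move/le_trans; apply; rewrite [X in _ <= X](splitr e) lerD//.
  by apply: B1; [rewrite lerDl|apply: le_lt_trans se; rewrite lerDl].
by rewrite distrC; apply: B2; [rewrite lerDr|apply: le_lt_trans se; rewrite lerDr].
Qed.

End fourier_uniqueness.

(** * Powers of an automorphism *)

Section measure_preserving.
Context {d : measure_display} {Y : measurableType d} {R : realType}.
Variable mu : probability Y R.
Local Notation C := R[i].

Definition preserving (S : Y -> Y) := measurable_fun setT S /\
  forall A, measurable A -> mu (S @^-1` A) = mu A.

Lemma preserving_comp S S' : preserving S -> preserving S' -> preserving (S \o S').
Proof.
move=> [mS pS] [mS' pS']; split; first exact: measurableT_comp.
move=> A mA; rewrite comp_preimage pS' ?pS//.
by rewrite -[X in measurable X]setTI; exact: mS.
Qed.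

Lemma preserving_id : preserving id.
Proof. by split. Qed.

Lemma preserving_iter S n : preserving S -> preserving (iter n S).
Proof.
move=> pS; elim: n => [|n IH]; first exact: preserving_id.
exact: preserving_comp.
Qed.

Lemma preserving_ae S (P : set Y) : preserving S ->
  {ae mu, forall x, P x} -> {ae mu, forall x, P (S x)}.
Proof.
move=> [mS pS] [N [mN N0 PN]]; exists (S @^-1` N); split.
- by rewrite -[X in measurable X]setTI; exact: mS.
- by rewrite pS.
- by move=> x /= nP; exact: PN.
Qed.

Lemma preserving_ge0_integral S (g : Y -> \bar R) : preserving S ->
  measurable_fun setT g -> (forall x, 0 <= g x)%E ->
  (\int[mu]_x g (S x) = \int[mu]_x g x)%E.
Proof.
move=> [mS pS] mg g0.
have := @ge0_integral_pushforward _ _ _ _ R S mS mu setT g measurableT mg (fun x _ => g0 x).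
rewrite preimage_setT => <-; apply: eq_measure_integral => A mA _.
exact: pS.
Qed.

Lemma preserving_integrable S (f : Y -> \bar R) : preserving S ->
  mu.-integrable setT f -> mu.-integrable setT (f \o S).
Proof.
move=> pS /integrableP[mf fi]; apply/integrableP; split.
  by apply: measurableT_comp => //; case: pS.
rewrite (preserving_ge0_integral (g := fun x => `|f x|%E) pS)//.
exact: measurableT_comp.
Qed.

Lemma preserving_integral S (f : Y -> \bar R) : preserving S ->
  mu.-integrable setT f -> (\int[mu]_x f (S x) = \int[mu]_x f x)%E.
Proof.
move=> pS fi; have iS := preserving_integrable pS fi; case: pS => mS pS.
have /integrableP[mf _] := fi.
have := @integral_pushforward _ _ _ _ R S mS mu setT f mf; rewrite preimage_setT.
move=> /(_ iS measurableT) <-; apply: eq_measure_integral => A mA _.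
exact: pS.
Qed.

Lemma preserving_L2 S f : preserving S -> L2 mu f -> L2 mu (f \o S).
Proof.
move=> pS /L2P[mf fi]; apply/L2P; split; last exact: (preserving_integrable pS fi).
by apply: cmeasurable_comp => //; case: pS.
Qed.

Lemma preserving_cintegral S f : preserving S -> cintegrable mu f ->
  cintegral mu (f \o S) = cintegral mu f.
Proof.
move=> pS [f1 f2]; apply: complex_ext; congr fine.
  exact: (preserving_integral pS f1).
exact: (preserving_integral pS f2).
Qed.

Lemma preserving_inner S f g : preserving S -> L2 mu f -> L2 mu g ->
  inner mu (f \o S) (g \o S) = inner mu f g.
Proof. by move=> pS mf mg; rewrite [RHS]/inner -(preserving_cintegral pS (cintegrable_mul mf mg)). Qed.

End measure_preserving.

Section automorphism_powers.
Context {d : measure_display} {Y : measurableType d} {R : realType}.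
Context {mu : probability Y R}.
Variable T : automorphism mu.
Local Notation C := R[i].

Definition aut_pow (n : int) : Y -> Y :=
  match n with Posz m => iter m T | Negz m => iter m.+1 (aut_inv T) end.

Lemma preserving_aut : preserving mu T.
Proof. by split; [exact: aut_measurable|exact: aut_preserving]. Qed.

Lemma preserving_aut_inv : preserving mu (aut_inv T).
Proof.
split; first exact: aut_inv_measurable.
move=> A mA.
have mI : measurable (aut_inv T @^-1` A).
  by rewrite -[X in measurable X]setTI; exact: aut_inv_measurable.
rewrite -(aut_preserving T mI) -comp_preimage.
have mTI : measurable ((aut_inv T \o T) @^-1` A).
  by rewrite comp_preimage -[X in measurable X]setTI; exact: aut_measurable.
have [N [mN N0 PN]] := aut_funK T.
have sub B D : measurable B -> measurable D -> B `\` N `<=` D -> (mu B <= mu D)%E.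
  move=> mB mD BD; apply: (@le_trans _ _ (mu (D `|` N))).
    apply: le_measure; rewrite ?inE//; first exact: measurableU.
    by move=> x Bx; have [Nx|Nx] := pselect (N x); [right|left; apply: BD].
  apply: le_trans (measureU2 _ mD mN) _; rewrite le_eqVlt; apply/orP; left; apply/eqP.
  by apply: (etrans (congr1 (fun t => mu D + t)%E N0)); rewrite adde0.
have K x : ~ N x -> aut_inv T (T x) = x by move=> nN; apply: contrapT => /PN.
apply/eqP; rewrite eq_le; apply/andP; split; apply: sub => // x [Ax /K Kx].
  by rewrite -Kx.
by rewrite /preimage /= Kx.
Qed.

Lemma preserving_pow n : preserving mu (aut_pow n).
Proof.
by case: n => n; apply: preserving_iter; [exact: preserving_aut|exact: preserving_aut_inv].
Qed.

Lemma koopman_powE n (f : Y -> C) : koopman_pow T n f = f \o aut_pow n.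
Proof.
have H (S : Y -> Y) m : iter m (fun g : Y -> C => g \o S) f = f \o iter m S.
  by elim: m => // m IH; rewrite iterS IH; apply/funext => x; rewrite /= -iterSr.
by case: n => n; [exact: (H T)|exact: (H (aut_inv T) n.+1)].
Qed.

Lemma aut_powS (n : int) : {ae mu, forall x, aut_pow (n + 1) x = aut_pow n (T x)}.
Proof.
case: n => n.
  have -> : Posz n + 1 = Posz n.+1 by rewrite intS addrC.
  by apply: aeW => x; rewrite /= -iterSr.
have -> : Negz n + 1 = - n%:Z by rewrite NegzE intS opprD addrAC addNr add0r.
apply: filterS (aut_funK T) => x Kx.
by rewrite [RHS]/= -iterS iterSr Kx; case: n => [|n].
Qed.

(** Only almost everywhere: the inverse map is an inverse mod 0. *)
Lemma aut_powD (m n : int) : {ae mu, forall x, aut_pow (m + n) x = aut_pow m (aut_pow n x)}.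
Proof.
have P1 (i : int) : {ae mu, forall x, aut_pow (i - 1) x = aut_pow i (aut_inv T x)}.
  have := preserving_ae preserving_aut_inv (aut_powS (i - 1)).
  apply: filterS2 (aut_invK T) => x Kx; rewrite subrK Kx => H.
  exact: esym.
elim/int_rec: n => [|n IH|n IH].
- by apply: aeW => x; rewrite addr0.
- rewrite intS addrCA addrC.
  have := preserving_ae preserving_aut IH.
  apply: filterS2 (aut_powS (m + n)) => x -> ->.
  by rewrite /= -iterSr.
- rewrite intS opprD addrCA addrC.
  have := preserving_ae preserving_aut_inv IH.
  apply: filterS2 (P1 (m - n%:Z)) => x -> ->; congr aut_pow.
  by case: n {IH} => [|n] //=; rewrite add0n -iterSr.
Qed.

Lemma koopman_powD m n (f : Y -> C) :
  {ae mu, forall x, koopman_pow T (m + n) f x = koopman_pow T m f (aut_pow n x)}.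
Proof. by apply: filterS (aut_powD m n) => x E; rewrite !koopman_powE /= E. Qed.

Lemma L2_koopman_pow n (f : Y -> C) : L2 mu f -> L2 mu (koopman_pow T n f).
Proof. by move=> mf; rewrite koopman_powE; exact: preserving_L2 (preserving_pow n) mf. Qed.

Lemma inner_koopman_pow m n (f g : Y -> C) : L2 mu f -> L2 mu g ->
  inner mu (koopman_pow T m f) (koopman_pow T n g) = inner mu (koopman_pow T (m - n) f) g.
Proof.
move=> mf mg; have pn := preserving_pow n.
rewrite -(preserving_inner pn (L2_koopman_pow (m - n) mf) mg).
apply: inner_ae; try exact: L2_koopman_pow.
- exact: preserving_L2 (L2_koopman_pow _ mf).
- exact: preserving_L2.
- by have := koopman_powD (m - n) n f; rewrite subrK.
- by apply: aeW => x; rewrite koopman_powE.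
Qed.

End automorphism_powers.

(** * Helly selection on the unit interval *)

Section clamp.
Context {R : realType}.

(** Composing a test function with this retraction onto the unit interval makes it constant on
    either side of the interval. *)
Definition clamp (x : R) : R := Num.max 0 (Num.min x 1).

Lemma clamp_id x : 0 <= x <= 1 -> clamp x = x.
Proof. by move=> /andP[x0 x1]; rewrite /clamp min_l// max_r. Qed.

Lemma clamp_itv x : 0 <= clamp x <= 1.
Proof. by rewrite /clamp le_max lexx ge_max ler01 ge_min lexx orbT. Qed.

Lemma clamp_lipschitz x y : `|clamp x - clamp y| <= `|x - y|.
Proof.
rewrite /clamp /Num.max /Num.min -[x - y]opprB normrN ler_norml.
have := ler_norm (x - y); have := ler_norm (y - x); rewrite distrC => h1 h2.
by case: (ltP x 1) => ?; case: (ltP y 1) => ?; do !case: ltP => ?; apply/andP; split; lra.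
Qed.

End clamp.

Section helly.
Context {R : realType}.
Variables (n : nat -> nat) (s w : nat -> nat -> R).
Hypothesis w0 : forall N j, 0 <= w N j.
Hypothesis w1 : forall N, \sum_(j < n N) (w N j : R) = 1.
Hypothesis s01 : forall N j, 0 <= s N j <= 1.

Definition partial_mass N (t : R) := \sum_(j < n N) (w N j * (s N j <= t)%R%:R : R).

Lemma partial_mass_itv N t : 0 <= partial_mass N t <= 1.
Proof.
rewrite sumr_ge0/=; last by move=> j _; rewrite mulr_ge0.
rewrite -(w1 N); apply: ler_sum => j _.
by rewrite -[leRHS]mulr1 ler_wpM2l// lern1 leq_b1.
Qed.

Lemma partial_mass_nd N : {homo partial_mass N : x y / x <= y}.
Proof.
move=> x y xy; apply: ler_sum => j _; rewrite ler_wpM2l// ler_nat.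
by case: (leP (s N j) x) => // sx; rewrite (le_trans sx xy).
Qed.

Lemma partial_mass_lt0 N t : t < 0 -> partial_mass N t = 0.
Proof.
move=> t0; rewrite /partial_mass big1// => j _.
by have /andP[s0 _] := s01 N j; rewrite leNgt (lt_le_trans t0 s0) mulr0.
Qed.

Lemma partial_mass_ge1 N t : 1 <= t -> partial_mass N t = 1.
Proof.
move=> t1; rewrite -(w1 N); apply: eq_bigr => j _.
by have /andP[_ s1] := s01 N j; rewrite (le_trans s1 t1) mulr1.
Qed.

Variable U : set_system nat.
Hypothesis UU : UltraFilter U.
Hypothesis Uoo : \oo `<=` U.

Let UP : ProperFilter U := ultra_proper.
Existing Instance UP.

Lemma ultra_limit (u : nat -> R) : (forall N, 0 <= u N <= 1) ->
  exists l : R, (u N @[N --> U]) --> l.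
Proof.
move=> u01.
have [|p [_ cp]] := @segment_compact R 0 1 (u @ U) _.
  by apply: Uoo; exists 0%N => // N _ /=; rewrite in_itv/=.
exists p => B pB; have [//|nB] := in_ultra_setVsetC (u @^-1` B) UU.
have [x [nBx Bx]] := cp (~` B) B nB pB.
by case: nBx.
Qed.

(** Limits along an ultrafilter exist at every point at once, which saves the extraction of a
    diagonal subsequence. *)
Definition limit_mass (t : R) : R := xget 0 [set l : R | (partial_mass N t @[N --> U]) --> l].

Lemma limit_massP t : (partial_mass N t @[N --> U]) --> limit_mass t.
Proof.
have [l ul] := ultra_limit (fun N => partial_mass_itv N t).
exact: (@xgetPex R 0 [set l : R | (partial_mass N t @[N --> U]) --> l] (ex_intro _ l ul)).
Qed.

Lemma limit_mass_nd : {homo limit_mass : x y / x <= y}.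
Proof.
move=> x y xy; apply: (@ler_cvg_to _ U _ _ (partial_mass^~ x) (partial_mass^~ y) _ _ (@limit_massP x) (@limit_massP y)).
by apply: nearW => N; exact: partial_mass_nd.
Qed.

Lemma limit_mass_cst t (c : R) : (forall N, partial_mass N t = c) -> limit_mass t = c.
Proof.
move=> E; apply: (@cvg_unique R _ (partial_mass N t @[N --> U]) _ _ _ (@limit_massP t)) => //=.
by under eq_fun do rewrite E; exact: cvg_cst.
Qed.

Lemma limit_mass_lt0 t : t < 0 -> limit_mass t = 0.
Proof. by move=> t0; apply: limit_mass_cst => N; exact: partial_mass_lt0. Qed.

Lemma limit_mass_ge1 t : 1 <= t -> limit_mass t = 1.
Proof. by move=> t0; apply: limit_mass_cst => N; exact: partial_mass_ge1. Qed.

Lemma limit_mass_itv t : 0 <= limit_mass t <= 1.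
Proof.
apply/andP; split.
  have [t0|t0] := ltP t 0; first by rewrite limit_mass_lt0.
  by rewrite -(limit_mass_lt0 (ltrN10 R)); apply: limit_mass_nd; rewrite (le_trans _ t0)// lerN10.
have [t0|t0] := leP 1 t; first by rewrite limit_mass_ge1.
by rewrite -(limit_mass_ge1 (lexx 1)); apply: limit_mass_nd; exact: ltW.
Qed.

(** The right-continuous modification of the limit, which is a distribution function. *)
Definition limit_cdf (t : R) : R := inf (limit_mass @` [set x | t < x]).

Let has_inf_cdf t : has_inf (limit_mass @` [set x | t < x]).
Proof.
split; first by exists (limit_mass (t + 1)), (t + 1) => //=; rewrite ltrDl.
by exists 0 => _ [x _ <-]; case/andP: (limit_mass_itv x).
Qed.

Lemma limit_cdf_le t x : t < x -> limit_cdf t <= limit_mass x.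
Proof. by move=> tx; apply: ge_inf; [case: (has_inf_cdf t)|exists x]. Qed.

Lemma limit_cdf_ge t : limit_mass t <= limit_cdf t.
Proof.
apply: lb_le_inf; first by case: (has_inf_cdf t).
by move=> _ [x /= tx <-]; apply: limit_mass_nd; exact: ltW.
Qed.

Lemma limit_cdf_nd : {homo limit_cdf : x y / x <= y}.
Proof.
move=> x y xy; apply: lb_le_inf; first by case: (has_inf_cdf y).
by move=> _ [z /= yz <-]; apply: limit_cdf_le; exact: le_lt_trans yz.
Qed.

Lemma limit_cdf_rc : right_continuous limit_cdf.
Proof.
move=> t; apply/cvgrPdist_lt => e e0.
have [_ [x /= tx <-] xe] := inf_adherent e0 (has_inf_cdf t).
near=> y; have ty : t < y by near: y; exact: nbhs_right_gt.
have yx : y < x by near: y; exact: nbhs_right_lt.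
rewrite distrC ger0_norm ?subr_ge0; last by apply: limit_cdf_nd; exact: ltW.
by rewrite ltrBlDl; apply: le_lt_trans xe; exact: limit_cdf_le.
Unshelve. all: by end_near. Qed.

HB.instance Definition _ := isCumulative.Build R _ R limit_cdf limit_cdf_nd limit_cdf_rc.

Lemma limit_cdf_lt0 t : t < 0 -> limit_cdf t = 0.
Proof.
move=> t0; apply/eqP; rewrite eq_le; apply/andP; split.
  have h : t < t / 2 by rewrite ltr_pdivlMr// mulr_natr mulr2n gtrDl.
  by rewrite -(limit_mass_lt0 (_ : t / 2 < 0)) ?limit_cdf_le// pmulr_llt0.
by rewrite -(limit_mass_lt0 t0) limit_cdf_ge.
Qed.

Lemma limit_cdf_ge1 t : 1 <= t -> limit_cdf t = 1.
Proof.
move=> t1; apply/eqP; rewrite eq_le; apply/andP; split.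
  have h : t < t + 1 by rewrite ltrDl.
  by rewrite -(limit_mass_ge1 (le_trans t1 (ltW h))) limit_cdf_le.
by rewrite -(limit_mass_ge1 t1) limit_cdf_ge.
Qed.

Lemma limit_cdfNy : limit_cdf @ -oo --> (0 : R).
Proof.
apply: cvg_near_cst; exists 0; split; first exact: num_real.
by move=> x x0; exact: limit_cdf_lt0.
Qed.

Lemma limit_cdfy : limit_cdf @ +oo --> (1 : R).
Proof.
apply: cvg_near_cst; exists 1; split; first exact: num_real.
by move=> x /ltW x1; exact: limit_cdf_ge1.
Qed.

HB.instance Definition _ := isCumulativeBounded.Build R 0 1 limit_cdf limit_cdfNy limit_cdfy.

Definition helly_measure : probability (measurableTypeR R) R :=
  lebesgue_stieltjes_measure limit_cdf.

Lemma helly_measure_ray t : helly_measure `]-oo, t]%classic = (limit_cdf t)%:E.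
Proof. exact: (cdf_lebesgue_stieltjes_id limit_cdf t). Qed.

Section staircase.
Variables (phi : R -> R) (K : nat).

Let t (l : nat) : R := l%:R / K.+1%:R.

(** A step function written by summation by parts as a combination of indicators of half-lines,
    so that its integrals are combinations of values of distribution functions. *)
Definition staircase (x : R) : R :=
  phi 1 - \sum_(0 <= l < K.+1) (phi (t l.+1) - phi (t l)) * (x <= t l)%R%:R.

Let tK : t K.+1 = 1. Proof. by rewrite /t divff// pnatr_eq0. Qed.

Let t_nd l m : (l <= m)%N -> t l <= t m.
Proof. by move=> lm; rewrite /t ler_wpM2r// ler_nat. Qed.

Let tS l : t l.+1 = t l + K.+1%:R^-1.
Proof. by rewrite /t -addn1 natrD mulrDl mul1r. Qed.

Let t01 l : (l <= K.+1)%N -> 0 <= t l <= 1.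
Proof. by move=> lK; rewrite -tK t_nd// andbT divr_ge0. Qed.

Lemma staircase_clamp (x : R) : exists2 l, (l <= K.+1)%N &
  staircase x = phi (t l) /\ `|clamp x - t l| <= K.+1%:R^-1.
Proof.
have [x1|x1] := leP x 1; last first.
  exists K.+1 => //; split; last first.
    by rewrite tK /clamp min_r ?max_r ?ltW// subrr normr0.
  rewrite /staircase big_nat big1 ?subr0 ?tK// => l /andP[_ lK].
  have /andP[_ tl] := t01 (ltnW lK).
  by rewrite leNgt (le_lt_trans tl x1) mulr0.
have ex : exists l, x <= t l by exists K.+1; rewrite tK.
have [l xl lmin] := ex_minnP ex.
have lK : (l <= K.+1)%N by apply: lmin; rewrite tK.
exists l => //; split.
  rewrite /staircase (@big_cat_nat _ _ _ l)//=.
  rewrite [\sum_(0 <= _ < l) _]big_nat [\sum_(0 <= _ < l | _) _]big1; last first.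
    move=> m /andP[_ ml]; have : ~~ (x <= t m) by apply/negP => /lmin; rewrite leqNgt ml.
    by move=> /negbTE ->; rewrite mulr0.
  rewrite add0r big_nat (eq_bigr (fun m => phi (t m.+1) - phi (t m))); last first.
    by move=> m /andP[lm _]; rewrite (le_trans xl (t_nd lm)) mulr1.
  by rewrite -big_nat (telescope_sumr (fun m => phi (t m)))// tK; ring.
have /andP[t0 t1] := t01 lK.
rewrite ler_norml; apply/andP; split; last first.
  rewrite lerBlDl; apply: (@le_trans _ _ (t l)); last by rewrite lerDl.
  by rewrite /clamp ge_max t0 ge_min xl.
rewrite lerBrDl; case: l {xl lK t0 t1} lmin => [|l] lmin.
  rewrite {1}/t mul0r add0r; apply: (@le_trans _ _ 0); first by rewrite oppr_le0.
  by have /andP[] := clamp_itv x.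
rewrite tS addrK; have xl : t l < x.
  by rewrite ltNge; apply/negP => /lmin; rewrite ltnn.
by rewrite /clamp le_max le_min (ltW xl) (le_trans (ltW xl) x1) orbT.
Qed.

Lemma staircase_mean N :
  \sum_(j < n N) (w N j * staircase (s N j) : R) =
  phi 1 - \sum_(0 <= l < K.+1) (phi (t l.+1) - phi (t l)) * partial_mass N (t l).
Proof.
rewrite /staircase (eq_bigr (fun j : 'I__ => w N j * phi 1 -
   \sum_(0 <= l < K.+1) (phi (t l.+1) - phi (t l)) * (w N j * (s N j <= t l)%R%:R))); last first.
  move=> j _; rewrite mulrBr mulr_sumr; congr (_ - _); apply: eq_bigr => l _; ring.
rewrite sumrB -mulr_suml w1 mul1r exchange_big/=; congr (_ - _).
by apply: eq_bigr => l _; rewrite -mulr_sumr.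
Qed.

Let integrable_ray (u : R) : helly_measure.-integrable setT (EFin \o (fun x => (x <= u)%R%:R)).
Proof.
apply: measurable_bounded_integrable => //.
- by rewrite -ge0_fin_numE//; exact: fin_num_measure.
- rewrite (_ : (fun _ => _) = \1_(`]-oo, u]%classic)); first exact: measurable_indic.
  by apply/funext => x; rewrite indicE mem_setE in_itv/=.
- exists 1; split; first exact: num_real.
  by move=> M M1 x _ /=; case: (x <= u); rewrite ?normr1 ?normr0 ?(ltW M1)// (le_trans _ (ltW M1)).
Qed.

Let Rintegral_ray (u : R) : (\int[helly_measure]_x (x <= u)%R%:R)%R = limit_cdf u.
Proof.
rewrite /Rintegral (_ : (fun x => (_)%:E) = (fun x => (\1_(`]-oo, u]%classic) x)%:E)); last first.
  by apply/funext => x; rewrite indicE mem_setE in_itv/=.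
by rewrite integral_indic// setIT; exact: (congr1 fine (helly_measure_ray u)).
Qed.

Lemma staircase_integral :
  helly_measure.-integrable setT (EFin \o staircase) /\
  (\int[helly_measure]_x staircase x)%R =
  phi 1 - \sum_(0 <= l < K.+1) (phi (t l.+1) - phi (t l)) * limit_cdf (t l).
Proof.
have E M : helly_measure.-integrable setT (EFin \o (fun x => \sum_(0 <= l < M) (phi (t l.+1) - phi (t l)) * (x <= t l)%R%:R)) /\
  (\int[helly_measure]_x \sum_(0 <= l < M) (phi (t l.+1) - phi (t l)) * (x <= t l)%R%:R)%R =
  \sum_(0 <= l < M) (phi (t l.+1) - phi (t l)) * limit_cdf (t l).
  elim: M => [|M [iM EM]].
    rewrite big_nil (_ : (fun x => \sum_(0 <= l < 0) _) = cst 0); last first.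
      by apply/funext => x; rewrite big_nil.
    split; last by rewrite Rintegral_cst// mul0r.
    by apply: (eq_integrable _ (cst 0%E)) => //; exact: integrable0.
  have iZ : helly_measure.-integrable setT
      (EFin \o (fun x => (phi (t M.+1) - phi (t M)) * (x <= t M)%R%:R)).
    have := integrableZl measurableT (phi (t M.+1) - phi (t M)) (integrable_ray (t M)).
    exact: eq_integrable.
  rewrite (_ : (fun x => \sum_(0 <= l < M.+1) _) = (fun x =>
      \sum_(0 <= l < M) (phi (t l.+1) - phi (t l)) * (x <= t l)%R%:R +
      (phi (t M.+1) - phi (t M)) * (x <= t M)%R%:R)); last first.
    by apply/funext => x; rewrite big_nat_recr.
  split; first by have := integrableD measurableT iM iZ; exact: eq_integrable.
  by rewrite RintegralD// EM big_nat_recr//= RintegralZl// Rintegral_ray.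
have [iK EK] := E K.+1.
have i1 : helly_measure.-integrable setT (EFin \o (fun=> phi 1)).
  apply: measurable_bounded_integrable => //.
    by rewrite -ge0_fin_numE//; exact: fin_num_measure.
  by exists `|phi 1|; split=> // M M1 x _ /=; exact: ltW.
split; first by have := integrableB measurableT i1 iK; exact: eq_integrable.
rewrite /staircase RintegralB// EK; congr (_ - _).
have h1 : fine (helly_measure setT) = 1 by rewrite probability_setT.
by apply: (etrans (Rintegral_cst helly_measure measurableT _)); rewrite h1 mulr1.
Qed.

End staircase.

(** The limit of the means of the staircase involves [limit_mass] and its integral involves
    [limit_cdf].  At each node the gap between the two is at most the increase of [limit_mass]
    up to the next node, so the gaps add up to at most [1] and contribute at most one step of
    the staircase. *)
Lemma helly_integral (phi : R -> R) (L c : R) : 0 <= L ->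
  (forall x y, `|phi x - phi y| <= L * `|x - y|) ->
  (\sum_(j < n N) (w N j * phi (s N j) : R) @[N --> \oo]) --> c ->
  (\int[helly_measure]_x phi (clamp x))%R = c.
Proof.
move=> L0 phiL phic.
have phiB x : `|phi (clamp x)| <= `|phi 0| + L.
  rewrite -(subrK (phi 0) (phi (clamp x))) addrC (le_trans (ler_normD _ _))// lerD2l.
  rewrite (le_trans (phiL _ _))// -[leRHS]mulr1 ler_wpM2l// subr0.
  by have /andP[c0 c1] := clamp_itv x; rewrite ger0_norm.
have mphi : measurable_fun setT (fun x => phi (clamp x)).
  apply: continuous_measurable_fun => x; apply/cvgrPdist_lt => e e0.
  near=> y; rewrite (le_lt_trans (phiL _ _))//.
  rewrite (@le_lt_trans _ _ ((L + 1) * `|x - y|))//.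
    by apply: ler_pM => //; rewrite ?lerDl ?clamp_lipschitz.
  rewrite mulrC -ltr_pdivlMr ?ltr_wpDl//.
  near: y; apply/nbhs_ballP; exists (e / (L + 1)) => //=.
  by rewrite divr_gt0 ?ltr_wpDl.
have h1 : fine (helly_measure setT) = 1 by rewrite probability_setT.
have hoo : (helly_measure setT < +oo)%E.
  by rewrite -ge0_fin_numE//; exact: fin_num_measure.
have iphi : helly_measure.-integrable setT (EFin \o (fun x => phi (clamp x))).
  apply: measurable_bounded_integrable => //.
  exists (`|phi 0| + L); split=> [|M M1 x _]; first exact: num_real.
  exact: le_trans (phiB x) (ltW M1).
have icst (r : R) : helly_measure.-integrable setT (EFin \o (fun=> r)).
  apply: measurable_bounded_integrable => //.
  by exists `|r|; split=> // M M1 x _ /=; exact: ltW.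
suff H K : `|(\int[helly_measure]_x phi (clamp x))%R - c| <= (3 * L) * K.+1%:R^-1.
  apply/eqP; rewrite -subr_eq0 -normr_le0; apply/ler_addgt0Pr => e e0; rewrite add0r.
  have cv : ((3 * L) * K.+1%:R^-1 : R) @[K --> \oo] --> (0 : R).
    by rewrite -(mulr0 (3 * L)); apply: cvgMr; exact: cvg_harmonic.
  have /cvgrPdist_lt/(_ e e0)[M _ /(_ M (leqnn M))] := cv.
  by rewrite sub0r normrN => /ltW eM; rewrite (le_trans (H M))// (le_trans (ler_norm _)).
have [ist Est] := staircase_integral phi K.
have near_st x : `|phi (clamp x) - staircase phi K x| <= L * K.+1%:R^-1.
  have [l _ [-> cl]] := staircase_clamp phi K x.
  by rewrite (le_trans (phiL _ _))// ler_wpM2l.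
pose t (l : nat) : R := l%:R / K.+1%:R.
pose m := phi 1 - \sum_(0 <= l < K.+1) (phi (t l.+1) - phi (t l)) * limit_mass (t l).
have b1 : `|(\int[helly_measure]_x phi (clamp x))%R - (\int[helly_measure]_x staircase phi K x)%R|
    <= L * K.+1%:R^-1.
  rewrite -RintegralB//.
  have iB : helly_measure.-integrable setT (EFin \o (fun x => phi (clamp x) - staircase phi K x)).
    by have := integrableB measurableT iphi ist; exact: eq_integrable.
  apply: (le_trans (le_normr_Rintegral measurableT iB)).
  apply: (@le_trans _ _ (\int[helly_measure]_x (cst (L * K.+1%:R^-1) x))%R).
    apply: le_Rintegral => //; last exact: icst.
    by have := integrable_abse iB; exact: eq_integrable.
  apply: (le_trans (_ : _ <= L * K.+1%:R^-1 * fine (helly_measure setT))); last by rewrite h1 mulr1.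
  by rewrite le_eqVlt; apply/orP; left; apply/eqP; exact: Rintegral_cst.
have b2 : `|(\int[helly_measure]_x staircase phi K x)%R - m| <= L * K.+1%:R^-1.
  rewrite Est /m opprD opprK addrACA subrr add0r addrC -sumrB.
  rewrite (le_trans (ler_norm_sum _ _ _))//.
  apply: (@le_trans _ _ (\sum_(0 <= l < K.+1) L * K.+1%:R^-1 * (limit_mass (t l.+1) - limit_mass (t l)))).
    apply: ler_sum => l _; rewrite -mulrBr normrM; apply: ler_pM => //.
      rewrite (le_trans (phiL _ _))// ler_wpM2l// /t -mulrBl -natrB// subSnn mul1r.
      by rewrite ger0_norm.
    rewrite distrC ger0_norm ?subr_ge0 ?limit_cdf_ge// lerD2r limit_cdf_le//.
    by rewrite /t ltr_pM2r// ltr_nat.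
  rewrite -mulr_sumr (telescope_sumr (fun l => limit_mass (t l)))//.
  rewrite -[leRHS]mulr1 ler_wpM2l ?mulr_ge0//.
  have /andP[_ l1] := limit_mass_itv (t K.+1); have /andP[l0 _] := limit_mass_itv (t 0).
  lra.
have b3 : `|m - c| <= L * K.+1%:R^-1.
  have mg : (\sum_(j < n N) (w N j * staircase phi K (s N j) : R) @[N --> U]) --> m.
    rewrite (_ : (fun N => \sum_(j < n N) _) = (fun N => phi 1 -
        \sum_(0 <= l < K.+1) (phi (t l.+1) - phi (t l)) * partial_mass N (t l))); last first.
      by apply/funext => N; rewrite staircase_mean.
    apply: cvgB; first exact: cvg_cst.
    apply: cvg_big => [|l _]; first exact: add_continuous.
    by apply: cvgMr; exact: limit_massP.
  have cg : (\sum_(j < n N) (w N j * phi (s N j) : R) @[N --> U]) --> c.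
    exact: (cvg_trans (cvg_app _ Uoo) phic).
  have lim := cvg_norm (cvgB mg cg).
  apply: (ler_cvg_to (lim _ _) (cvg_cst (L * K.+1%:R^-1))).
  apply: nearW => N.
  change (`|\sum_(j < n N) (w N j * staircase phi K (s N j) : R) -
            \sum_(j < n N) (w N j * phi (s N j) : R)| <= L * K.+1%:R^-1).
  rewrite -sumrB (le_trans (ler_norm_sum _ _ _))//.
  apply: (@le_trans _ _ (\sum_(j < n N) (w N j * (L * K.+1%:R^-1) : R))).
    apply: ler_sum => j _; rewrite -mulrBr normrM (ger0_norm (w0 _ _)) ler_wpM2l//.
    by rewrite distrC -[X in phi X](clamp_id (s01 N j)).
  by rewrite -mulr_suml w1 mul1r.
have : `|(\int[helly_measure]_x phi (clamp x))%R - c| <= L * K.+1%:R^-1 + L * K.+1%:R^-1 + L * K.+1%:R^-1.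
  rewrite -[_ - c](subrK (m - c)) (le_trans (ler_normD _ _))// lerD//.
  rewrite opprB addrA subrK. rewrite -(subrK (\int[helly_measure]_x staircase phi K x)%R (\int[helly_measure]_x phi (clamp x))%R) -addrA.
  by rewrite (le_trans (ler_normD _ _))// lerD.
by move=> /le_trans; apply; rewrite le_eqVlt; apply/orP; left; apply/eqP; ring.
Unshelve. all: by end_near. Qed.

End helly.

(** Helly's selection theorem for finitely supported probabilities on the unit interval.  The
    limit is tested on those Lipschitz functions whose means converge. *)
Lemma helly {R : realType} (n : nat -> nat) (s w : nat -> nat -> R) :
  (forall N j, 0 <= w N j) -> (forall N, \sum_(j < n N) (w N j : R) = 1) ->
  (forall N j, 0 <= s N j <= 1) ->
  exists P : probability (measurableTypeR R) R, forall (phi : R -> R) (L c : R),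
    0 <= L -> (forall x y, `|phi x - phi y| <= L * `|x - y|) ->
    (\sum_(j < n N) (w N j * phi (s N j) : R) @[N --> \oo]) --> c ->
    (\int[P]_x phi (clamp x))%R = c.
Proof.
move=> w0 w1 s01; have [U [UU Uoo]] := @ultraFilterLemma _ (\oo : set_system nat) _.
by exists (helly_measure w0 w1 s01 UU Uoo) => phi L c; exact: helly_integral.
Qed.

(** * Roots of unity *)

Section exponential.
Context {R : realType}.
Local Notation C := R[i].

Definition expi (t : R) : C := cos (pi *+ 2 * t) +i* sin (pi *+ 2 * t).

Lemma expiD s t : expi (s + t) = expi s * expi t.
Proof.
by apply: complex_ext; rewrite ?(ReM, ImM) /expi /= mulrDr ?cosD ?sinD// addrC [X in X + _]mulrC mulrC.
Qed.

Lemma expi0 : expi 0 = 1.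
Proof. by rewrite /expi mulr0 cos0 sin0. Qed.

Lemma expi1 : expi 1 = 1.
Proof. by rewrite /expi mulr1 cos2pi sin2pi. Qed.

Lemma expiX n t : expi (n%:R * t) = expi t ^+ n.
Proof.
elim: n => [|n IH]; first by rewrite mul0r expi0.
by rewrite -addn1 natrD mulrDl mul1r expiD IH addn1 exprSr.
Qed.

Lemma sqc_expi t : sqc (expi t) = 1.
Proof. by rewrite /sqc /expi /= cos2Dsin2. Qed.

Lemma expi_neq1 t : 0 < t < 1 -> expi t != 1.
Proof.
move=> /andP[t0 t1]; apply/eqP => -[+ _].
rewrite mulrnAl cos_mulr2n cos2sin2 => E.
have s0 : 0 < sin (pi * t) :> R.
  by apply: sin_gt0_pi; rewrite mulr_gt0 ?pi_gt0//= -[ltRHS]mulr1 ltr_pM2l ?pi_gt0.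
have : sin (pi * t) ^+ 2 = 0 :> R by lra.
by move/eqP; rewrite sqrf_eq0 gt_eqF.
Qed.

Lemma derivative_lipschitz (f df : R -> R) (M : R) :
  (forall x : R, is_derive x (1 : R) f (df x)) -> (forall x, `|df x| <= M) ->
  forall x y, `|f x - f y| <= M * `|x - y|.
Proof.
move=> fd dM x y; wlog xy : x y / x <= y.
  by move=> H; have [/H//|/ltW/H] := leP x y; rewrite distrC (distrC x).
have [|c _ E] := MVT_segment xy (fun z _ => fd z).
  apply: derivable_within_continuous => z _.
  by have := fd z => -[].
rewrite distrC (distrC x) E normrM ler_wpM2r//.
Qed.

Lemma cos_lipschitz (a x y : R) : `|cos (a * x) - cos (a * y)| <= `|a| * `|x - y|.
Proof.
rewrite -normrM mulrBr -[leRHS]mul1r.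
apply: (derivative_lipschitz (fun z => is_derive_cos z)) => z.
by rewrite normrN ler_norml sin_geN1 sin_le1.
Qed.

Lemma sin_lipschitz (a x y : R) : `|sin (a * x) - sin (a * y)| <= `|a| * `|x - y|.
Proof.
rewrite -normrM mulrBr -[leRHS]mul1r.
apply: (derivative_lipschitz (fun z => is_derive_sin z)) => z.
by rewrite ler_norml cos_geN1 cos_le1.
Qed.

Section roots_of_unity.
Variable N : nat.

Definition root_of_unity : C := expi N.+1%:R^-1.

Lemma root_of_unityX j : root_of_unity ^+ j = expi (j%:R / N.+1%:R).
Proof. by rewrite expiX. Qed.

Lemma root_of_unity_order : root_of_unity ^+ N.+1 = 1.
Proof. by rewrite root_of_unityX divff ?pnatr_eq0// expi1. Qed.

Lemma sqc_root_of_unity : sqc root_of_unity = 1.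
Proof. exact: sqc_expi. Qed.

Lemma root_of_unity_inj a b : (a <= N)%N -> (b <= N)%N ->
  root_of_unity ^+ a = root_of_unity ^+ b -> a = b.
Proof.
wlog ab : a b / (a <= b)%N.
  by move=> H aN bN E; have [/H->//|/ltnW/H->//] := leqP a b.
move=> aN bN E; move: ab; rewrite leq_eqVlt => /orP[/eqP//|ab].
have : root_of_unity ^+ (b - a) = 1.
  apply: (mulfI (expf_neq0 a (unit_neq0 sqc_root_of_unity))).
  by rewrite -exprD subnKC ?mulr1 -?E// ltnW.
rewrite root_of_unityX => /eqP; rewrite (negbTE (expi_neq1 _))//.
rewrite divr_gt0 ?ltr0n ?subn_gt0//= ltr_pdivrMr ?ltr0n// mul1r ltr_nat ltnS.
exact: leq_trans (leq_subr _ _) bN.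
Qed.

(** Orthogonality of the characters of a cyclic group. *)
Lemma root_of_unity_sum n m : (n <= N)%N ->
  \sum_(j < N.+1) ((root_of_unity ^+ n)^* * root_of_unity ^+ m) ^+ j =
  (n == m %% N.+1)%N%:R * N.+1%:R.
Proof.
move=> nN; set q := _ * _.
have r0 a : root_of_unity ^+ a != 0 by rewrite expf_neq0// unit_neq0// sqc_root_of_unity.
have rJ : (root_of_unity ^+ n)^* = (root_of_unity ^+ n)^-1.
  by rewrite unit_conj// sqcX sqc_root_of_unity expr1n.
have rmod : root_of_unity ^+ m = root_of_unity ^+ (m %% N.+1)%N.
  by rewrite {1}(divn_eq m N.+1) exprD mulnC exprM root_of_unity_order expr1n mul1r.
have [E|nE] := eqVneq n (m %% N.+1)%N.
  have -> : q = 1 by rewrite /q rJ rmod -E mulVf.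
  by rewrite mul1r (eq_bigr (fun=> 1)) ?sumr_const ?card_ord// => i _; rewrite expr1n.
have q1 : q != 1.
  apply: contra nE => /eqP; rewrite /q rJ rmod => E.
  apply/eqP; apply: root_of_unity_inj => //; first by rewrite -ltnS ltn_mod.
  by rewrite -[LHS]mulr1 -E mulrA mulfV// mul1r.
rewrite mul0r; apply: (mulfI (_ : q - 1 != 0)); first by rewrite subr_eq0.
rewrite mulr0 -subrX1 /q rJ exprMn exprVn -!exprM ![(_ * N.+1)%N]mulnC !exprM.
by rewrite root_of_unity_order !expr1n invr1 mulr1 subrr.
Qed.

End roots_of_unity.
End exponential.

(** * Existence of spectral measures *)

Lemma sqc_inner_le {d} {Y : measurableType d} {R : realType} (m : {measure set Y -> \bar R})
    (f g : Y -> R[i]) : L2 m f -> L2 m g -> sqc (inner m f g) <= nsq m f * nsq m g.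
Proof.
move=> mf mg; set c := inner m f g.
have : complex.Re (inner m f (fun x => c * g x)) ^+ 2 <= nsq m f * nsq m (fun x => c * g x).
  by apply: Re_inner_CS => //; exact: L2Z.
rewrite innerZr// -/c nsqZ// mulrC sqcE /= mulrCA expr2.
have [->|c0] := eqVneq (sqc c) 0; first by rewrite mulr_ge0 ?nsq_ge0.
by rewrite ler_pM2l// lt_neqAle eq_sym c0 sqc_ge0.
Qed.

Lemma nsq_koopman_pow {d} {Y : measurableType d} {R : realType} {mu : probability Y R}
    (T : automorphism mu) n (f : Y -> R[i]) : L2 mu f ->
  nsq mu (koopman_pow T n f) = nsq mu f.
Proof.
move=> mf; apply: (@complexI R); rewrite -!innerE//; last exact: L2_koopman_pow.
by rewrite inner_koopman_pow// subrr.
Qed.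

Section fourier_weights.
Context {d : measure_display} {Y : measurableType d} {R : realType}.
Context {mu : probability Y R}.
Variables (T : automorphism mu) (F : Y -> R[i]).
Hypothesis mF : L2 mu F.
Local Notation C := R[i].

Definition correlation (n : int) : C := inner mu (koopman_pow T n F) F.

Lemma inner_sum n (c c' : 'I_n -> C) (h h' : 'I_n -> Y -> C) :
  (forall i, L2 mu (h i)) -> (forall i, L2 mu (h' i)) ->
  inner mu (fun x => \sum_(i < n) c i * h i x) (fun x => \sum_(i < n) c' i * h' i x) =
  \sum_(i < n) \sum_(j < n) c i * (c' j)^* * inner mu (h i) (h' j).
Proof.
move=> mh mh'; rewrite inner_suml//; last exact: L2_sum.
apply: eq_bigr => i _; rewrite innerC//; last exact: L2_sum.
rewrite inner_suml// rmorph_sum mulr_sumr; apply: eq_bigr => j _.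
by rewrite rmorphM/= -innerC// mulrA.
Qed.

(** The discrete Fourier transform of the orbit segment [F, U F, ..., U^N F]. *)
Definition twisted_sum N j (x : Y) : C :=
  \sum_(n < N.+1) ((root_of_unity N ^+ (j * n))^*) * koopman_pow T (Posz n) F x.

Definition fourier_weight N j : R := nsq mu (twisted_sum N j) / N.+1%:R ^+ 2.

Lemma fourier_weight_ge0 N j : 0 <= fourier_weight N j.
Proof. by rewrite divr_ge0 ?nsq_ge0 ?exprn_ge0. Qed.

Lemma nsq_twisted_sum N j : (nsq mu (twisted_sum N j))%:C =
  \sum_(n < N.+1) \sum_(m < N.+1)
    (root_of_unity N ^+ (j * n))^* * root_of_unity N ^+ (j * m) *
    correlation (Posz n - Posz m).
Proof.
have mk (n : 'I_N.+1) : L2 mu (koopman_pow T (Posz n) F) by exact: L2_koopman_pow.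
rewrite -innerE; last exact: L2_sum.
rewrite inner_sum//; apply: eq_bigr => n _; apply: eq_bigr => m _.
by rewrite conjCK inner_koopman_pow.
Qed.

(** Orthogonality of the roots of unity leaves the pairs of indices [n = m + k] modulo [N + 1]. *)
Lemma fourier_weight_moment N k :
  \sum_(j < N.+1) ((fourier_weight N j)%:C * root_of_unity N ^+ (j * k)) =
  \sum_(m < N.+1) correlation (Posz ((m + k) %% N.+1)%N - Posz m) / N.+1%:R.
Proof.
set w := root_of_unity N; pose M : C := N.+1%:R.
have M0 : M != 0 by rewrite pnatr_eq0.
have E j : (fourier_weight N j)%:C * w ^+ (j * k) = (M ^+ 2)^-1 *
   \sum_(m < N.+1) \sum_(n < N.+1)
    correlation (Posz n - Posz m) * ((w ^+ n)^* * w ^+ (m + k)) ^+ j.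
  rewrite /fourier_weight rmorphM fmorphV rmorphXn rmorph_nat/= nsq_twisted_sum.
  rewrite -[LHS]mulrA [LHS]mulrC -[LHS]mulrA; congr (_ * _).
  rewrite exchange_big mulr_sumr; apply: eq_bigr => m _; rewrite mulr_sumr.
  apply: eq_bigr => n _; rewrite mulrCA mulrA mulrC; congr (_ * _).
  rewrite exprMn -rmorphXn/= -!exprM ![(_ * j)%N]mulnC mulnDr exprD.
  by rewrite -/w -mulrA; congr (_ * _); rewrite mulrC.
rewrite (eq_bigr _ (fun (j : 'I_N.+1) _ => E j)) -mulr_sumr exchange_big/= mulr_sumr.
apply: eq_bigr => m _; rewrite exchange_big/=.
have mN : ((m + k) %% N.+1 < N.+1)%N by rewrite ltn_mod.
rewrite (bigD1 (Ordinal mN))//= [X in _ + X]big1 ?addr0; last first.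
  move=> n nm; rewrite -mulr_sumr root_of_unity_sum; last by rewrite -ltnS.
  by rewrite [(_ == _)%N](negbTE _)// ?mul0r ?mulr0//; apply: contra nm => /eqP ?; exact/eqP/val_inj.
rewrite -mulr_sumr root_of_unity_sum ?eqxx ?mul1r; last by rewrite -ltnS.
by rewrite mulrCA -/M expr2 invfM -mulrA mulVf// mulr1.
Qed.

Lemma correlation0 : correlation 0 = (nsq mu F)%:C.
Proof. by rewrite /correlation innerE. Qed.

Hypothesis F1 : nsq mu F = 1.

Lemma fourier_weight_sum N : \sum_(j < N.+1) (fourier_weight N j : R) = 1.
Proof.
apply: (@complexI R); rewrite rmorph_sum/=.
transitivity (\sum_(j < N.+1) ((fourier_weight N j)%:C * root_of_unity N ^+ (j * 0))).
  by apply: eq_bigr => j _; rewrite muln0 mulr1.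
rewrite fourier_weight_moment (eq_bigr (fun=> N.+1%:R^-1)).
  by rewrite sumr_const card_ord -[LHS]mulr_natr mulVf// pnatr_eq0.
move=> m _; rewrite addn0 modn_small// subrr correlation0 F1.
by rewrite mul1r.
Qed.

Lemma sqc_correlation n : sqc (correlation n) <= 1.
Proof.
have := sqc_inner_le (L2_koopman_pow T n mF) mF.
by rewrite nsq_koopman_pow// F1 mulr1.
Qed.

(** Only the last [k] indices wrap around modulo [N + 1]. *)
Lemma correlation_drift N k m : sqc (correlation (Posz ((m + k) %% N.+1)%N - Posz m) - correlation (Posz k)) <=
  4 * (N.+1 - k <= m)%N%:R.
Proof.
have [mk|mk] := leqP (N.+1 - k) m; last first.
  rewrite modn_small; last by move: mk; rewrite ltn_subRL addnC.
  by rewrite PoszD addrAC subrr add0r subrr sqc0 mulr0.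
rewrite mulr1; have := sqcD2 (correlation (Posz ((m + k) %% N.+1)%N - Posz m)) (- correlation (Posz k)).
move=> /le_trans; apply; have := sqc_correlation (Posz ((m + k) %% N.+1)%N - Posz m).
have := sqc_correlation (Posz k); rewrite sqcN; lra.
Qed.

Lemma tail_count M k : (k <= M)%N -> \sum_(m < M) (M - k <= m)%N%:R = k%:R :> R.
Proof.
move=> kM; rewrite -(big_mkord xpredT (fun m => (M - k <= m)%N%:R)).
rewrite (@big_cat_nat _ _ _ (M - k))//= ?leq_subr//.
rewrite [X in X + _]big_nat [X in X + _]big1 ?add0r; last first.
  by move=> m /andP[_ mk]; rewrite leqNgt mk.
rewrite big_nat (eq_bigr (fun=> 1)); last by move=> m /andP[-> _].
by rewrite -big_nat sumr_const_nat subKn.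
Qed.

(** There are [k] exceptional terms, each bounded by a constant, in an average over [N + 1]. *)
Lemma fourier_weight_moment_cvg k :
  ccvg (fun N => \sum_(j < N.+1) ((fourier_weight N j)%:C * root_of_unity N ^+ (j * k)))
    (correlation (Posz k)).
Proof.
suff H (p : C -> R) : p 0 = 0 -> (forall x y, p (x + y) = p x + p y) ->
    (forall (r : R) x, p (r%:C * x) = r * p x) -> (forall x, p x ^+ 2 <= sqc x) ->
    (p (\sum_(j < N.+1) ((fourier_weight N j)%:C * root_of_unity N ^+ (j * k))) @[N --> \oo]) -->
    p (correlation (Posz k)).
  split; apply: H => //.
  - exact: ReD.
  - by move=> r x; rewrite ReM /= mul0r subr0.
  - by move=> x; rewrite /sqc lerDl sqr_ge0.
  - exact: ImD.
  - by move=> r x; rewrite ImM /= mul0r addr0.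
  - by move=> x; rewrite /sqc lerDr sqr_ge0.
move=> p0 pD pZ psq.
have psum n (h : 'I_n -> C) : p (\sum_(i < n) h i) = \sum_(i < n) p (h i).
  exact: (big_morph p pD p0).
have pN x : p (- x) = - p x.
  by rewrite -mulN1r -[-1](rmorphN1 (real_complex R)) pZ mulN1r.
apply/cvgrPdist_le => e e0.
have cv : ((2 * k%:R) * N.+1%:R^-1 : R) @[N --> \oo] --> (0 : R).
  by rewrite -(mulr0 (2 * k%:R)); apply: cvgMr; exact: cvg_harmonic.
have /cvgrPdist_lt/(_ e e0) := cv.
apply: filter_app; exists k => // N /= kN; rewrite sub0r normrN => /ltW.
rewrite ger0_norm// => /(le_trans _); apply.
rewrite fourier_weight_moment -mulr_suml mulrC.
rewrite (_ : N.+1%:R^-1 = (N.+1%:R^-1 : R)%:C); last by rewrite fmorphV rmorph_nat.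
rewrite pZ psum mulrC distrC.
rewrite -[p (correlation (Posz k))](mulfK (_ : N.+1%:R != 0)) ?pnatr_eq0// -mulrBl.
rewrite normrM [`|_^-1|]ger0_norm// ler_wpM2r//.
rewrite (_ : _ * N.+1%:R = \sum_(m < N.+1) p (correlation (Posz k))); last first.
  by rewrite sumr_const card_ord mulr_natr.
rewrite -sumrB (le_trans (ler_norm_sum _ _ _))//.
apply: (@le_trans _ _ (\sum_(m < N.+1) (2 * (N.+1 - k <= m)%N%:R))); last first.
  by rewrite -mulr_sumr tail_count// (leq_trans kN).
apply: ler_sum => m _; rewrite -pN -pD.
rewrite -(@ler_pXn2r _ 2)// ?nnegrE ?mulr_ge0// real_normK ?num_real//.
rewrite (le_trans (psq _))// (le_trans (correlation_drift _ _ _))//.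
by rewrite exprMn; case: (_ <= _)%N; rewrite ?expr1n ?expr0n/= ?mulr1 ?mulr0//; rewrite -natrX.
Qed.

Lemma herglotz_line : exists P : probability (measurableTypeR R) R,
  forall k : nat, correlation (Posz k) = cintegral P (fun x => expi (k%:R * clamp x)).
Proof.
pose s N j : R := clamp (j%:R / N.+1%:R).
have [P HP] := helly fourier_weight_ge0 fourier_weight_sum
  (fun N j => clamp_itv (j%:R / N.+1%:R : R)).
exists P => k; have [cR cI] := fourier_weight_moment_cvg k.
have sE N (j : 'I_N.+1) : root_of_unity N ^+ (j * k) = expi (k%:R * s N j).
  rewrite /s clamp_id; last first.
    by rewrite divr_ge0//= ler_pdivrMr ?ltr0n// mul1r ler_nat ltnW.
  by rewrite mulnC root_of_unityX natrM mulrA.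
apply: complex_ext; apply/esym.
- apply: (HP (fun x => cos (pi *+ 2 * (k%:R * x))) `|pi *+ 2 * k%:R|) => //.
    by move=> x y; rewrite !mulrA; exact: cos_lipschitz.
  apply: cvg_trans cR; apply: near_eq_cvg; apply: nearW => N.
  rewrite (big_morph (@complex.Re R) ReD (erefl : complex.Re (0 : C) = 0)).
  by apply: eq_bigr => j _; rewrite sE ReM /= mul0r subr0.
- apply: (HP (fun x => sin (pi *+ 2 * (k%:R * x))) `|pi *+ 2 * k%:R|) => //.
    by move=> x y; rewrite !mulrA; exact: sin_lipschitz.
  apply: cvg_trans cI; apply: near_eq_cvg; apply: nearW => N.
  rewrite (big_morph (@complex.Im R) ImD (erefl : complex.Im (0 : C) = 0)).
  by apply: eq_bigr => j _; rewrite sE ImM /= mul0r addr0.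
Qed.

End fourier_weights.

Section scaled_measure.
Context {R : realType} {d : measure_display} {Z : measurableType d}.

Lemma Rintegral_mscale (m : {measure set Z -> \bar R}) (c : {nonneg R}) (u : Z -> R) :
  m.-integrable setT (EFin \o u) ->
  \int[mscale c m]_z (u z) = c%:num * \int[m]_z (u z).
Proof.
move=> iu; have /integrableP[mu _] := iu.
have fp := integrable_pos_fin_num measurableT iu.
have fn := integrable_neg_fin_num measurableT iu.
rewrite /Rintegral [in LHS]integralE [in RHS]integralE.
rewrite !ge0_integral_mscale//; last 2 first.
  exact: measurable_funeneg.
  exact: measurable_funepos.
rewrite -muleBr//; last by rewrite fin_num_adde_defl// fin_numN.
by rewrite fineM// fin_numB fp fn.
Qed.

Lemma coef_mscale (zeta : Z -> R[i]) (m : {finite_measure set Z -> \bar R}) (c : {nonneg R}) n :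
  cmeasurable zeta -> (forall z, sqc (zeta z) = 1) ->
  coef zeta (mscale c m) n = (c%:num)%:C * coef zeta m n.
Proof.
move=> mz z1; have [i1 i2] := cintegrable_chi mz z1 m n.
by apply: complex_ext; rewrite !(ReM, ImM) /= ?(mul0r, subr0, addr0) Rintegral_mscale.
Qed.

End scaled_measure.

Section herglotz.
Context {R : realType}.
Local Notation C := R[i].

Lemma norm_expi (t : R) : `|expi t| == 1 :> C.
Proof.
rewrite -sqrp_eq1// -add_Re2_Im2.
by have := sqc_expi t; rewrite /sqc => ->.
Qed.

Definition circle_point (t : R) : circle R := UnitCircle (norm_expi (clamp t)).

Lemma measurable_clamp : measurable_fun setT (@clamp R).
Proof.
apply: measurable_maxr; first exact: measurable_cst.
by apply: measurable_minr; [exact: measurable_id|exact: measurable_cst].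
Qed.

Lemma cmeasurable_expi (a : R) : cmeasurable (fun t : R => expi (a * clamp t)).
Proof.
have m1 : measurable_fun setT (fun t : R => pi *+ 2 * (a * clamp t)).
  by apply: measurable_funM => //; apply: measurable_funM => //; exact: measurable_clamp.
split.
  apply: (measurableT_comp _ m1); apply: continuous_measurable_fun; exact: continuous_cos.
apply: (measurableT_comp _ m1); apply: continuous_measurable_fun; exact: continuous_sin.
Qed.

Lemma measurable_circle_point : measurable_fun setT (circle_point : measurableTypeR R -> circle R).
Proof.
move=> _ A [B mB <-]; rewrite !setTI.
rewrite -[X in measurable X]setTI; apply: (_ : measurable_fun setT (fun t : R => (cos (pi *+ 2 * clamp t), sin (pi *+ 2 * clamp t)))) => //.
have [m1 m2] := cmeasurable_expi 1.
apply/measurable_fun_pairP; split => /=.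
  by move: m1; under eq_fun do rewrite mul1r.
by move: m2; under eq_fun do rewrite mul1r.
Qed.

HB.instance Definition _ := isMeasurableFun.Build _ _ _ _
  (circle_point : measurableTypeR R -> circle R) measurable_circle_point.

Lemma coef_distribution (P : probability (measurableTypeR R) R) k :
  coef (fun z : circle R => circle_val z)
    (distribution P (circle_point : {mfun measurableTypeR R >-> circle R})) (Posz k) =
  cintegral P (fun t => expi (k%:R * clamp t)).
Proof.
have [m1 m2] := cmeasurable_chi (@cmeasurable_circle_val R) (@sqc_circle_val R) (Posz k).
have E t : chi (fun z : circle R => circle_val z) (Posz k) (circle_point t) =
    expi (k%:R * clamp t) by rewrite expiX.
have L : L2 P (fun t => expi (k%:R * clamp t)).
  apply: (@L2_bounded _ _ _ _ 1); [exact: fin_measure|exact: cmeasurable_expi|].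
  by move=> t; rewrite sqc_expi.
have [i1 i2] : cintegrable P (fun t => expi (k%:R * clamp t)).
  have := cintegrable_mul L (L2_cst P 1).
  by congr cintegrable; apply/funext => z; rewrite conjC1 mulr1.
apply: complex_ext; rewrite /= /Rintegral integral_distribution.
- congr fine; apply: eq_integral => t _.
  exact: (congr1 (fun x => (complex.Re x)%:E) (E t)).
- exact/measurable_EFinP.
- by move: i1; apply: eq_integrable => // t _; exact/esym/(congr1 (fun x => (complex.Re x)%:E) (E t)).
- congr fine; apply: eq_integral => t _.
  exact: (congr1 (fun x => (complex.Im x)%:E) (E t)).
- exact/measurable_EFinP.
- by move: i2; apply: eq_integrable => // t _; exact/esym/(congr1 (fun x => (complex.Im x)%:E) (E t)).
Qed.

Context {d : measure_display} {Y : measurableType d} {mu : probability Y R}.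
Variable T : automorphism mu.

Lemma correlationN (F : Y -> C) n : L2 mu F ->
  correlation T F (- n) = (correlation T F n)^*.
Proof.
move=> mF; rewrite /correlation -(innerC (L2_koopman_pow T n mF) mF).
by have := inner_koopman_pow T 0 n mF mF; rewrite sub0r => ->.
Qed.

(** The norm of [F] is brought to [1] by scaling, and the measure found on the interval is
    transported to the circle by the exponential; negative coefficients follow by conjugation. *)
Lemma herglotz (F : Y -> C) : L2 mu F ->
  exists rho : {finite_measure set (circle R) -> \bar R}, spectral_measure_of T F rho.
Proof.
move=> mF; pose zeta (z : circle R) := circle_val z.
have mz := @cmeasurable_circle_val R; have z1 := @sqc_circle_val R.
suff [rho H] : exists rho : {finite_measure set (circle R) -> \bar R},
    forall k : nat, correlation T F (Posz k) = coef zeta rho (Posz k).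
  exists rho; case=> n; first exact: H.
  rewrite NegzE; apply: (etrans (correlationN _ mF)); rewrite H.
  by rewrite -coefN.
have [F0|F0] := eqVneq (nsq mu F) 0.
  exists (mscale 0%:nng (dirac (point : circle R))) => k.
  rewrite coef_mscale// mul0r.
  apply: sqc_eq0; apply/eqP; rewrite eq_le sqc_ge0 andbT.
  by rewrite (le_trans (sqc_inner_le (L2_koopman_pow T k mF) mF))// F0 mulr0.
pose c : R := Num.sqrt (nsq mu F).
have c2 : c ^+ 2 = nsq mu F by rewrite sqr_sqrtr// nsq_ge0.
have c0 : c != 0 by rewrite -sqrf_eq0 c2.
pose G x := (c^-1)%:C * F x.
have mG : L2 mu G by exact: L2Z.
have G1 : nsq mu G = 1 by rewrite nsqZ// -c2 /sqc /= expr0n addr0 exprVn mulVf ?sqrf_eq0.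
have [P HP] := herglotz_line T mG G1.
exists (mscale (NngNum (nsq_ge0 mu F)) (distribution P (circle_point : {mfun measurableTypeR R >-> circle R}))) => k.
rewrite coef_mscale// coef_distribution -HP /= -c2 /correlation.
have -> : koopman_pow T (Posz k) G = fun x => (c^-1)%:C * koopman_pow T (Posz k) F x.
  by rewrite !koopman_powE.
rewrite innerZl//; last exact: L2_koopman_pow.
rewrite innerZr//; last exact: L2_koopman_pow.
rewrite conjC_real !mulrA -!rmorphM/= (_ : c ^+ 2 * c^-1 * c^-1 = 1) ?mul1r//.
by rewrite expr2 mulfK// mulfV.
Qed.

End herglotz.

(** * Vectors whose spectral measure does not charge a set *)

Section spectral_null_class.
Context {R : realType} {d : measure_display} {Y : measurableType d} {mu : probability Y R}.
Variable T : automorphism mu.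
Local Notation C := R[i].
Local Notation circle_measure := {finite_measure set (circle R) -> \bar R}.
Local Notation zeta := (fun z : circle R => circle_val z).
Implicit Types (F G : Y -> C) (rho : circle_measure).

Lemma coef_add_finite (r1 r2 : circle_measure) n :
  coef zeta (add_finite r1 r2) n = coef zeta r1 n + coef zeta r2 n.
Proof.
have mz := @cmeasurable_circle_val R; have z1 := @sqc_circle_val R.
have [i1 i2] := cintegrable_chi mz z1 r1 n; have [j1 j2] := cintegrable_chi mz z1 r2 n.
apply: complex_ext; rewrite !(ReD, ImD) /= /Rintegral (integral_measure_add measurableT)// fineD//.
- exact: (integrable_fin_num measurableT i1).
- exact: (integrable_fin_num measurableT j1).
- exact: (integrable_fin_num measurableT i2).
- exact: (integrable_fin_num measurableT j2).
Qed.

Lemma add_finiteE (r1 r2 : circle_measure) A : add_finite r1 r2 A = (r1 A + r2 A)%E.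
Proof. exact: measure_addE. Qed.

Lemma spectral_measure_unique F rho rho' A : measurable A ->
  spectral_measure_of T F rho -> spectral_measure_of T F rho' -> rho A = rho' A.
Proof. by move=> mA H H'; apply: fourier_unique => // n; exact: (etrans (esym (H n)) (H' n)). Qed.

Lemma spectral_measureT F rho : L2 mu F -> spectral_measure_of T F rho ->
  rho setT = (nsq mu F)%:E.
Proof.
move=> mF H; have := H 0; rewrite (innerE mF) => /(congr1 (@complex.Re R)) /= ->.
rewrite /Rintegral (_ : (\int[rho]_x 1%:E = rho setT)%E) ?fineK ?fin_num_measure//.
by rewrite integral_cst// mul1e.
Qed.

Lemma correlationD F G n : L2 mu F -> L2 mu G ->
  correlation T (fun x => F x + G x) n + correlation T (fun x => F x - G x) n =
  (correlation T F n + correlation T F n) + (correlation T G n + correlation T G n).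
Proof.
move=> mF mG; have UF := L2_koopman_pow T n mF; have UG := L2_koopman_pow T n mG.
have E : koopman_pow T n (fun x => F x + G x) = fun x => koopman_pow T n F x + koopman_pow T n G x.
  by rewrite !koopman_powE.
have E' : koopman_pow T n (fun x => F x - G x) = fun x => koopman_pow T n F x - koopman_pow T n G x.
  by rewrite !koopman_powE.
have mFG := L2D mF mG; have mFG' := L2B mF mG; have mN := L2N mG; have UN := L2N UG.
rewrite /correlation E E' !innerDl// !innerDr// !innerNl// !innerNr//.
by ring.
Qed.

(** The parallelogram law: the spectral measures of [F + G] and [F - G] add up to twice the sum
    of those of [F] and [G], since the correlations do. *)
Lemma spectral_measureD F G rF rG rS A : measurable A -> L2 mu F -> L2 mu G ->
  spectral_measure_of T F rF -> spectral_measure_of T G rG ->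
  spectral_measure_of T (fun x => F x + G x) rS ->
  (rS A <= (rF A + rF A) + (rG A + rG A))%E.
Proof.
move=> mA mF mG HF HG HS; have [rD HD] := herglotz T (L2B mF mG).
have : add_finite rS rD A = add_finite (add_finite rF rF) (add_finite rG rG) A.
  apply: fourier_unique => // n; rewrite !coef_add_finite.
  rewrite -[coef _ rS n]HS -[coef _ rD n]HD -[coef _ rF n]HF -[coef _ rG n]HG.
  exact: correlationD.
move=> E; apply: (@le_trans _ _ (add_finite rS rD A)).
  by rewrite add_finiteE leeDl.
have <- : add_finite (add_finite rF rF) (add_finite rG rG) A = (rF A + rF A + (rG A + rG A))%E.
  by rewrite add_finiteE; congr (_ + _)%E; exact: add_finiteE.
by rewrite E.
Qed.

Variable A : set (circle R).
Hypothesis mA : measurable A.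

(** Quantified over all spectral measures of [F]: they exist by [herglotz] and agree on
    measurable sets. *)
Definition spectral_null F := L2 mu F /\
  forall rho, spectral_measure_of T F rho -> rho A = 0%E.

Lemma spectral_nullP F rho : L2 mu F -> spectral_measure_of T F rho ->
  rho A = 0%E -> spectral_null F.
Proof.
by move=> mF H A0; split=> // rho' H'; rewrite (spectral_measure_unique mA H' H).
Qed.

Lemma spectral_null_correlation F G : spectral_null F -> L2 mu G ->
  (forall n, correlation T G n = correlation T F n) -> spectral_null G.
Proof.
by move=> [mF HF] mG E; split=> // rho H; apply: HF => n; rewrite -[RHS]H; exact/esym/E.
Qed.

Lemma spectral_nullD F G : spectral_null F -> spectral_null G ->
  spectral_null (fun x => F x + G x).
Proof.
move=> [mF HF] [mG HG]; split; first exact: L2D.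
move=> rho H; have [rF sF] := herglotz T mF; have [rG sG] := herglotz T mG.
apply/eqP; rewrite -measure_le0.
apply: (le_trans (spectral_measureD mA mF mG sF sG H)).
by rewrite (HF _ sF) (HG _ sG) !adde0.
Qed.

Lemma spectral_nullZ (c : C) F : spectral_null F -> spectral_null (fun x => c * F x).
Proof.
move=> [mF HF]; have [rF sF] := herglotz T mF.
apply: (@spectral_nullP _ (mscale (NngNum (sqc_ge0 c)) rF)); first exact: L2Z.
  move=> n; rewrite -[RHS]/(coef zeta (mscale (NngNum (sqc_ge0 c)) rF) n) coef_mscale /=.
  - rewrite -[coef _ _ _]sF koopman_powE -sqcE.
    rewrite -[(fun x => c * F x) \o _]/(fun x => c * (F \o aut_pow T n) x) -koopman_powE.
    by rewrite innerZl ?innerZr ?mulrA//; [exact: L2_koopman_pow|exact: L2_koopman_pow|exact: L2Z].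
  - exact: cmeasurable_circle_val.
  - exact: sqc_circle_val.
by apply: (etrans (congr1 (fun t => (sqc c)%:E * t)%E (HF _ sF))); rewrite mule0.
Qed.

(** If [F] is close to a null [G], then the mass that [F] gives to [A] is at most twice that of
    [F - G], whose total mass is the squared norm of [F - G]. *)
Lemma spectral_null_lim F : L2 mu F ->
  (forall e : R, 0 < e -> exists2 G, spectral_null G & nsq mu (fun x => F x - G x) < e) ->
  spectral_null F.
Proof.
move=> mF H; split=> // rho sF; apply/eqP; rewrite -measure_le0.
apply/lee_addgt0Pr => e e0; rewrite add0e.
have [G [mG HG] FG] := H (e / 2) (divr_gt0 e0 (ltr0Sn _ 1)).
have mD := L2B mF mG; have [rD sD] := herglotz T mD; have [rG sG] := herglotz T mG.
have sF' : spectral_measure_of T (fun x => (F x - G x) + G x) rho.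
  by move=> n; rewrite -[RHS]sF; congr inner; [congr koopman_pow|]; apply/funext => x; rewrite subrK.
apply: (le_trans (spectral_measureD mA mD mG sD sG sF')).
rewrite (HG _ sG) !adde0.
have : (rD A <= (e / 2)%:E)%E.
  apply: (@le_trans _ _ (rD setT)); first by apply: le_measure; rewrite ?inE.
  by rewrite (spectral_measureT mD sD) lee_fin ltW.
by move=> D; apply: (le_trans (leeD D D)); rewrite -EFinD lee_fin -splitr.
Qed.

Lemma spectral_null0 : spectral_null (fun=> 0).
Proof.
have m0 := L2_0fun mu; split=> // rho H; apply/eqP; rewrite -measure_le0.
apply: (@le_trans _ _ (rho setT)); first by apply: le_measure; rewrite ?inE.
rewrite (spectral_measureT m0 H) (_ : nsq mu _ = 0)//.
rewrite -[RHS](nsq_self mu (fun=> 0 : C)); congr nsq; apply/funext => x.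
by rewrite subrr.
Qed.

Lemma spectral_null_closed_span S F : (forall G, S G -> spectral_null G) ->
  closed_span mu S F -> spectral_null F.
Proof.
move=> SN; have SL G : S G -> L2 mu G by move=> /SN[].
move=> /(closed_spanP SL)[mF H]; apply: spectral_null_lim => // e e0.
have [s [Ss se]] := H e e0; exists s => //.
elim: Ss => [|c h t Sh _ IH].
  exact: spectral_null0.
by apply: spectral_nullD => //; apply: spectral_nullZ; exact: SN.
Qed.

Lemma spectral_null_koopman m F : spectral_null F -> spectral_null (koopman_pow T m F).
Proof.
move=> NF; have [mF _] := NF; apply: (spectral_null_correlation NF); first exact: L2_koopman_pow.
move=> n; have mU := L2_koopman_pow T m mF.
rewrite /correlation -[in RHS](addrK m n) -inner_koopman_pow//.
apply: inner_ae => //; try exact: L2_koopman_pow.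
  have := koopman_powD T m n F; rewrite addrC; apply: filterS => x ->.
  by rewrite (koopman_powE T n).
exact: aeW.
Qed.

End spectral_null_class.

(** * Consequences of ergodicity *)

Section borel_cantelli_L2.
Context {R : realType} {d : measure_display} {Y : measurableType d}.
Variable m : {measure set Y -> \bar R}.
Local Notation C := R[i].
Variable h : nat -> Y -> C.
Hypothesis mh : forall n, L2 m (h n).
Hypothesis h_small : forall n, nsq m (h n) <= 8^-1 ^+ n.

(** The exponents [4^-n] here and [8^-n] in the bound on norms leave the summable masses [2^-n]. *)
Definition large n : set Y := [set x | 4^-1 ^+ n < sqc (h n x)].

Lemma measurable_large n : measurable (large n).
Proof.
rewrite (_ : large n = (fun x => sqc (h n x)) @^-1` `]4^-1 ^+ n, +oo[%classic); last first.
  by apply/seteqP; split=> x; rewrite /large /= in_itv/= andbT.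
rewrite -[X in measurable X]setTI; apply: measurable_sqc => //.
exact: L2_cmeasurable (mh n).
Qed.

Lemma measure_large n : (m (large n) <= (2 / (2 ^ n.+1)%:R)%:E)%E.
Proof.
have mS := measurable_sqc (L2_cmeasurable (mh n)); have mE := (measurable_EFinP _ _).2 mS.
have : ((4^-1 ^+ n)%:E * m (large n) <= (8^-1 ^+ n)%:E)%E.
  rewrite -integral_cst//; last exact: measurable_large.
  apply: (@le_trans _ _ (\int[m]_(x in large n) (sqc (h n x))%:E)%E).
    apply: ge0_le_integral => //.
    - exact: measurable_large.
    - by move=> x _; rewrite lee_fin.
    - by apply: measurable_funTS.
    - by move=> x; rewrite /large /= lee_fin => /ltW.
  apply: (@le_trans _ _ (\int[m]_x (sqc (h n x))%:E)%E).
    apply: ge0_subset_integral => //; first exact: measurable_large.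
    by move=> x _; rewrite lee_fin sqc_ge0.
  by rewrite EFin_nsq// lee_fin.
have p4 : 0 < 4^-1 ^+ n :> R by rewrite exprn_gt0// invr_gt0 ltr0n.
rewrite muleC -lee_pdivlMr// => /le_trans; apply.
rewrite -EFinM lee_fin -exprVn invrK -exprMn natrX exprS invfM mulrA divff ?pnatr_eq0// mul1r.
by rewrite -exprVn (_ : 8^-1 * 4 = 2^-1 :> R)//; field.
Qed.

Lemma borel_cantelli_large : m (lim_sup_set large) = 0%E.
Proof.
apply: lim_sup_set_cvg0; first exact: measurable_large.
apply: (@le_lt_trans _ _ (\sum_(0 <= n <oo) (2 / (2 ^ n.+1)%:R)%:E)%E).
  by apply: lee_nneseries => // n _; exact: measure_large.
by apply: le_lt_trans (epsilon_trick0 _ _) _; rewrite ?ltry.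
Qed.

Lemma not_lim_sup_large x : ~ lim_sup_set large x ->
  exists k, forall n, (k <= n)%N -> sqc (h n x) <= 4^-1 ^+ n.
Proof.
move=> /existsNP[k] /not_implyP[_ nk]; exists k => n kn; rewrite leNgt; apply/negP => H.
by apply: nk; exists n.
Qed.

Lemma measurable_lim_sup_large : measurable (lim_sup_set large).
Proof.
by apply: bigcapT_measurable => n; apply: bigcup_measurable => k _; exact: measurable_large.
Qed.

Lemma ae_eventually_small : {ae m, forall x,
  exists k, forall n, (k <= n)%N -> sqc (h n x) <= 4^-1 ^+ n}.
Proof.
exists (lim_sup_set large); split; [exact: measurable_lim_sup_large|exact: borel_cantelli_large|].
by move=> x /= nx; apply: contrapT => /not_lim_sup_large.
Qed.

End borel_cantelli_L2.

Section ergodic_constants.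
Context {R : realType} {d : measure_display} {Y : measurableType d} {mu : probability Y R}.
Variable T : automorphism mu.
Hypothesis T_ergodic : ergodic T.

Lemma ae_False : ~ {ae mu, forall x : Y, False}.
Proof.
move=> [N [mN N0 H]].
have NT : N = setT by apply/seteqP; split=> // x _; apply: H.
have := probability_setT mu; rewrite -NT => N1.
have := etrans (esym N1) N0; by move/eqP; rewrite onee_eq0.
Qed.

(** An almost invariant set is replaced by the set of points whose orbit meets it infinitely
    often, which is strictly invariant. *)
Lemma ergodic_ae_set (A : set Y) : measurable A -> {ae mu, forall x, A (T x) <-> A x} ->
  {ae mu, forall x, ~ A x} \/ {ae mu, forall x, A x}.
Proof.
move=> mA TA; pose B := lim_sup_set (fun n => iter n T @^-1` A).
have mB : measurable B.
  apply: bigcapT_measurable => n; apply: bigcup_measurable => k _.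
  rewrite -[X in measurable X]setTI.
  by have [mi _] := preserving_iter k (preserving_aut T); exact: mi.
have BA : {ae mu, forall x, B x <-> A x}.
  have : {ae mu, forall x, forall n, A (iter n T (T x)) <-> A (iter n T x)}.
    apply: ae_foralln => n.
    have := preserving_ae (preserving_iter n (preserving_aut T)) TA.
    by apply: filterS => x; rewrite -iterS iterSr.
  apply: filterS => x H.
  have AE n : A (iter n T x) <-> A x.
    by elim: n => [|n IH]//; rewrite iterSr; apply: iff_trans IH; exact: H.
  split; first by move=> /(_ 0%N I)[n _ /= /AE].
  by move=> Ax n _; exists n => //=; apply/AE.
have TB : T @^-1` B = B.
  apply/seteqP; split=> x Bx n _.
    by have [k /= nk Ak] := Bx n I; exists k.+1; [exact: leqW|rewrite /preimage /= -iterS iterSr].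
  have [k /= nk Ak] := Bx n.+1 I; case: k nk Ak => // k nk Ak.
  by exists k => //; move: Ak; rewrite /preimage /= -iterS iterSr.
have [B0|B1] := T_ergodic mB TB.
  left; have : {ae mu, forall x, ~ B x} by exists B; split=> // x /= /contrapT.
  by apply: filterS2 BA => x BAx nB /BAx.
right; have : {ae mu, forall x, B x}.
  exists (~` B); split=> //; first exact: measurableC.
  by rewrite probability_setC// B1 subee.
by apply: filterS2 BA => x BAx /BAx.
Qed.

(** The sets [u > c] are null or of full measure; the value of [u] is the supremum of those [c]
    for which they are of full measure. *)
Lemma ergodic_ae_constant (u : Y -> R) : measurable_fun setT u ->
  {ae mu, forall x, u (T x) = u x} -> exists c, {ae mu, forall x, u x = c}.
Proof.
move=> mu_ Tu; pose S := [set c | {ae mu, forall x, c < u x}].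
have dich c : S c \/ {ae mu, forall x, u x <= c}.
  have mE : measurable [set x | c < u x].
    rewrite (_ : [set x | _] = u @^-1` `]c, +oo[%classic).
      by rewrite -[X in measurable X]setTI; exact: mu_.
    by apply/seteqP; split=> x /=; rewrite in_itv/= andbT.
  have : {ae mu, forall x, [set x | c < u x] (T x) <-> [set x | c < u x] x}.
    by apply: filterS Tu => x /= ->.
  move=> /(ergodic_ae_set mE)[H|H]; [right|by left].
  by apply: filterS H => x /= /negP; rewrite -leNgt.
have supS : has_sup S.
  split.
    apply: contrapT => nS; apply: ae_False.
    have : {ae mu, forall x, forall j : nat, u x <= - j%:R}.
      apply: ae_foralln => j; have [Sj|//] := dich (- j%:R).
      by exfalso; apply: nS; exists (- j%:R).
    apply: filterS => x H.
    by have := H (Num.Def.trunc (- u x)).+1; rewrite lerNr leNgt truncnS_gt.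
  apply: contrapT => nS; apply: ae_False.
  have : {ae mu, forall x, forall j : nat, j%:R <= u x}.
    apply: ae_foralln => j; have [Sj|Hj] := dich j%:R; first by apply: filterS Sj => x /ltW.
    exfalso; apply: nS; exists j%:R => c Sc; rewrite leNgt; apply/negP => jc.
    by apply: ae_False; apply: filterS2 Hj Sc => x uj cu; have := lt_le_trans cu uj; rewrite ltNge (ltW jc).
  apply: filterS => x H.
  by have := H (Num.Def.trunc (u x)).+1; rewrite leNgt truncnS_gt.
exists (sup S).
have : {ae mu, forall x, forall j : nat, `|u x - sup S| <= j.+1%:R^-1}.
  apply: ae_foralln => j; have j0 : 0 < j.+1%:R^-1 :> R by [].
  have [c Sc cS] := sup_adherent j0 supS.
  have [Sj|Hj] := dich (sup S + j.+1%:R^-1).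
    by have := ub_le_sup supS.2 Sj; rewrite leNgt ltrDl j0.
  apply: filterS2 Hj Sc => x uj cu; rewrite ler_distl uj andbT.
  by rewrite ltW// (lt_trans cS).
apply: filterS => x H; apply/eqP; rewrite -subr_eq0 -normr_le0.
apply/ler_addgt0Pr => e e0; rewrite add0r.
have cv : (j.+1%:R^-1 : R) @[j --> \oo] --> (0 : R) by exact: cvg_harmonic.
have /cvgrPdist_lt/(_ e e0)[M _ /(_ M (leqnn M))] := cv.
by rewrite sub0r normrN => /ltW eM; rewrite (le_trans (H M))// (le_trans (ler_norm _)).
Qed.

End ergodic_constants.

Lemma inner_cst {d} {Y : measurableType d} {R : realType} (m : probability Y R) (c : R[i]) :
  inner m (fun=> c) (fun=> 1) = c.
Proof.
rewrite (_ : (fun=> c) = (fun=> c * 1)); last by apply/funext => x; rewrite mulr1.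
rewrite innerZl ?innerE; [|exact: L2_cst..].
rewrite /nsq Rintegral_cst// sqc1 mul1r (_ : fine _ = 1) ?mulr1//.
exact: (congr1 fine (probability_setT m)).
Qed.

Lemma cintegral_inner1 {d} {Y : measurableType d} {R : realType} (m : measure Y R)
    (h : Y -> R[i]) : cintegral m h = inner m h (fun=> 1).
Proof. by congr cintegral; apply/funext => x; rewrite conjC1 mulr1. Qed.

Lemma limn_einf_le {R : realType} (u : nat -> \bar R) (M : \bar R) :
  (forall n, u n <= M)%E -> (limn_einf u <= M)%E.
Proof.
move=> uM; rewrite limn_einf_lim; apply: lime_le.
  by apply: ereal_nondecreasing_is_cvgn; exact: nondecreasing_einfs.
apply: nearW => n; apply: le_trans (uM n); apply: ereal_inf_lbound.
by exists n => //=.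
Qed.

Lemma measurable_limn_einf {d} {Y : measurableType d} {R : realType}
    (f : nat -> Y -> \bar R) : (forall n, measurable_fun setT (f n)) ->
  measurable_fun setT (fun x => limn_einf (f ^~ x)).
Proof.
move=> mf; rewrite (_ : (fun x => _) = fun x => (- limn_esup ((fun n x => - f n x) ^~ x))%E).
  apply: measurableT_comp => //; apply: measurable_fun_limn_esup => n.
  exact: measurableT_comp.
by apply/funext => x; rewrite (limn_esupN (f ^~ x)) oppeK.
Qed.

Section mean_ergodic.
Context {R : realType}.
Local Notation C := R[i].

Lemma summable_increments_cvg (u : nat -> R) k :
  (forall n, (k <= n)%N -> `|u n.+1 - u n| <= 2^-1 ^+ n) -> cvgn u.
Proof.
move=> H; pose v n := u (n + k)%N.
have cv : cvgn v.
  have h2 : `|2^-1 : R| < 1 by rewrite ger0_norm ?invr_ge0// invf_lt1 ?ltr1n.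
  have : cvgn (series (fun n => v n.+1 - v n)).
    apply: normed_cvg; apply: (@series_le_cvg _ _ (geometric 1 2^-1)) => [n|n|n|] //=.
    - rewrite mul1r /v addSn (le_trans (H _ (leq_addl _ _)))//.
      by rewrite ler_wiXn2l ?invr_ge0 ?leq_addr// ltW// invf_lt1 ?ltr1n.
    - exact: is_cvg_geometric_series.
  move=> /cvg_ex[l sl]; apply/cvg_ex; exists (l + v 0%N).
  apply: cvg_trans (cvgD sl (cvg_cst (v 0%N))); apply: near_eq_cvg; apply: nearW => n.
  change (\sum_(0 <= j < n) (v j.+1 - v j) + v 0%N = v n).
  by rewrite (telescope_sumr v)// subrK.
by move: cv => /cvg_ex[l vl]; apply/cvg_ex; exists l; rewrite -(cvg_shiftn k).
Qed.

Lemma norm_le_sqc (x : C) n : sqc x <= 4^-1 ^+ n ->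
  `|complex.Re x| <= 2^-1 ^+ n /\ `|complex.Im x| <= 2^-1 ^+ n.
Proof.
rewrite (_ : 4^-1 = 2^-1 ^+ 2 :> R); last by rewrite expr2; field.
rewrite -exprM mulnC exprM /sqc => H.
have p2 : 0 <= 2^-1 ^+ n :> R by rewrite exprn_ge0// invr_ge0.
by split; rewrite -(@ler_pXn2r _ 2)// ?nnegrE// real_normK ?num_real//;
   apply: le_trans H; rewrite ?lerDl ?lerDr sqr_ge0.
Qed.

Lemma geometric_small (e : R) (c : R) : 0 <= c < 1 -> 0 < e -> exists k, forall n, (k <= n)%N -> c ^+ n < e.
Proof.
move=> /andP[c0 c1] e0; have : (c ^+ n @[n --> \oo]) --> (0 : R).
  by apply: cvg_expr; rewrite ger0_norm.
move=> /cvgrPdist_lt/(_ e e0)[k _ H]; exists k => n kn.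
by have := H n kn; rewrite sub0r normrN ger0_norm// exprn_ge0.
Qed.

Context {d : measure_display} {Y : measurableType d} {mu : probability Y R}.
Variable T : automorphism mu.
Hypothesis T_ergodic : ergodic T.
Variable g : nat -> Y -> C.
Hypothesis mg : forall n, L2 mu (g n).
Hypothesis g_cauchy : forall n m, (n <= m)%N -> nsq mu (fun x => g m x - g n x) <= 8^-1 ^+ n.
Hypothesis g_inv : forall n, nsq mu (fun x => g n (T x) - g n x) <= 8^-1 ^+ n.
Hypothesis g_mean : forall n, inner mu (g n) (fun=> 1) = 0.

Let real_limit (p : C -> R) : (forall x y, p (x - y) = p x - p y) ->
  (forall n, measurable_fun setT (fun x => p (g n x))) ->
  (forall x n, sqc x <= 4^-1 ^+ n -> `|p x| <= 2^-1 ^+ n) ->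
  exists c : R, {ae mu, forall x, (p (g n x) @[n --> \oo]) --> c}.
Proof.
move=> pB mp psq.
pose u x := fine (limn_esup (fun n => (p (g n x))%:E)).
have mu_ : measurable_fun setT u.
  apply: measurableT_comp => //; apply: measurable_fun_limn_esup => n.
  exact/measurable_EFinP.
have uE x (l : R) : (p (g n x) @[n --> \oo]) --> l -> u x = l.
  move=> gl; have /cvg_limn_einf_sup[_ E] : ((p (g n x))%:E @[n --> \oo]) --> l%:E.
    by apply: cvg_EFin => //; exact: nearW.
  by rewrite /u E.
have mD n : L2 mu (fun x => g n.+1 x - g n x) by exact: L2B.
have mI n : L2 mu (fun x => g n (T x) - g n x).
  by apply: L2B => //; apply: preserving_L2 (mg n); exact: preserving_aut.
have aeD := ae_eventually_small mD (fun n => g_cauchy (leqnSn n)).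
have aeI := ae_eventually_small mI g_inv.
have cvg_u : {ae mu, forall x, (p (g n x) @[n --> \oo]) --> u x}.
  apply: filterS aeD => x [k H].
  have /cvg_ex[l gl] : cvgn (fun n => p (g n x)).
    by apply: (@summable_increments_cvg _ k) => n kn; rewrite -pB; apply: psq; exact: H.
  by rewrite (uE _ _ gl).
have uT : {ae mu, forall x, u (T x) = u x}.
  apply: filterS2 aeI cvg_u => x [k H] ux; apply: uE.
  have cT : (p (g n (T x)) - p (g n x) @[n --> \oo]) --> (0 : R).
    apply/cvgrPdist_lt => e e0.
    have [|k' Hk'] := @geometric_small e 2^-1 _ e0.
      by rewrite invr_ge0 ler0n/= invf_lt1 ?ltr1n.
    exists (maxn k k') => // n /=; rewrite geq_max => /andP[kn k'n].
    by rewrite sub0r normrN -pB (le_lt_trans (psq _ _ (H n kn)))// Hk'.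
  rewrite (_ : (fun n => _) = fun n => (p (g n (T x)) - p (g n x)) + p (g n x)).
    by rewrite -[u x]add0r; exact: (cvgD cT ux).
  by apply/funext => n /=; rewrite subrK.
have [c uc] := ergodic_ae_constant T_ergodic mu_ uT.
by exists c; apply: filterS2 cvg_u uc => x + <-.
Qed.

(** The sequence converges almost everywhere, by Borel-Cantelli, to an invariant function, which
    is constant.  Fatou's lemma bounds the distance to this constant, which is therefore the
    limit of the means, that is zero. *)
Lemma mean_ergodic_null n : nsq mu (g n) <= 8^-1 ^+ n.
Proof.
have [cR aeR] := @real_limit (@complex.Re R) (fun x y => etrans (ReD _ _) (congr1 _ (ReN _)))
  (fun n => (L2_cmeasurable (mg n)).1) (fun x n H => (norm_le_sqc H).1).
have [cI aeI] := @real_limit (@complex.Im R) (fun x y => etrans (ImD _ _) (congr1 _ (ImN _)))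
  (fun n => (L2_cmeasurable (mg n)).2) (fun x n H => (norm_le_sqc H).2).
pose c : C := cR +i* cI.
have mc := L2_cst mu c; have m1 := L2_cst mu 1.
have fatou_bound k : nsq mu (fun x => g k x - c) <= 8^-1 ^+ k.
  rewrite nsqBC -lee_fin -EFin_nsq; last exact: L2B.
  have mk j := measurable_sqc (L2_cmeasurable (L2B (mg (j + k)%N) (mg k))).
  pose F j x := (sqc (g (j + k)%N x - g k x))%:E.
  have FE : (\int[mu]_x (sqc (c - g k x))%:E = \int[mu]_x limn_einf (F^~ x))%E.
    apply: ae_eq_integral => //.
    - by apply/measurable_EFinP; apply: measurable_sqc; apply: L2_cmeasurable (L2B mc (mg k)).
    - by apply: measurable_limn_einf => j; exact/measurable_EFinP.
    - apply: filterS2 aeR aeI => x HR HI _; apply/esym.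
      have gx : ccvg (fun j => g (j + k)%N x) c.
        by split; [rewrite -(cvg_shiftn k) in HR|rewrite -(cvg_shiftn k) in HI].
      have gk := ccvgD gx (ccvg_cst (- g k x)).
      suff /cvg_limn_einf_sup[-> _] : ((sqc (g (j + k)%N x - g k x))%:E @[j --> \oo]) -->
          (sqc (c - g k x))%:E by [].
      apply: cvg_EFin; first exact: nearW.
      have [c1 c2] := gk; rewrite /sqc [X in _ --> X + _]expr2 [X in _ --> _ + X]expr2.
      by apply: cvgD; under eq_fun do rewrite /= expr2; apply: cvgM.
  rewrite FE; apply: (le_trans (fatou _ measurableT _ _)).
  - by move=> j; exact/measurable_EFinP.
  - by move=> j x _; rewrite lee_fin sqc_ge0.
  apply: limn_einf_le => j; rewrite EFin_nsq; last exact: L2B.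
  by rewrite lee_fin; apply: g_cauchy; exact: leq_addl.
have c0 : c = 0.
  apply: sqc_eq0; apply/eqP; rewrite eq_le sqc_ge0 andbT.
  apply/ler_addgt0Pr => e e0; rewrite add0r.
  have [|k Hk] := @geometric_small e 8^-1 _ e0.
    by rewrite invr_ge0 ler0n/= invf_lt1 ?ltr1n.
  apply: le_trans (ltW (Hk k (leqnn k))); apply: le_trans (fatou_bound k).
  have := sqc_inner_le (L2B (mg k) mc) m1.
  have -> : nsq mu (fun=> 1) = 1.
    by apply: (@complexI R); rewrite -innerE// inner_cst.
  rewrite mulr1; apply: le_trans; rewrite innerDl//; last exact: L2N.
  by rewrite innerNl// g_mean inner_cst add0r sqcN.
by have := fatou_bound n; rewrite c0; under eq_fun do rewrite subr0.
Qed.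

End mean_ergodic.

Section cyclic_space.
Context {R : realType} {d : measure_display} {Y : measurableType d} {mu : probability Y R}.
Variable T : automorphism mu.
Local Notation C := R[i].
Local Notation chi := (chi (fun z : circle R => circle_val z)).
Let mz := @cmeasurable_circle_val R.
Let z1 := @sqc_circle_val R.
Variables (f : Y -> C) (rho : {finite_measure set (circle R) -> \bar R}).
Hypothesis mf : L2 mu f.
Hypothesis f_rho : spectral_measure_of T f rho.
Local Notation U := (fun n : int => koopman_pow T n f).

(** [U^n f] corresponds to [z^n]: the cyclic space of [f] is a copy of [L2(rho)]. *)
Lemma spectral_gram i j : inner mu (U i) (U j) = inner rho (chi i) (chi j).
Proof.
by rewrite (inner_chi z1) inner_koopman_pow//; exact: f_rho.
Qed.

Lemma nsq_cyclic l : nsq mu (combo U l) = nsq rho (combo chi l).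
Proof.
apply: nsq_combo; [by move=> i; exact: L2_koopman_pow|by move=> i; exact: L2_chi|].
exact: spectral_gram.
Qed.

Definition combo_sub (l k : seq (C * int)) := l ++ [seq (-1 * p.1, p.2) | p <- k].

Lemma combo_subE Z (b : int -> Z -> C) l k :
  combo b (combo_sub l k) = fun x => combo b l x - combo b k x.
Proof.
rewrite combo_cat combo_scale; apply/funext => x; by rewrite mulN1r.
Qed.

Definition combo_shift (l : seq (C * int)) := [seq (p.1, p.2 + 1) | p <- l].

Lemma combo_shift_chi l z : combo chi (combo_shift l) z = circle_val z * combo chi l z.
Proof.
rewrite /combo big_map mulr_sumr; apply: eq_bigr => p _ /=.
by rewrite (chiD z1) chi1 mulrA mulrC.
Qed.

Lemma combo_shift_koopman l :
  {ae mu, forall x, combo U (combo_shift l) x = combo U l (T x)}.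
Proof.
elim: l => [|p l IH]; first by apply: aeW => x; rewrite /combo !big_nil.
apply: filterS2 IH (koopman_powD T p.2 1 f) => x Hl Hp.
rewrite /combo_shift /= !combo_cons /= Hp; congr (_ * _ + _).
exact: Hl.
Qed.

Hypothesis T_ergodic : ergodic T.
Hypothesis f_mean : cintegral mu f = 0.

Lemma inner_cyclic_cst l : inner mu (combo U l) (fun=> 1) = 0.
Proof.
have m1 := L2_cst mu 1; have mU i : L2 mu (U i) by exact: L2_koopman_pow.
rewrite (inner_combo_l mU)// big1// => p _.
have -> : inner mu (U p.2) (fun=> 1) = inner mu f (fun=> 1).
  rewrite -(preserving_inner (preserving_pow T p.2) mf m1).
  by congr inner; rewrite koopman_powE.
by rewrite -cintegral_inner1 f_mean mulr0.
Qed.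

(** The eigenvalue [1] carries no mass: polynomials in the operator that approximate the
    indicator of [1] on the circle produce an almost invariant Cauchy sequence of
    mean zero functions, whose limit ergodicity forces to vanish. *)
Lemma spectral_measure_no_mass1 : rho [set z | circle_val z = 1] = 0%E.
Proof.
set A := [set z : circle R | circle_val z = 1].
have mA : measurable A by exact: (measurable_zeta_eq1 mz).
have mone : L2 rho (cindic A) by exact: (L2_cindic (fin_measure rho) mA).
have [_ VA] := approximable_circle rho mA.
have SL h : range chi h -> L2 rho h by move=> [n _ <-]; exact: L2_chi.
have e0 n : 0 < 8^-1 ^+ n / 4 :> R by rewrite divr_gt0// exprn_gt0// invr_gt0.
have /choice[l lP] : forall n, exists l : seq (C * int),
    nsq rho (fun z => cindic A z - combo chi l z) < 8^-1 ^+ n / 4.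
  move=> n; have [_ /(_ _ (e0 n))[s [Ss sn]]] := (closed_spanP SL _).1 VA.
  by have [l El] := lspan_range_combo Ss; exists l; rewrite -El.
have mp n : L2 rho (combo chi (l n)) by apply: L2_combo => i; exact: L2_chi.
have mg n : L2 mu (combo U (l n)) by apply: L2_combo => i; exact: L2_koopman_pow.
have cauchy n m : (n <= m)%N ->
    nsq mu (fun x => combo U (l m) x - combo U (l n) x) <= 8^-1 ^+ n.
  move=> nm; rewrite -(combo_subE U) nsq_cyclic combo_subE.
  apply: (le_trans (nsq_triangle (mp m) mone (mp n))).
  rewrite (nsqBC rho (combo chi (l m))); have := lP m; have := lP n.
  have : 8^-1 ^+ m <= 8^-1 ^+ n :> R.
    by rewrite ler_wiXn2l ?invr_ge0// invf_le1 ?ler1n.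
  lra.
have inv n : nsq mu (fun x => combo U (l n) (T x) - combo U (l n) x) <= 8^-1 ^+ n.
  have mS : L2 mu (combo U (combo_shift (l n))) by apply: L2_combo => i; exact: L2_koopman_pow.
  have mT : L2 mu (fun x => combo U (l n) (T x)).
    by apply: preserving_L2 (mg n); exact: preserving_aut.
  have -> : nsq mu (fun x => combo U (l n) (T x) - combo U (l n) x) =
      nsq rho (fun z => (circle_val z - 1) * (combo chi (l n) z - cindic A z)).
    transitivity (nsq mu (fun x => combo U (combo_shift (l n)) x - combo U (l n) x)).
      apply: (@complexI R); rewrite -!innerE; [|exact: L2B..].
      apply: inner_ae; try exact: L2B.
        by apply: filterS (combo_shift_koopman (l n)) => x ->.
      by apply: filterS (combo_shift_koopman (l n)) => x ->.
    rewrite -(combo_subE U) nsq_cyclic combo_subE; congr nsq; apply/funext => z.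
    rewrite combo_shift_chi cindicE; have [/eqP E|nz] := boolP (circle_val z == 1).
      by move: (z \in A)%:R => r; rewrite E mul1r !subrr mul0r.
    have -> : (z \in A) = false by apply: memNset => zA; rewrite /A /= in zA; rewrite zA eqxx in nz.
    by rewrite subr0 mulrBl mul1r.
  have mzB : cmeasurable (fun z : circle R => circle_val z - 1).
    exact: (cmeasurableD mz (cmeasurable_cst (-1))).
  have zB (z : circle R) : sqc (circle_val z - 1) <= 4.
    by rewrite (le_trans (sqcD2 _ _))// z1 sqcN sqc1; lra.
  rewrite (le_trans (nsq_mul mzB zB (L2B (mp n) mone)))// nsqBC.
  by rewrite mulrC -ler_pdivlMr// ltW// lP.
have g0 n := mean_ergodic_null T_ergodic mg cauchy inv (fun n => inner_cyclic_cst (l n)) n.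
have : nsq rho (cindic A) = 0.
  apply/eqP; rewrite eq_le nsq_ge0 andbT.
  apply/ler_addgt0Pr => e e_gt0; rewrite add0r.
  have [|k Hk] := @geometric_small R (e / 4) 8^-1 _ (divr_gt0 e_gt0 (ltr0Sn _ 3)).
    by rewrite invr_ge0 ler0n/= invf_lt1 ?ltr1n.
  have := nsqD2 (L2B mone (mp k)) (mp k).
  rewrite (_ : (fun x => _ - _ + _) = cindic A); last by apply/funext => x; rewrite subrK.
  have := lP k; have := g0 k; rewrite nsq_cyclic; have := Hk k (leqnn k).
  lra.
move=> n0; apply: (etrans _ (etrans (EFin_nsq mone) (congr1 EFin n0))).
transitivity (\int[rho]_z (\1_A z)%:E)%E; first by rewrite integral_indic// setIT.
by apply: eq_integral => z _; rewrite cindicE indicE; case: (z \in A); rewrite ?sqc1 ?sqc0.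
Qed.

End cyclic_space.

(** * Disjointness of the spectral type and its convolution square *)

Lemma product_null {R : realType} {d1 d2} {X1 : measurableType d1} {X2 : measurableType d2}
    (m1 r1 : {finite_measure set X1 -> \bar R}) (m2 r2 : {finite_measure set X2 -> \bar R})
    (D : set (X1 * X2)) : measurable D ->
  (forall A, measurable A -> r1 A = 0%E -> m1 A = 0%E) ->
  (forall A, measurable A -> r2 A = 0%E -> m2 A = 0%E) ->
  (r1 \x r2)%E D = 0%E -> (m1 \x m2)%E D = 0%E.
Proof.
move=> mD d1m d2m; rewrite /product_measure1 => D0.
have mr := measurable_fun_xsection r2 mD; have mm := measurable_fun_xsection m2 mD.
have : ae_eq r1 setT (r2 \o xsection D) (cst 0%E).
  apply/(ae_eq_integral_abs r1 measurableT mr); rewrite -D0.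
  by apply: eq_integral => x _; rewrite gee0_abs.
move=> [N [mN N0 H]].
rewrite (ge0_ae_eq_integral _ mm (@measurable_cst _ _ _ _ _ 0%E))//; first exact: integral0.
exists N; split => //; first exact: d1m.
move=> x /= nx; apply: H => /= rx; apply: nx => xT; apply: d2m; first exact: measurable_xsection.
exact: rx.
Qed.

Section weak_limit_theorem.
Context {R : realType} {d : measure_display} {X : measurableType d} {mu : probability X R}.
Variables (T : automorphism mu) (a : R) (k : nat -> int).
Hypothesis T_ergodic : ergodic T.
Hypothesis a_gt0 : 0 < a.
Hypothesis a_lt1 : a < 1.
Hypothesis T_cvg : weak_operator_cvg mu (fun i => koopman_pow T (k i))
  (fun f x => a%:C * f x + (1 - a)%:C * koopman T f x).
Local Notation C := R[i].
Local Notation T1 := (circle R).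
Local Notation zeta := (fun z : T1 => circle_val z).
Local Notation chi := (chi zeta).
Local Notation echi := (echi zeta).
Let mz := @cmeasurable_circle_val R.
Let z1 := @sqc_circle_val R.

Let aC : C := a%:C.

Lemma weak_limit_conj : aC^* = aC. Proof. exact: conjC_real. Qed.

Lemma weak_limit_neq0 : aC != 0.
Proof. by rewrite /aC fmorph_eq0 gt_eqF. Qed.

Lemma weak_limit_neq1 : 1 - aC != 0.
Proof. by rewrite /aC -[1](rmorph1 (real_complex R)) -rmorphB fmorph_eq0 subr_eq0 gt_eqF. Qed.

(** The hypothesis on [T], tested on [U^j f] and [f]. *)
Lemma spectral_limit_coef f (rho : {finite_measure set T1 -> \bar R}) : L2 mu f ->
  spectral_measure_of T f rho -> limit_coef zeta aC k rho.
Proof.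
move=> mf frho j.
have mj := L2_koopman_pow T j mf; have mS := L2_koopman_pow T (j + 1) mf.
have mT : L2 mu (koopman T (koopman_pow T j f)).
  by apply: preserving_L2 mj; exact: preserving_aut.
have H := ccvgE (T_cvg mj mf).
have E i : inner mu (koopman_pow T (k i) (koopman_pow T j f)) f = coef zeta rho (k i + j).
  rewrite -[RHS](frho (k i + j)); apply: inner_ae => //; try exact: L2_koopman_pow.
    have := koopman_powD T j (k i) f; rewrite addrC; apply: filterS => x ->.
    by rewrite (koopman_powE T (k i)).
  exact: aeW.
have El : inner mu (fun x => a%:C * koopman_pow T j f x + (1 - a)%:C * koopman T (koopman_pow T j f) x) f =
    aC * coef zeta rho j + (1 - aC) * coef zeta rho (j + 1).
  rewrite innerDl//; [|exact: L2Z..]; rewrite !innerZl//.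
  rewrite -[coef zeta rho j](frho j) -[coef zeta rho (j + 1)](frho (j + 1)).
  rewrite rmorphB rmorph1; congr (_ + _ * _); apply: inner_ae => //.
    by have := koopman_powD T j 1 f; apply: filterS => x ->.
  exact: aeW.
by rewrite El in H; move: H; congr ccvg; apply/funext => i; rewrite E.
Qed.

Definition circle_one : T1 := UnitCircle (introT eqP (@normr1 C)).

Lemma spectral_separating_polynomial f (rho : {finite_measure set T1 -> \bar R}) (e : R) :
  L2_0 mu f -> spectral_measure_of T f rho -> 0 < e ->
  exists l : seq (C * int),
    nsq rho (fun z => combo chi l z - 1) < e /\
    nsq (rho \x rho)%E (combo (fun n => echi (n, n)) l) < e.
Proof.
move=> [mf f0] frho; apply: (@separating_polynomial R _ T1 zeta mz z1 aC k _ _ circle_one rho) => //.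
- exact: weak_limit_neq0.
- exact: weak_limit_neq1.
- exact: spectral_limit_coef frho.
- exact: (spectral_measure_no_mass1 mf frho T_ergodic f0).
Qed.

Lemma measurable_circle_mul :
  measurable_fun setT (fun p : T1 * T1 => circle_mul p.1 p.2).
Proof.
move=> _ A [B mB <-]; rewrite !setTI.
have [m1 m2] := cmeasurable_tensor mz mz.
rewrite -[X in measurable X]setTI.
apply: (_ : measurable_fun setT (fun p : T1 * T1 => (complex.Re (tensor zeta zeta p), complex.Im (tensor zeta zeta p)))) => //.
exact/measurable_fun_pairP.
Qed.

(** For a fast sequence of separating polynomials [p_n], almost every [z] satisfies
    [p_n(z) -> 1] and almost every pair satisfies [p_n(zw) -> 0], so that [zw] avoids the set
    where [p_n] tends to [1]. *)
Theorem spectral_type_singular (sigma : {finite_measure set T1 -> \bar R}) :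
  maximal_spectral_type T sigma -> mutually_singular sigma (convolution sigma sigma).
Proof.
move=> [_ [f [rho [mf0 frho /null_content_dominatesP dom]]]].
have dom' A : measurable A -> rho A = 0%E -> sigma A = 0%E by move=> mA; exact: dom.
have e0 n : 0 < 8^-1 ^+ n :> R by rewrite exprn_gt0// invr_gt0.
have /choice[l lP] : forall n, exists l : seq (C * int),
    nsq rho (fun z => combo chi l z - 1) < 8^-1 ^+ n /\
    nsq (rho \x rho)%E (combo (fun n => echi (n, n)) l) < 8^-1 ^+ n.
  by move=> n; exact: spectral_separating_polynomial mf0 frho (e0 n).
pose h n z := combo chi (l n) z - 1.
pose h' n := combo (fun n => echi (n, n)) (l n).
have mh n : L2 rho (h n).
  by apply: L2B; [apply: L2_combo => i; exact: L2_chi|exact: L2_cst].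
have mh' n : L2 (rho \x rho)%E (h' n).
  by apply: L2_combo => i; exact: (L2_echi mz z1).
have mA := measurable_lim_sup_large mh; have mD := measurable_lim_sup_large mh'.
have A0 := borel_cantelli_large mh (fun n => ltW (lP n).1).
have D0 := borel_cantelli_large mh' (fun n => ltW (lP n).2).
exists (lim_sup_set (large h)); split => //; first exact: dom'.
rewrite /convolution /pushforward.
set B := _ @^-1` _.
have mB : measurable B.
  by rewrite -[X in measurable X]setTI; apply: measurable_circle_mul => //; exact: measurableC.
have sD0 := product_null mD dom' dom' D0.
apply/eqP; rewrite -measure_le0 -sD0; apply: le_measure; rewrite ?inE//.
move=> [z w] nA; apply: contrapT => nD.
have [i Hi] := not_lim_sup_large nA; have [j Hj] := not_lim_sup_large nD.
pose n := (maxn i (maxn j 2)).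
have := Hi n (leq_maxl _ _); have := Hj n _; rewrite /h /h' /=.
have -> : combo chi (l n) (circle_mul z w) = combo (fun n => echi (n, n)) (l n) (z, w).
  by apply: eq_bigr => p _; congr (_ * _); exact: expfzMl.
set p := combo _ _ _ => Hp Hp1.
have := sqcD2 p (- (p - 1)); rewrite sqcN opprB addrC subrK sqc1.
have n4 : 4^-1 ^+ n <= 4^-1 ^+ 2 :> R.
  rewrite ler_wiXn2l ?invr_ge0// ?invf_le1 ?ler1n//.
  exact: leq_trans (leq_maxr _ _) (leq_maxr _ _).
have pn := Hp (leq_trans (leq_maxl _ _) (leq_maxr _ _)).
have : 4^-1 ^+ 2 = 16^-1 :> R by rewrite expr2; field.
lra.
Qed.

End weak_limit_theorem.

(** * Cyclic vectors of the square *)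

Local Notation orbit := Pilot.Defs.orbit.

Section closed_span_orbits.
Context {R : realType} {d : measure_display} {Y : measurableType d} {nu : probability Y R}.
Variable S : automorphism nu.
Local Notation C := R[i].
Local Notation V := (koopman_pow S).

Lemma closed_span_ae (O : set (Y -> C)) g g' : (forall h, O h -> L2 nu h) ->
  closed_span nu O g -> L2 nu g' -> {ae nu, forall x, g' x = g x} -> closed_span nu O g'.
Proof.
move=> OL Og mg' gg'; apply: (closed_span_null OL Og mg'); apply: nsq_ae => //.
exact: closed_span_L2 Og.
Qed.

Lemma orbit_L2 F h : L2 nu F -> orbit S F h -> L2 nu h.
Proof. by move=> mF [n _ <-]; exact: L2_koopman_pow. Qed.

Section family.
Variable F : nat -> Y -> C.
Hypothesis mF : forall n, L2 nu (F n).
Local Notation O := (\bigcup_n orbit S (F n)).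

Lemma orbits_L2 h : O h -> L2 nu h.
Proof. by move=> [n _]; exact: orbit_L2. Qed.

Lemma closed_span_orbits_koopman m g : closed_span nu O g -> closed_span nu O (V m g).
Proof.
apply: (@closed_span_map _ _ _ _ _ nu nu _ 1 _ _ _ orbits_L2 orbits_L2).
- by move=> f; exact: L2_koopman_pow.
- by move=> f h; rewrite !koopman_powE.
- by move=> c f; rewrite !koopman_powE.
- by move=> f mf; rewrite nsq_koopman_pow// mul1r.
move=> h [n _ [j _ <-]].
apply: (@closed_span_ae _ (V (j + m) (F n))); first exact: orbits_L2.
- by apply: closed_span_gen; [exact: orbits_L2|exists n => //; exists (j + m)].
- by apply: L2_koopman_pow; exact: L2_koopman_pow.
- by have := koopman_powD S j m (F n); apply: filterS => x ->; rewrite (koopman_powE S m).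
Qed.

Lemma closed_span_orbit_sub n g : closed_span nu (orbit S (F n)) g -> closed_span nu O g.
Proof.
apply: closed_span_idem => [h|h|h Oh]; [exact: orbit_L2|exact: orbits_L2|].
by apply: closed_span_gen; [exact: orbits_L2|exists n].
Qed.

End family.

Lemma koopman_powDfun n (P Q : Y -> C) :
  V n (fun x => P x + Q x) = fun x => V n P x + V n Q x.
Proof. by rewrite !koopman_powE. Qed.

Lemma koopman_powBfun n (P Q : Y -> C) :
  V n (fun x => P x - Q x) = fun x => V n P x - V n Q x.
Proof. by rewrite !koopman_powE. Qed.

(** Polynomials that tend to [1] on the spectrum of [P] and to [0] on that of [Q]
    project a vector [P + Q] onto its component [P]. *)
Lemma closed_span_component (P Q : Y -> C) : L2 nu P -> L2 nu Q ->
  (forall e : R, 0 < e -> exists l : seq (C * int),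
    nsq nu (fun x => combo (V ^~ P) l x - P x) < e /\ nsq nu (combo (V ^~ Q) l) < e) ->
  closed_span nu (orbit S (fun x => P x + Q x)) P.
Proof.
move=> mP mQ H; have mPQ := L2D mP mQ.
have OL h : orbit S (fun x => P x + Q x) h -> L2 nu h by exact: orbit_L2.
apply/(closed_spanP OL); split=> // e e0.
have [l [l1 l2]] := H (e / 4) (divr_gt0 e0 (ltr0Sn _ 3)).
exists (combo (V ^~ (fun x => P x + Q x)) l); split.
  elim: l {l1 l2} => [|p l IH]; first by rewrite combo_nil; exact: lspan0.
  by rewrite combo_cons; apply: lspanS => //; exists p.2.
have mcP : L2 nu (combo (V ^~ P) l) by apply: L2_combo => i; exact: L2_koopman_pow.
have mcQ : L2 nu (combo (V ^~ Q) l) by apply: L2_combo => i; exact: L2_koopman_pow.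
rewrite nsqBC.
have -> : (fun x => combo (V ^~ (fun x => P x + Q x)) l x - P x) =
    fun x => (combo (V ^~ P) l x - P x) + combo (V ^~ Q) l x.
  apply/funext => x; rewrite addrAC; congr (_ - _); rewrite /combo -big_split/=.
  by apply: eq_bigr => p _; rewrite koopman_powDfun mulrDr.
apply: le_lt_trans (nsqD2 (L2B mcP mP) mcQ) _; lra.
Qed.

Lemma combo_sub1 (P : Y -> C) l x : combo (V ^~ P) (combo_sub l [:: (1, 0)]) x =
  combo (V ^~ P) l x - P x.
Proof. by rewrite combo_subE; congr (_ - _); rewrite /combo big_seq1 mul1r. Qed.

(** Constants are orthogonal to the span and to [g], so dropping the constant term of an
    approximation does not increase the distance. *)
Lemma closed_span_mean_zero (O : set (Y -> C)) g : (forall h, O h -> L2_0 nu h) ->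
  L2_0 nu g -> closed_span nu (O `|` [set (fun=> 1)]) g -> closed_span nu O g.
Proof.
move=> O0 [mg g0].
have OL h : O h -> L2 nu h by move=> /O0[].
have OL' h : (O `|` [set (fun=> 1)]) h -> L2 nu h by move=> [/OL//|->]; exact: L2_cst.
move=> /(closed_spanP OL')[_ H]; apply/(closed_spanP OL); split=> // e /H[s [Ss sg]].
have [s' [c [Ss' s0 Es]]] : exists s' c, [/\ lspan O s', inner nu s' (fun=> 1) = 0 &
    s = fun x => s' x + c].
  elim: Ss {sg} => [|b h t Oh _ [s' [c [Ss' s0 ->]]]].
    exists (fun=> 0), 0; split; [exact: lspan0| |by apply/funext => x; rewrite addr0].
    by rewrite inner_0l//; exact: L2_cst.
  have ms' := lspan_L2 OL Ss'; have m1 := L2_cst nu 1.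
  case: Oh => [Oh|->]; last first.
    exists s', (b + c); split => //; apply/funext => x.
    by rewrite mulr1 addrCA.
  exists (fun x => b * h x + s' x), c; split.
  - exact: lspanS.
  - rewrite innerDl ?innerZl//; [|exact: OL|exact/L2Z/OL].
    by rewrite s0 addr0 -cintegral_inner1 (O0 _ Oh).2 mulr0.
  - by apply/funext => x; rewrite addrA.
exists s'; split=> //; apply: le_lt_trans sg; rewrite Es.
have ms' := lspan_L2 OL Ss'; have mB := L2B mg ms'; have mc := L2_cst nu c.
rewrite (_ : (fun x => g x - (s' x + c)) = fun x => (g x - s' x) - c * 1); last first.
  by apply/funext => x; rewrite opprD addrA mulr1.
rewrite (nsqB mB (L2Z c (L2_cst nu 1))).
rewrite innerZr//; last exact: L2_cst.
rewrite innerDl//; [|exact: L2N|exact: L2_cst].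
rewrite innerNl//; last exact: L2_cst.
rewrite -cintegral_inner1 g0 s0 subrr mulr0 /= mulr0 subr0 lerDl.
exact: nsq_ge0.
Qed.

End closed_span_orbits.

Section tensor_square.
Context {R : realType} {d : measure_display} {X : measurableType d} {mu : probability X R}.
Variable T : automorphism mu.
Local Notation C := R[i].
Local Notation S := (prod_automorphism T T).
Local Notation nu := (mu \x mu)%E.
Local Notation U := (koopman_pow T).
Local Notation V := (koopman_pow S).

Lemma koopman_pow_tensor n (g h : X -> C) : V n (tensor g h) = tensor (U n g) (U n h).
Proof.
have H : aut_pow S n = fun z => (aut_pow T n z.1, aut_pow T n z.2).
  case: n => n.
    by elim: n => [|n IH]; apply/funext => -[x y] //; rewrite /aut_pow !iterS; move: IH => /= ->.
  rewrite /aut_pow; elim: n.+1 => [|m IH]; apply/funext => -[x y] //.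
  by rewrite !iterS IH.
by rewrite !koopman_powE H.
Qed.

Lemma inner_koopman_tensor n (g g' h h' : X -> C) :
  L2 mu g -> L2 mu g' -> L2 mu h -> L2 mu h' ->
  inner nu (V n (tensor g h)) (tensor g' h') = inner mu (U n g) g' * inner mu (U n h) h'.
Proof.
by move=> mg mg' mh mh'; rewrite koopman_pow_tensor inner_tensor//; exact: L2_koopman_pow.
Qed.

Lemma koopman_pow_cst n (c : C) : U n (fun=> c) = fun=> c.
Proof. by rewrite koopman_powE. Qed.

Lemma ae_prod_fst (P : X -> Prop) : {ae mu, forall x, P x} -> {ae nu, forall z, P z.1}.
Proof.
move=> [N [mN N0 H]]; exists (N `*` setT); split.
- exact: measurableX.
- by rewrite product_measure1E//; apply: (etrans (congr1 (fun t => t * _)%E N0)); rewrite mul0e.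
- by move=> z nz; split => //; exact: H.
Qed.

Lemma ae_prod_snd (P : X -> Prop) : {ae mu, forall x, P x} -> {ae nu, forall z, P z.2}.
Proof.
move=> [N [mN N0 H]]; exists (setT `*` N); split.
- exact: measurableX.
- by rewrite product_measure1E//; apply: (etrans (congr1 (fun t => _ * t)%E N0)); rewrite mule0.
- by move=> z nz; split => //; exact: H.
Qed.

Lemma L2_0_tensor (g h : X -> C) : L2 mu g -> L2 mu h ->
  cintegral mu g = 0 \/ cintegral mu h = 0 -> L2_0 nu (tensor g h).
Proof.
move=> mg mh g0; split; first exact: L2_tensor.
have int1 u : L2 mu u -> cintegrable mu u.
  move=> mu_; have := cintegrable_mul mu_ (L2_cst mu 1).
  by congr cintegrable; apply/funext => x; rewrite conjC1 mulr1.
have [_ ->] := cintegral_tensor (int1 _ mg) (int1 _ mh).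
by case: g0 => ->; rewrite ?mul0r ?mulr0.
Qed.

(** Indicators of rectangles are tensor products, and a tensor product may be approximated in
    one factor at a time. *)
Lemma closed_span_tensors (B : set (X -> C)) : (forall h, B h -> L2 mu h) ->
  (forall h, L2 mu h -> closed_span mu B h) ->
  forall F, L2 nu F -> closed_span nu [set tensor g h | g in B & h in B] F.
Proof.
move=> BL BT F mF; set TB := [set tensor g h | g in B & h in B].
have TL h : TB h -> L2 nu h by move=> [u Bu [v Bv <-]]; apply: L2_tensor; exact: BL.
have nsq_tensor g h : L2 mu g -> L2 mu h -> nsq nu (tensor g h) = nsq mu g * nsq mu h.
  move=> mg mh; apply: (@complexI R); rewrite -innerE; last exact: L2_tensor.
  by rewrite inner_tensor// !innerE// rmorphM.
have H g h : B g -> L2 mu h -> closed_span nu TB (tensor g h).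
  move=> Bg mh; have mg := BL _ Bg.
  apply: (@closed_span_map _ _ _ _ _ mu nu (tensor g) (nsq mu g) B TB h) => //.
  - by move=> u mu_; exact: L2_tensor.
  - by move=> u v; apply/funext => z; rewrite /tensor mulrDr.
  - by move=> c u; apply/funext => z; rewrite /tensor mulrCA.
  - by move=> u mu_; rewrite nsq_tensor.
  - by move=> u Bu; apply: closed_span_gen => //; exists g => //; exists u.
  - exact: BT.
have G g h : L2 mu g -> L2 mu h -> closed_span nu TB (tensor g h).
  move=> mg mh.
  apply: (@closed_span_map _ _ _ _ _ mu nu (fun u => tensor u h) (nsq mu h) B TB g) => //.
  - by move=> u mu_; exact: L2_tensor.
  - by move=> u v; apply/funext => z; rewrite /tensor mulrDl.
  - by move=> c u; apply/funext => z; rewrite /tensor mulrA.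
  - by move=> u mu_; rewrite nsq_tensor// mulrC.
  - by move=> u Bu; exact: H.
  - exact: BT.
have ind A : measurable A -> L2 mu (cindic A) by exact: (L2_cindic (fin_measure mu)).
have RL h : rectangle_indicators h -> L2 nu h.
  by move=> [A [B' [mA mB ->]]]; apply: L2_tensor; exact: ind.
apply: (closed_span_idem RL TL _ (closed_span_rectangles (fin_prod mu mu) mF)).
by move=> _ [A [B' [mA mB ->]]]; apply: G; exact: ind.
Qed.

End tensor_square.

Section square_of_cyclic.
Context {R : realType} {d : measure_display} {X : measurableType d} {mu : probability X R}.
Variable T : automorphism mu.
Local Notation C := R[i].
Local Notation T1 := (circle R).
Local Notation zeta := (fun z : T1 => circle_val z).
Local Notation chi := (chi zeta).
Local Notation echi := (echi zeta).
Local Notation S := (prod_automorphism T T).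
Local Notation nu := (mu \x mu)%E.
Local Notation U := (koopman_pow T).
Local Notation V := (koopman_pow S).
Local Notation one := (fun=> 1 : C).
Let mz := @cmeasurable_circle_val R.
Let z1 := @sqc_circle_val R.
Variables (f : X -> C) (rho : {finite_measure set T1 -> \bar R}).
Hypothesis mf0 : L2_0 mu f.
Hypothesis f_rho : spectral_measure_of T f rho.
Hypothesis f_cyclic : L2_0 mu `<=` closed_span mu (orbit T f).
Hypothesis sep : forall e : R, 0 < e -> exists l : seq (C * int),
  nsq rho (fun z => combo chi l z - 1) < e /\
  nsq (rho \x rho)%E (combo (fun n => echi (n, n)) l) < e.
Hypothesis sym : forall i j, closed_span (rho \x rho)%E (diag_orbit zeta (fun=> 1))
  (fun z => echi (i, j) z + echi (j, i) z).
Hypothesis anti : forall i j, closed_span (rho \x rho)%E (diag_orbit zeta (antisym_gen zeta))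
  (fun z => echi (i, j) z - echi (j, i) z).
Hypothesis dif : closed_span (rho \x rho)%E (diff_gen zeta) (fun=> 1).

Let mf : L2 mu f. Proof. by case: mf0. Qed.
Let m1 : L2 mu one. Proof. exact: L2_cst. Qed.
Let mU n : L2 mu (U n f). Proof. exact: L2_koopman_pow. Qed.
Local Notation c := (coef zeta rho).

Let inner_UU i j : inner mu (U i f) (U j f) = c (i - j).
Proof. by rewrite (spectral_gram mf f_rho) (inner_chi z1). Qed.

Let inner_U1 n : inner mu (U n f) one = 0.
Proof.
rewrite -[RHS]mf0.2 cintegral_inner1 -(preserving_inner (preserving_pow T n) mf m1).
by congr inner; rewrite koopman_powE.
Qed.

Let inner_1U n : inner mu one (U n f) = 0.
Proof. by rewrite innerC// inner_U1 conjC0. Qed.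

Let inner_11 : inner mu one one = 1. Proof. exact: inner_cst. Qed.

Definition cross (p : int * int) : X * X -> C := tensor (U p.1 f) (U p.2 f).

Lemma L2_cross p : L2 nu (cross p).
Proof. exact: L2_tensor. Qed.

Lemma inner_cross p q : inner nu (cross p) (cross q) = inner (rho \x rho)%E (echi p) (echi q).
Proof. by rewrite inner_tensor// !inner_UU (inner_echi mz z1). Qed.

Lemma inner_koopman_cross n p q :
  inner nu (V n (cross p)) (cross q) = c (n + p.1 - q.1) * c (n + p.2 - q.2).
Proof.
rewrite inner_koopman_tensor//.
have E i j : inner mu (U n (U i f)) (U j f) = c (n + i - j).
  rewrite -inner_UU; apply: inner_ae => //; try exact: L2_koopman_pow.
    by have := koopman_powD T i n f; rewrite addrC; apply: filterS => x ->; rewrite (koopman_powE T n).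
  exact: aeW.
by rewrite !E.
Qed.

Definition left_f : X * X -> C := tensor f one.
Definition right_f : X * X -> C := tensor one f.
Definition both_f : X * X -> C := cross (0, 0).
Definition antisym_f : X * X -> C := fun z => cross (0, 1) z - cross (1, 0) z.

Lemma L2_left_f : L2 nu left_f. Proof. exact: L2_tensor. Qed.
Lemma L2_right_f : L2 nu right_f. Proof. exact: L2_tensor. Qed.
Lemma L2_both_f : L2 nu both_f. Proof. exact: L2_cross. Qed.
Lemma L2_antisym_f : L2 nu antisym_f. Proof. by apply: L2B; exact: L2_cross. Qed.

Definition first_vector : X * X -> C := fun z => left_f z + both_f z.
Definition second_vector : X * X -> C := fun z => right_f z + antisym_f z.

Lemma L2_0_cross p : L2_0 nu (cross p).
Proof. by apply: L2_0_tensor => //; left; rewrite cintegral_inner1. Qed.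

Lemma L2_0_left_f : L2_0 nu left_f.
Proof. by apply: L2_0_tensor => //; left; case: mf0. Qed.

Lemma L2_0_right_f : L2_0 nu right_f.
Proof. by apply: L2_0_tensor => //; right; case: mf0. Qed.

Lemma L2_0D {d'} {Y : measurableType d'} (m : probability Y R) (g h : Y -> C) :
  L2_0 m g -> L2_0 m h -> L2_0 m (fun x => g x + h x).
Proof.
move=> [mg g0] [mh h0]; split; first exact: L2D.
by rewrite cintegral_inner1 innerDl//; [rewrite -!cintegral_inner1 g0 h0 addr0|exact: L2_cst].
Qed.

Lemma L2_0N {d'} {Y : measurableType d'} (m : probability Y R) (g : Y -> C) :
  L2_0 m g -> L2_0 m (fun x => - g x).
Proof.
move=> [mg g0]; split; first exact: L2N.
by rewrite cintegral_inner1 innerNl//; [rewrite -cintegral_inner1 g0 oppr0|exact: L2_cst].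
Qed.

Lemma L2_0_first_vector : L2_0 nu first_vector.
Proof. exact: (L2_0D L2_0_left_f (L2_0_cross _)). Qed.

Lemma L2_0_second_vector : L2_0 nu second_vector.
Proof. exact: (L2_0D L2_0_right_f (L2_0D (L2_0_cross _) (L2_0N (L2_0_cross _)))). Qed.

Lemma spectral_left_f : spectral_measure_of S left_f rho.
Proof.
move=> n; rewrite [LHS]inner_koopman_tensor// koopman_pow_cst inner_11 mulr1.
exact: f_rho.
Qed.

Lemma spectral_right_f : spectral_measure_of S right_f rho.
Proof.
move=> n; rewrite [LHS]inner_koopman_tensor// koopman_pow_cst inner_11 mul1r.
exact: f_rho.
Qed.

(** The component [Q] acts on the torus as the multiplier [q] does, and [q] is bounded: the
    polynomials that separate [rho] from its convolution square separate [P] from [Q]. *)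
Let sep_of (P Q : X * X -> C) (M : R) (q : T1 * T1 -> C) : 0 < M -> L2 nu P -> L2 nu Q ->
  cmeasurable q -> (forall z, sqc (q z) <= M) ->
  spectral_measure_of S P rho ->
  (forall i j, inner nu (V i Q) (V j Q) =
     inner (rho \x rho)%E (fun z => q z * echi (i, i) z) (fun z => q z * echi (j, j) z)) ->
  closed_span nu (orbit S (fun z => P z + Q z)) P.
Proof.
move=> M0 mP mQ mq qM HP gram.
apply: closed_span_component => // e e0.
have eM : 0 < Num.min e (e / M) by rewrite lt_min e0 divr_gt0.
have [l [l1 l2]] := sep eM; exists l; split.
  have -> : nsq nu (fun x => combo (V^~ P) l x - P x) = nsq rho (fun z => combo chi l z - 1).
    transitivity (nsq nu (combo (V ^~ P) (combo_sub l [:: (1, 0)]))).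
      by congr nsq; apply/funext => x; rewrite combo_sub1.
    rewrite (nsq_cyclic mP HP) combo_subE; congr nsq; apply/funext => z.
    by congr (_ - _); rewrite /combo big_seq1 mul1r.
  by apply: lt_le_trans l1 _; rewrite ge_min lexx.
have mE n : L2 (rho \x rho)%E (echi (n, n)) by exact: (L2_echi mz z1).
have -> : nsq nu (combo (V^~ Q) l) =
    nsq (rho \x rho)%E (combo (fun n z => q z * echi (n, n) z) l).
  apply: nsq_combo => // i; first exact: L2_koopman_pow.
  exact: (L2_mul mq qM).
have -> : combo (fun n z => q z * echi (n, n) z) l =
    fun z => q z * combo (fun n => echi (n, n)) l z.
  apply/funext => z; rewrite /combo mulr_sumr; apply: eq_bigr => p _.
  by rewrite mulrCA.
apply: le_lt_trans (nsq_mul mq qM _) _; first exact: L2_combo.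
rewrite mulrC -ltr_pdivlMr//; apply: lt_le_trans l2 _.
by rewrite ge_min lexx orbT.
Qed.

Lemma closed_span_first_left : closed_span nu (orbit S first_vector) left_f.
Proof.
apply: (@sep_of left_f both_f 1 (fun=> 1)) => //.
- exact: L2_left_f.
- exact: L2_both_f.
- by move=> z; rewrite sqc1.
- exact: spectral_left_f.
move=> i j; rewrite inner_koopman_pow; [|exact: L2_both_f..].
rewrite inner_koopman_cross !(addr0, subr0).
have E n : (fun z => 1 * echi (n, n) z) = echi (n, n) by apply/funext => z; rewrite mul1r.
by rewrite !E (inner_echi mz z1).
Qed.

Lemma closed_span_second_right : closed_span nu (orbit S second_vector) right_f.
Proof.
have manti : cmeasurable (antisym_gen zeta).
  have H := cmeasurableD (cmeasurable_comp measurable_snd mz : cmeasurable (fun z : T1 * T1 => _))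
    (cmeasurableM (cmeasurable_cst (-1)) (cmeasurable_comp measurable_fst mz)).
  by move: H; congr cmeasurable; apply/funext => z; rewrite mulN1r.
apply: (@sep_of right_f antisym_f 4 (antisym_gen zeta)) => //.
- exact: L2_right_f.
- exact: L2_antisym_f.
- move=> z; rewrite /antisym_gen (le_trans (sqcD2 _ _))//.
  by rewrite sqcN !z1; lra.
- exact: spectral_right_f.
move=> i j; rewrite inner_koopman_pow; [|exact: L2_antisym_f..].
have mc := L2_cross; have mVc p : L2 nu (V (i - j) (cross p)) by exact: L2_koopman_pow.
rewrite koopman_powBfun innerDl//; [|exact: L2N|exact: L2_antisym_f].
rewrite innerNl//; last exact: L2_antisym_f.
rewrite !innerDr//; [|exact: L2N..].
rewrite !innerNr// !inner_koopman_cross /=.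
have mE p : L2 (rho \x rho)%E (echi p) by exact: (L2_echi mz z1).
have E n : (fun z => antisym_gen zeta z * echi (n, n) z) =
    (fun z => echi (n, n + 1) z - echi (n + 1, n) z).
  apply/funext => z; rewrite /antisym_gen.
  by rewrite /echi /tensor /= !(chiD z1) !chi1; ring.
rewrite !E innerDl//; [|exact: L2N|exact: L2B].
rewrite innerNl//; last exact: L2B.
rewrite !innerDr//; [|exact: L2N..].
rewrite !innerNr// !(inner_echi mz z1) /=.
have -> : i + 1 - (j + 1) = i - j by ring.
have -> : i - (j + 1) = i - j - 1 by ring.
have -> : i + 1 - j = i - j + 1 by ring.
by rewrite !(addr0, subr0, addrK).
Qed.

(** Two nonzero vectors; the sequence is completed by zeros as finite multiplicity requires. *)
Definition cyclic_vectors (n : nat) : X * X -> C :=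
  match n with 0%N => first_vector | 1%N => second_vector | _ => fun=> 0 end.
Local Notation O := (\bigcup_n orbit S (cyclic_vectors n)).

Lemma L2_0_cyclic_vectors n : L2_0 nu (cyclic_vectors n).
Proof.
case: n => [|[|n]]; [exact: L2_0_first_vector|exact: L2_0_second_vector|].
split; first exact: L2_0fun.
rewrite cintegral_inner1 inner_0l//.
exact: (L2_bounded (M := sqc 1) (fin_prod mu mu) (cmeasurable_cst 1)).
Qed.

Let mF n : L2 nu (cyclic_vectors n).
Proof. by case: (L2_0_cyclic_vectors n). Qed.

Let OL h : O h -> L2 nu h. Proof. exact: orbits_L2. Qed.
Local Notation W := (closed_span nu O).

Let span_vector n : W (cyclic_vectors n).
Proof. by apply: closed_span_gen => //; exists n => //; exists 0. Qed.

Lemma span_left_f : W left_f.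
Proof. exact: (closed_span_orbit_sub mF (n := 0%N) closed_span_first_left). Qed.

Lemma span_both_f : W both_f.
Proof.
apply: closed_span_eq (closed_spanB OL (span_vector 0) span_left_f) _ => z.
by rewrite /= /first_vector addrC addKr.
Qed.

Lemma span_right_f : W right_f.
Proof. exact: (closed_span_orbit_sub mF (n := 1%N) closed_span_second_right). Qed.

Lemma span_antisym_f : W antisym_f.
Proof.
apply: closed_span_eq (closed_spanB OL (span_vector 1) span_right_f) _ => z.
by rewrite /= /second_vector addrC addKr.
Qed.

(** Spans of combinations of characters on the torus carry over to the same combinations of
    the vectors [U^i f (x) U^j f], since both families have the same Gram matrix. *)
Let transport (J : Type) (g : J -> seq (C * (int * int))) l (D : set (T1 * T1 -> C))
    (B : set (X * X -> C)) :
  (forall h, B h -> L2 nu h) ->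
  (forall h, D h -> exists n, h =1 combo echi (g n)) ->
  (forall n, closed_span nu B (combo cross (g n))) ->
  closed_span (rho \x rho)%E D (combo echi l) -> closed_span nu B (combo cross l).
Proof.
move=> BL Dg gB H.
have mE p : L2 (rho \x rho)%E (echi p) by exact: (L2_echi mz z1).
have gram p q : inner (rho \x rho)%E (echi p) (echi q) = inner nu (cross p) (cross q).
  by rewrite inner_cross.
have DL h : D h -> L2 (rho \x rho)%E h by move=> /Dg[n /funext ->]; exact: L2_combo.
have EL h : (combo echi @` range g) h -> L2 (rho \x rho)%E h.
  by move=> [_ [n _ <-] <-]; exact: L2_combo.
have CL h : (combo cross @` range g) h -> L2 nu h.
  by move=> [_ [n _ <-] <-]; apply: L2_combo => p; exact: L2_cross.
have : closed_span nu (combo cross @` range g) (combo cross l).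
  apply: (closed_span_transport mE (fun p => L2_cross p) gram).
  apply: closed_span_idem H => // h /Dg[n /funext ->].
  by apply: closed_span_gen => //; exists (g n) => //; exists n.
by apply: closed_span_idem => // _ [_ [n _ <-] <-].
Qed.

(** Half the sum of a symmetric and an antisymmetric vector, each supplied by one of the two
    generators. *)
Lemma span_cross p : W (cross p).
Proof.
case: p => i j.
have Vcross n p q : {ae mu, forall x, U n (U p f) x = U (n + p) f x} ->
    {ae mu, forall x, U n (U q f) x = U (n + q) f x} ->
    {ae nu, forall z, cross (n + p, n + q) z = V n (cross (p, q)) z}.
  move=> /ae_prod_fst Hp /ae_prod_snd Hq; apply: filterS2 Hp Hq => z Ep Eq.
  by rewrite koopman_pow_tensor /cross /tensor /= -Ep -Eq.
have Ushift n p : {ae mu, forall x, U n (U p f) x = U (n + p) f x}.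
  by have := koopman_powD T p n f; rewrite addrC; apply: filterS => x ->; rewrite (koopman_powE T n).
have Wsum : W (fun z => cross (i, j) z + cross (j, i) z).
  have E Z (b : int * int -> Z -> C) z : combo b [:: (1, (i, j)); (1, (j, i))] z =
      b (i, j) z + b (j, i) z by rewrite /combo big_cons big_seq1 !mul1r.
  apply: closed_span_eq (_ : W (combo cross [:: (1, (i, j)); (1, (j, i))])) (E _ _).
  apply: (@transport int (fun n => [:: (1, (n, n))]) _ (diag_orbit zeta (fun=> 1))) => //.
  - by move=> _ [n _ <-]; exists n => z; rewrite /combo big_seq1 mul1r mulr1.
  - move=> n; apply: closed_span_eq (closed_span_orbits_koopman mF n span_both_f) _ => z.
    by rewrite /combo big_seq1 mul1r koopman_pow_tensor.
  - by apply: closed_span_eq (sym i j) _ => z; rewrite E.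
have Wdif : W (fun z => cross (i, j) z - cross (j, i) z).
  have E Z (b : int * int -> Z -> C) p q z : combo b [:: (1, p); (-1, q)] z = b p z - b q z.
    by rewrite /combo big_cons big_seq1 mul1r mulN1r.
  apply: closed_span_eq (_ : W (combo cross [:: (1, (i, j)); (-1, (j, i))])) (E _ _ _ _).
  apply: (@transport int (fun n => [:: (1, (n, n + 1)); (-1, (n + 1, n))]) _
    (diag_orbit zeta (antisym_gen zeta))) => //.
  - move=> _ [n _ <-]; exists n => z; rewrite E /antisym_gen.
    by rewrite /echi /tensor /= !(chiD z1) !chi1; ring.
  - move=> n.
    apply: (closed_span_ae OL (closed_span_orbits_koopman mF n span_antisym_f)).
      by apply: L2_combo => p; exact: L2_cross.
    rewrite koopman_powBfun.
    have := Vcross n 1 0 (Ushift n 1) (Ushift n 0); have := Vcross n 0 1 (Ushift n 0) (Ushift n 1).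
    by rewrite !addr0; apply: filterS2 => z E1 E2; rewrite E E1 E2.
  - by apply: closed_span_eq (anti i j) _ => z; rewrite E.
apply: closed_span_eq (closed_spanZ OL 2^-1 (closed_spanD OL Wsum Wdif)) _ => z.
by field.
Qed.

(** The functions [1] and [U^n f] are total on [X], and every product of two of them other than
    [1 (x) 1] lies in the closed span. *)
Lemma L2_0_spanned : L2_0 nu `<=` W.
Proof.
move=> F F0; apply: closed_span_mean_zero => // [h [n _ [m _ <-]]|].
  have [mh h0] := L2_0_cyclic_vectors n; split; first exact: L2_koopman_pow.
  rewrite -[RHS]h0 !cintegral_inner1 -(preserving_inner (preserving_pow S m) mh (L2_cst _ 1)).
  by congr inner; rewrite koopman_powE.
pose B := orbit T f `|` [set one].
have BL h : B h -> L2 mu h by move=> [[n _ <-]//|->].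
have BT h : L2 mu h -> closed_span mu B h.
  move=> mh; pose k := cintegral mu h.
  have h0 : L2_0 mu (fun x => h x - k).
    split; first exact: L2B (L2_cst _ _).
    rewrite cintegral_inner1 innerDl//; [|exact: L2N (L2_cst _ _)].
    by rewrite innerNl ?inner_cst -?cintegral_inner1 ?subrr//; exact: L2_cst.
  have Bh : closed_span mu B (fun x => h x - k).
    apply: closed_span_idem (f_cyclic h0) => // [g|g Og]; first exact: orbit_L2.
    by apply: closed_span_gen => //; left.
  have B1 : closed_span mu B one by apply: closed_span_gen => //; right.
  apply: closed_span_eq (closed_spanD BL Bh (closed_spanZ BL k B1)) _ => x.
  by rewrite mulr1 subrK.
have OL1 h : (O `|` [set (fun=> 1)]) h -> L2 nu h.
  by move=> [/OL//|->]; exact: (L2_bounded (M := sqc 1) (fin_prod mu mu) (cmeasurable_cst 1)).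
have sub h : W h -> closed_span nu (O `|` [set (fun=> 1)]) h.
  by apply: closed_span_idem => // g Og; apply: closed_span_gen => //; left.
have TL h : [set tensor g h | g in B & h in B] h -> L2 nu h.
  by move=> [u Bu [v Bv <-]]; apply: L2_tensor; exact: BL.
apply: (closed_span_idem TL OL1 _ (closed_span_tensors BL BT F0.1)).
move=> _ [u Bu [v Bv <-]]; case: Bu Bv => [[i _ <-]|->] [[j _ <-]|->].
- exact: (sub _ (span_cross (i, j))).
- apply: sub; apply: closed_span_eq (closed_span_orbits_koopman mF i span_left_f) _ => z.
  by rewrite koopman_pow_tensor koopman_pow_cst.
- apply: sub; apply: closed_span_eq (closed_span_orbits_koopman mF j span_right_f) _ => z.
  by rewrite koopman_pow_tensor koopman_pow_cst.
- apply: closed_span_gen => //; right; apply/funext => z.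
  by rewrite /tensor mulr1.
Qed.

Lemma innerBB {d'} {Y : measurableType d'} (m : {measure set Y -> \bar R}) (g h g' h' : Y -> C) :
  L2 m g -> L2 m h -> L2 m g' -> L2 m h' ->
  inner m (fun x => g x - h x) (fun x => g' x - h' x) =
  inner m g g' - inner m g h' - (inner m h g' - inner m h h').
Proof.
move=> mg mh mg' mh'; have mB := L2B mg' mh'; have mN := L2N mh; have mN' := L2N mh'.
by rewrite (innerDl mg mN mB) (innerNl mh mB) !innerDr// !innerNr.
Qed.

Lemma first_second_orthogonal n : inner nu (V n first_vector) second_vector = 0.
Proof.
have mVl : L2 nu (V n left_f) by apply: L2_koopman_pow; exact: L2_left_f.
have mVb : L2 nu (V n both_f) by apply: L2_koopman_pow; exact: L2_both_f.
have mr := L2_right_f; have ma := L2_antisym_f; have mc := L2_cross.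
have left_cross q : inner nu (V n left_f) (cross q) = 0.
  by rewrite inner_koopman_tensor// koopman_pow_cst inner_1U mulr0.
have antiE (u : X * X -> C) : L2 nu u ->
    inner nu u antisym_f = inner nu u (cross (0, 1)) - inner nu u (cross (1, 0)).
  move=> mu_; rewrite -(innerNr mu_ (mc (1, 0))).
  exact: (innerDr (mc (0, 1)) (L2N (mc (1, 0))) mu_).
rewrite koopman_powDfun (innerDl mVl mVb (L2D mr ma)).
rewrite (innerDr mr ma mVl) (innerDr mr ma mVb) !antiE// !left_cross !inner_koopman_cross /=.
have -> : inner nu (V n left_f) right_f = 0 by rewrite inner_koopman_tensor// inner_U1 mul0r.
have -> : inner nu (V n both_f) right_f = 0.
  by rewrite inner_koopman_tensor// (inner_U1 n) mul0r.
by rewrite !(addr0, subr0, add0r) [X in _ - X]mulrC subrr.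
Qed.

Lemma cyclic_vectors_orthogonal m n g h : m <> n ->
  orbit S (cyclic_vectors m) g -> orbit S (cyclic_vectors n) h -> inner nu g h = 0.
Proof.
have H i j : inner nu (V i first_vector) (V j second_vector) = 0.
  rewrite inner_koopman_pow; [|exact: (mF 0)|exact: (mF 1)].
  exact: first_second_orthogonal.
have H0 i (u : X * X -> C) : L2 nu u -> inner nu (V i (fun=> 0)) u = 0.
  by move=> mu_; rewrite koopman_powE; exact: inner_0l.
have H0' i (u : X * X -> C) : L2 nu u -> inner nu u (V i (fun=> 0)) = 0.
  move=> mu_; rewrite innerC ?H0 ?conjC0//.
  by apply: L2_koopman_pow; exact: L2_0fun.
move=> mn [i _ <-] [j _ <-].
have mV n' i' : L2 nu (V i' (cyclic_vectors n')) by exact: L2_koopman_pow.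
case: m n mn => [|[|m]] [|[|n]] // _.
- exact: (H0' j _ (mV 0%N i)).
- by rewrite (innerC (mV 0%N j) (mV 1%N i)) (H j i) conjC0.
- exact: (H0' j _ (mV 1%N i)).
- exact: (H0 i _ (mV 0%N j)).
- exact: (H0 i _ (mV 1%N j)).
- exact: (H0 i _ (mV n.+2 j)).
Qed.

Section null_sets.
Variable A : set T1.
Hypothesis mA : measurable A.
Local Notation N := (spectral_null S A).

Let null_orbit F g : N F -> closed_span nu (orbit S F) g -> N g.
Proof.
move=> NF; apply: (spectral_null_closed_span mA) => _ [n _ <-].
exact: spectral_null_koopman.
Qed.

Let correlation_cross p n : correlation S (cross p) n = c n * c n.
Proof. by rewrite [LHS]inner_koopman_cross !addrK. Qed.

Definition cross_diff (p : int * int) : X * X -> C :=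
  fun z => cross (p.1, p.2 + 1) z - cross (p.1 + 1, p.2) z.

Let L2_cross_diff p : L2 nu (cross_diff p).
Proof. by apply: L2B; exact: L2_cross. Qed.

Let correlation_cross_diff p n : correlation S (cross_diff p) n =
  c n * c n - c (n - 1) * c (n + 1) - (c (n + 1) * c (n - 1) - c n * c n).
Proof.
have mc := L2_cross; have mVc q : L2 nu (V n (cross q)) by exact: L2_koopman_pow.
rewrite /correlation koopman_powBfun innerBB// !inner_koopman_cross /=.
case: p => i j /=.
have -> : n + i - (i + 1) = n - 1 by ring.
have -> : n + (j + 1) - j = n + 1 by ring.
have -> : n + (i + 1) - i = n + 1 by ring.
have -> : n + j - (j + 1) = n - 1 by ring.
by rewrite !addrK.
Qed.

Lemma null_left_right : N left_f <-> N right_f.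
Proof.
have E n : correlation S right_f n = correlation S left_f n.
  by rewrite [LHS]spectral_right_f [RHS]spectral_left_f.
split=> H; apply: (spectral_null_correlation H).
- exact: L2_right_f.
- exact: E.
- exact: L2_left_f.
- by move=> n; rewrite E.
Qed.

Lemma null_cross p : N both_f -> N (cross p).
Proof.
move=> H; apply: (spectral_null_correlation H); first exact: L2_cross.
by move=> n; rewrite !correlation_cross.
Qed.

Lemma null_sub F G : N F -> N G -> N (fun z => F z - G z).
Proof.
move=> NF /(spectral_nullZ mA (-1)) NG; have := spectral_nullD mA NF NG.
by congr spectral_null; apply/funext => z; rewrite mulN1r.
Qed.

(** Exchanging the factors, or moving one factor along its orbit, does not change the
    correlations of a product vector. *)
Lemma null_first_second : N first_vector -> N second_vector.
Proof.
move=> N1; have Nl : N left_f := null_orbit N1 closed_span_first_left.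
have Nb : N both_f.
  have := null_sub N1 Nl; congr spectral_null.
  by apply/funext => z; rewrite /first_vector addrC addKr.
apply: (spectral_nullD mA); first exact/null_left_right.
by apply: null_sub; exact: null_cross.
Qed.

(** Translates of the antisymmetric vector have the same correlations, and [f (x) f] lies in
    their closed span, as [1] lies in that of the multiples of [z - w]. *)
Lemma null_second_first : N second_vector -> N first_vector.
Proof.
move=> N2; have Nr : N right_f := null_orbit N2 closed_span_second_right.
have Na : N antisym_f.
  have := null_sub N2 Nr; congr spectral_null.
  by apply/funext => z; rewrite /second_vector addrC addKr.
apply: (spectral_nullD mA); first exact/null_left_right.
have Nd p : N (cross_diff p).
  apply: (spectral_null_correlation Na); first exact: L2_cross_diff.
  move=> n; rewrite correlation_cross_diff.
  have := correlation_cross_diff (0, 0) n => <-.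
  by rewrite /cross_diff /= !add0r.
pose B := range cross_diff.
have BL h : B h -> L2 nu h by move=> [p _ <-]; exact: L2_cross_diff.
have E Z (b : int * int -> Z -> C) p q z : combo b [:: (1, p); (-1, q)] z = b p z - b q z.
  by rewrite /combo big_cons big_seq1 mul1r mulN1r.
have E1 Z (b : int * int -> Z -> C) z : combo b [:: (1, (0, 0))] z = b (0, 0) z.
  by rewrite /combo big_seq1 mul1r.
have : closed_span nu B (combo cross [:: (1, (0, 0))]).
  apply: (@transport (int * int)%type (fun p => [:: (1, (p.1 + 1, p.2)); (-1, (p.1, p.2 + 1))]) _
    (diff_gen zeta)) => //.
  - move=> _ [p _ <-]; exists p => z; rewrite E.
    by rewrite /echi /tensor /= !(chiD z1) !chi1; ring.
  - move=> p; apply: closed_span_eq (closed_spanZ BL (-1) (closed_span_gen BL (imageP _ (I : setT p)))) _ => z.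
    by rewrite E /cross_diff mulN1r opprB.
  - by apply: closed_span_eq dif _ => z; rewrite E1 echi0.
move=> /(spectral_null_closed_span mA (S := B)) Nc.
have : N (combo cross [:: (1, (0, 0))]) by apply: Nc => _ [p _ <-].
by congr spectral_null; apply/funext => z; rewrite E1.
Qed.

Lemma null_all F : N first_vector -> L2_0 nu F -> N F.
Proof.
move=> N1 /L2_0_spanned; apply: (spectral_null_closed_span mA) => _ [n _ [m _ <-]].
apply: spectral_null_koopman.
case: n => [|[|n]]; [exact: N1|exact: null_first_second|exact: spectral_null0].
Qed.

End null_sets.

Lemma homogeneous_square : homogeneous_spectrum S 2.
Proof.
have [sigma Hs] := herglotz S (mF 0).
exists sigma, (fun=> 2%:R%:E); split; last exact: aeW.
have sigma_null B : measurable B -> sigma B = 0%E -> spectral_null S B first_vector.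
  by move=> mB B0; exact: (spectral_nullP mB (mF 0) Hs B0).
split.
  split.
    move=> g tau g0 gtau; apply/null_content_dominatesP => B mB B0.
    by have [_] := null_all mB (sigma_null _ mB B0) g0; apply.
  by exists first_vector, sigma; split; [exact: L2_0_first_vector|exact: Hs|].
pose A n : set T1 := if (n < 2)%N then setT else set0.
have mA n : measurable (A n) by rewrite /A; case: ifP.
exists cyclic_vectors, A, mA; split.
- split; first exact: L2_0_cyclic_vectors.
  by move=> m n mn g h; exact: cyclic_vectors_orthogonal.
- exact: L2_0_spanned.
- by move=> [|[|n]].
- move=> n; have [tau Ht] := herglotz S (mF n); exists tau; split => //.
  have restrT B : (n < 2)%N -> mrestr sigma (mA n) B = sigma B.
    by rewrite /mrestr /A => ->; rewrite setIT.
  have restr0 B : (2 <= n)%N -> mrestr sigma (mA n) B = 0%E.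
    by rewrite /mrestr /A leqNgt => /negbTE ->; rewrite setI0 measure0.
  have tau_null B : measurable B -> tau B = 0%E -> spectral_null S B (cyclic_vectors n).
    by move=> mB B0; exact: (spectral_nullP mB (mF n) Ht B0).
  split; apply/null_content_dominatesP => B mB.
    case: n => [|[|n]] in tau Ht restrT restr0 tau_null *.
    - by move=> /(etrans (esym (restrT B isT)))/(sigma_null _ mB)[_]; apply.
    - move=> /(etrans (esym (restrT B isT)))/(sigma_null _ mB)/(null_first_second mB)[_].
      exact.
    - by move=> _; have [_] := spectral_null0 S mB; apply.
  case: n => [|[|n]] in tau Ht restrT restr0 tau_null *.
  - by move=> /(tau_null _ mB)[_ tau0]; apply: (etrans (restrT B isT)); exact: tau0.
  - move=> /(tau_null _ mB)/(null_second_first mB)[_ tau0].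
    by apply: (etrans (restrT B isT)); exact: tau0.
  - by move=> _; exact: restr0.
- move=> z; apply/esym/cvg_lim => //; apply: cvg_near_cst; exists 2%N => // n /= n2.
  rewrite (@big_cat_nat _ _ _ 2)//= [X in (_ + X)%E]big_nat [X in (_ + X)%E]big1 ?adde0.
    rewrite big_nat_recr//= big_nat1 /A /= indicE in_setT -EFinD.
    by congr (_%:E); rewrite -natrD.
  by move=> i /andP[i2 _]; rewrite /A ltnNge i2 /= indicE in_set0.
Qed.

End square_of_cyclic.

Theorem square_homogeneous {R : realType} {d : measure_display} {X : measurableType d}
    {mu : probability X R} (T : automorphism mu) (a : R) (k : nat -> int) :
  ergodic T -> 0 < a -> a < 1 ->
  weak_operator_cvg mu (fun i => koopman_pow T (k i))
    (fun f x => a%:C * f x + (1 - a)%:C * koopman T f x) ->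
  simple_spectrum T -> homogeneous_spectrum (prod_automorphism T T) 2.
Proof.
move=> T_ergodic a0 a1 T_cvg [f [mf0 f_cyclic]]; have [mf f0] := mf0.
have [rho f_rho] := herglotz T mf.
have mz := @cmeasurable_circle_val R; have z1 := @sqc_circle_val R.
have lim := spectral_limit_coef T_cvg mf f_rho.
have n0 := weak_limit_neq0 a0; have n1 := weak_limit_neq1 a1.
apply: (homogeneous_square mf0 f_rho f_cyclic).
- by move=> e e0; exact: (spectral_separating_polynomial T_ergodic a0 a1 T_cvg mf0 f_rho e0).
- exact: (closed_span_symmetric mz z1 n0 n1 lim lim).
- exact: (closed_span_antisymmetric mz z1 n0 n1 lim lim).
- apply: (closed_span_diff_cst1 mz z1 (weak_limit_conj a) n0 n1 lim lim).
  exact: (spectral_measure_no_mass1 mf f_rho T_ergodic f0).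
Qed.

Theorem theorem2p1 (R : realType) (d : measure_display) (X : measurableType d)
    (mu : probability X R) (T : automorphism mu) (a : R) (k : nat -> int)
    (mu_lebesgue : lebesgue_space mu)
    (T_ergodic : ergodic T)
    (a_gt0 : 0 < a) (a_lt1 : a < 1)
    (k_oo : forall m : int, \forall i \near \oo, m <= k i)
    (T_cvg : weak_operator_cvg mu (fun i => koopman_pow T (k i))
      (fun f x => a%:C * f x + (1 - a)%:C * koopman T f x)) :
  (forall sigma : {finite_measure set (circle R) -> \bar R},
    maximal_spectral_type T sigma ->
    mutually_singular sigma (convolution sigma sigma)) /\
  (simple_spectrum T -> homogeneous_spectrum (prod_automorphism T T) 2).

Proof.
split; first exact: (spectral_type_singular T_ergodic a_gt0 a_lt1 T_cvg).
exact: (square_homogeneous T_ergodic a_gt0 a_lt1 T_cvg).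
Qed.
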